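(* Let $\alpha\in(0,1)$. There exists a weak physical solution $v_0\in L^\infty((0,2)\times\mathbb{T}^3)$ of the 3-dimensional forced Euler equations with initial datum $v_{\mathrm{in}}\in C^\infty$ and force $F_0\in C^\alpha$, for which there exists $\varepsilon>0$ such that the vanishing viscosity sequence $\{v_\nu\}_{\nu>0}\subset C^\infty$ of solutions of the 3-dimensional forced Navier--Stokes equations with viscosity $\nu$ and forces $F_\nu$ (the sequence realizing $v_0$ as a weak physical solution) satisfies $\sup_{\nu>0}\|v_\nu\|_{L^\infty}<\infty$, $F_\nu\to F_0$ in $C^\alpha$ as $\nu\to0$, and $$\|v_\nu-v_0\|_{L^p}\ge\varepsilon\qquad\text{for any }p\in[1,\infty],$$ where the norms are over $(0,2)\times\mathbb{T}^3$.
   Context: $\mathbb{T}^3\simeq\mathbb{R}^3/\mathbb{Z}^3$. The forced Navier--Stokes equations are $\partial_tv_\nu+v_\nu\cdot\nabla v_\nu+\nabla p_\nu=\nu\Delta v_\nu+F_\nu$, $\operatorname{div}v_\nu=0$; for $\nu=0$ they are the forced Euler equations. Weak physical solution (on $(0,2)\times\mathbb{T}^3$): let $v\in L^3((0,2)\times\mathbb{T}^3)$ be a distributional solution of the incompressible Euler equations with force $F_0\in L^{3/2}$ and divergence-free initial datum $v_{\mathrm{in}}\in L^2$. It is a weak physical solution if: (1) there is a sequence of initial data $\{v_{\mathrm{in},\nu}\}_{\nu>0}$ with $v_{\mathrm{in},\nu}\to v_{\mathrm{in}}$ in $L^2$; (2) there is a sequence of suitable Leray--Hopf solutions (Leray--Hopf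 weak solutions satisfying the local energy inequality of Caffarelli--Kohn--Nirenberg) $\{v_\nu\}_{\nu>0}\subset L^3_{t,x}$ of the Navier--Stokes equations with viscosity $\nu$, initial data $v_{\mathrm{in},\nu}$ and forces $F_\nu$, and a subsequence $\nu_q\to0$ along which $v_{\nu_q}\rightharpoonup v$ in the sense of distributions; (3) the forces satisfy either $\sup_{\nu>0}\|F_\nu\|_{L^{1+\sigma}((0,2);C^\sigma(\mathbb{T}^3))}<\infty$ for some $\sigma>0$, or $F_\nu\to F_0$ in $L^1((0,2);L^2(\mathbb{T}^3))$. *)

(* Defs.v *)
From HB Require Import structures.
From mathcomp Require Import all_boot all_order all_algebra.
From mathcomp Require Import all_classical all_reals all_analysis.
From mathcomp Require Import measurable_realfun.

Set Implicit Arguments.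
Unset Strict Implicit.
Unset Printing Implicit Defensive.

Import Order.TTheory GRing.Theory Num.Theory.
Import numFieldNormedType.Exports.

Local Open Scope classical_set_scope.
Local Open Scope ring_scope.

(* Functions on T^3 = R^3/Z^3 are Z^3-periodic functions on R * R * R,
   integrated over the cube [0,1[^3.  Functions on (0,2) x T^3 are total
   functions on R * (R * R * R) of which only the values at times in ]0,2[
   are ever used. *)
Notation space R := (R * R * R)%type.
Notation spacetime R := (R * (R * R * R))%type.
Notation sfield R := (R * R * R -> 'rV[R]_3).
Notation vfield R := (R * (R * R * R) -> 'rV[R]_3).

(* measurableTypeR R is R with the sigma-algebra on which the library defines
   lebesgue_measure *)
Notation mspace R :=
  (measurableTypeR R * measurableTypeR R * measurableTypeR R)%type.
Notation mspacetime R := (measurableTypeR R * mspace R)%type.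

(* the library's sigma-finite instance for m1 \x m2 is not found by
   inference: it is shadowed by the one for products of subprobabilities *)
Lemma product_measure_sigma_finite (R : realType) (d1 d2 : measure_display)
    (T1 : measurableType d1) (T2 : measurableType d2)
    (m1 : {sigma_finite_measure set T1 -> \bar R})
    (m2 : {sigma_finite_measure set T2 -> \bar R}) :
  sigma_finite setT (m1 \x m2)%E.
Proof.
have /sigma_finiteP[F [TF ndF Foo]] := sigma_finiteT m1.
have /sigma_finiteP[G [TG ndG Goo]] := sigma_finiteT m2.
exists (fun n => F n `*` G n).
  rewrite -setXTT TF TG predeqE => -[x y]; split.
    move=> [/= [n _ Fnx] [k _ Gky]]; exists (maxn n k) => //; split.
    - by move: x Fnx; exact/subsetPset/ndF/leq_maxl.
    - by move: y Gky; exact/subsetPset/ndG/leq_maxr.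
  by move=> [n _ []/= ? ?]; split; exists n.
move=> k; have [? ?] := Foo k; have [? ?] := Goo k.
split; first exact: measurableX.
by rewrite product_measure1E// lte_mul_pinfty// ge0_fin_numE.
Qed.

Definition leb1 (R : realType) :
    {sigma_finite_measure set (measurableTypeR R) -> \bar R} :=
  lebesgue_measure.
Arguments leb1 R : clear implicits.

Definition leb2 (R : realType)
    : set (measurableTypeR R * measurableTypeR R) -> \bar R :=
  (leb1 R \x leb1 R)%E.
Arguments leb2 R : clear implicits.
HB.instance Definition _ (R : realType) := Measure.on (leb2 R).
HB.instance Definition _ (R : realType) :=
  Measure_isSigmaFinite.Build _ _ _ (leb2 R)
    (product_measure_sigma_finite (leb1 R) (leb1 R)).

Definition leb3 (R : realType) : set (mspace R) -> \bar R :=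
  (leb2 R \x leb1 R)%E.
Arguments leb3 R : clear implicits.
HB.instance Definition _ (R : realType) := Measure.on (leb3 R).
HB.instance Definition _ (R : realType) :=
  Measure_isSigmaFinite.Build _ _ _ (leb3 R)
    (product_measure_sigma_finite (leb2 R) (leb1 R)).

Definition leb4 (R : realType) : set (mspacetime R) -> \bar R :=
  (leb1 R \x leb3 R)%E.
Arguments leb4 R : clear implicits.
HB.instance Definition _ (R : realType) := Measure.on (leb4 R).
HB.instance Definition _ (R : realType) :=
  Measure_isSigmaFinite.Build _ _ _ (leb4 R)
    (product_measure_sigma_finite (leb1 R) (leb3 R)).

Definition timeI (R : realType) : set (measurableTypeR R) := (`]0, 2[ : set R).
Definition cube (R : realType) : set (mspace R) :=
  ((`[0, 1[ `*` `[0, 1[) `*` `[0, 1[ : set (space R)).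
(* (0,t) x T^3 *)
Definition slab (R : realType) (t : R) : set (mspacetime R) :=
  ((`]0, t[ : set R) `*` @cube R : set (spacetime R)).
(* the same with T^3 unrolled to its universal cover R^3 *)
Definition strip (R : realType) : set (spacetime R) := `]0, 2[ `*` setT.

Definition evec (R : realType) (i : 'I_3) : space R :=
  ((val i == 0%N)%:R, (val i == 1%N)%:R, (val i == 2%N)%:R).

Definition periodic (R : realType) (Y : Type) (g : space R -> Y) : Prop :=
  forall (x : space R) (i : 'I_3), g (x + evec R i) = g x.
Definition xperiodic (R : realType) (Y : Type) (f : spacetime R -> Y) : Prop :=
  forall t : R, periodic (fun x => f (t, x)).

(* Euclidean norm of a vector, Frobenius norm of a matrix *)
Definition enorm (R : realType) (m n : nat) (A : 'M[R]_(m, n)) : R :=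
  Num.sqrt (\sum_i \sum_j A i j ^+ 2).
Definition dotp (R : realType) (u w : 'rV[R]_3) : R :=
  \sum_i u 0 i * w 0 i.

Fixpoint Ck (R : realType) (V : normedModType R) (U : set V) (k : nat)
    (f : V -> R) : Prop :=
  (forall x, U x -> {for x, continuous f}) /\
  if k is k'.+1 then
    forall w : V, (forall x, U x -> derivable f x w) /\
                  Ck U k' (fun x => 'D_w f x)
  else True.
(* meaningful for open U *)
Definition smooth_on (R : realType) (V : normedModType R) (U : set V)
    (f : V -> R) : Prop := forall k, Ck U k f.

Definition Dt (R : realType) (phi : spacetime R -> R) (z : spacetime R) : R :=
  'D_((1, 0) : spacetime R) phi z.
Definition Dx (R : realType) (i : 'I_3) (phi : spacetime R -> R)
    (z : spacetime R) : R := 'D_((0, evec R i) : spacetime R) phi z.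
Definition laplacian (R : realType) (phi : spacetime R -> R)
    (z : spacetime R) : R := \sum_(i < 3) Dx i (Dx i phi) z.

(* C^oo_c([0,2) x T^3) and C^oo_c((0,2) x T^3) *)
Definition test0 (R : realType) (phi : spacetime R -> R) : Prop :=
  [/\ smooth_on setT phi, xperiodic phi
    & exists2 d : R, 0 < d & forall t x, 2 - d < t -> phi (t, x) = 0].
Definition test (R : realType) (phi : spacetime R -> R) : Prop :=
  test0 phi /\ exists2 d : R, 0 < d & forall t x, t < d -> phi (t, x) = 0.

Definition Lp_norm (R : realType) (d : measure_display) (T : measurableType d)
    (mu : {measure set T -> \bar R}) (D : set T) (p : \bar R)
    (m n : nat) (f : T -> 'M[R]_(m, n)) : \bar R :=
  'N[mu]_p[(fun x => (enorm (f x))%:E) \_ D]%E.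
Definition in_Lp (R : realType) (d : measure_display) (T : measurableType d)
    (mu : {measure set T -> \bar R}) (D : set T) (p : \bar R)
    (m n : nat) (f : T -> 'M[R]_(m, n)) : Prop :=
  (forall i j, measurable_fun D (fun x => f x i j)) /\
  (Lp_norm mu D p f < +oo)%E.

(* L^p((0,2); L^q(T^3)) *)
Definition LpLq_norm (R : realType) (p q : \bar R) (f : vfield R) : \bar R :=
  'N[leb1 R]_p[(fun t => Lp_norm (leb3 R) (@cube R) q
                            (fun x => f (t, x))) \_ (@timeI R)]%E.
Definition in_LpLq (R : realType) (p q : \bar R) (f : vfield R) : Prop :=
  (forall i j, measurable_fun (@slab R 2) (fun z => f z i j)) /\
  (LpLq_norm p q f < +oo)%E.

(* Hoelder norm sup |f| + [f]_a on D.  Distances in the domain are those of the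
   library's (max) norm on products, equivalent to the Euclidean one.  For a
   periodic function on R^3 or the strip, the Hoelder quotient over all pairs
   has the same supremum as the one for the distance of the torus. *)
Definition holder_norm (R : realType) (V : normedModType R) (D : set V) (a : R)
    (f : V -> 'rV[R]_3) : \bar R :=
  (ereal_sup [set (enorm (f z))%:E | z in D] +
   ereal_sup [set (enorm (f zw.1 - f zw.2) / `|zw.1 - zw.2| `^ a)%R%:E
             | zw in [set zw : V * V | [/\ D zw.1, D zw.2 & zw.1 != zw.2]]])%E.

(* t |-> the norm of f(t) in C^s(T^3) *)
Definition Cs_norm (R : realType) (s : R) (f : vfield R) (t : R) : \bar R :=
  holder_norm [set: space R] s (fun x => f (t, x)).

(* L^p((0,2); C^s(T^3)), for 0 < s < 1; the measurability in time of the C^s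
   norm is required separately, in in_LpCs *)
Definition LpCs_norm (R : realType) (p : \bar R) (s : R) (f : vfield R)
    : \bar R :=
  'N[leb1 R]_p[(Cs_norm s f) \_ (@timeI R)]%E.
Definition in_LpCs (R : realType) (p : \bar R) (s : R) (f : vfield R) : Prop :=
  [/\ forall i j, measurable_fun (@slab R 2) (fun z => f z i j),
      measurable_fun (@timeI R) (Cs_norm s f)
    & (LpCs_norm p s f < +oo)%E].

Definition divergence_free (R : realType) (v : vfield R) : Prop :=
  forall phi, test phi ->
    \int[leb4 R]_(z in @slab R 2) (\sum_i v z 0 i * Dx i phi z) = 0.
Definition divergence_free_datum (R : realType) (vin : sfield R) : Prop :=
  forall psi : space R -> R, smooth_on setT psi -> periodic psi ->
    \int[leb3 R]_(x in @cube R) (\sum_i vin x 0 i * 'D_(evec R i) psi x) = 0.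

(* d_t v + div (v (x) v) + grad p = nu Laplacian v + F, v(0) = vin, in the
   sense of distributions on [0,2) x T^3; nu = 0 is the Euler equation *)
Definition momentum_equation (R : realType) (nu : R) (vin : sfield R)
    (F v : vfield R) (p : spacetime R -> R) : Prop :=
  forall (phi : spacetime R -> R) (i : 'I_3), test0 phi ->
    \int[leb4 R]_(z in @slab R 2)
       (v z 0 i * Dt phi z + \sum_j v z 0 i * v z 0 j * Dx j phi z
        + p z * Dx i phi z + nu * v z 0 i * laplacian phi z
        + F z 0 i * phi z)
    + \int[leb3 R]_(x in @cube R) (vin x 0 i * phi (0, x)) = 0.

(* p in L^{3/2}((0,2) x T^3), the integrability matching v in L^3 *)
Definition pressure (R : realType) (p : spacetime R -> R) : Prop :=
  xperiodic p /\
  in_Lp (leb4 R) (@slab R 2) (3 / 2)%:E (fun z => (p z)%:M : 'M[R]_1).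

Definition initial_datum (R : realType) (vin : sfield R) : Prop :=
  [/\ periodic vin, in_Lp (leb3 R) (@cube R) 2%:E vin
    & divergence_free_datum vin].

Definition euler_solution (R : realType) (vin : sfield R) (F v : vfield R)
    : Prop :=
  [/\ initial_datum vin,
      xperiodic F /\ in_Lp (leb4 R) (@slab R 2) (3 / 2)%:E F,
      xperiodic v /\ in_Lp (leb4 R) (@slab R 2) 3%:E v,
      divergence_free v
    & exists2 p, pressure p & momentum_equation 0 vin F v p].

(* G i j = d_j v_i *)
Definition weak_gradient (R : realType) (v : vfield R)
    (G : spacetime R -> 'M[R]_3) : Prop :=
  forall (phi : spacetime R -> R) (i j : 'I_3), test phi ->
    \int[leb4 R]_(z in @slab R 2) (v z 0 i * Dx j phi z) =
    - \int[leb4 R]_(z in @slab R 2) (G z i j * phi z).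

Definition weakly_continuous (R : realType) (v : vfield R) : Prop :=
  (forall t, 0 < t < 2 ->
     in_Lp (leb3 R) (@cube R) 2%:E (fun x => v (t, x))) /\
  (forall w : sfield R, in_Lp (leb3 R) (@cube R) 2%:E w ->
     {in `]0, 2[, continuous (fun t : R =>
        \int[leb3 R]_(x in @cube R) dotp (v (t, x)) (w x))}).

Definition energy_inequality (R : realType) (nu : R) (vin : sfield R)
    (F v : vfield R) (G : spacetime R -> 'M[R]_3) : Prop :=
  forall t : R, 0 < t < 2 ->
    2^-1 * \int[leb3 R]_(x in @cube R) (enorm (v (t, x)) ^+ 2)
    + nu * \int[leb4 R]_(z in @slab R t) (enorm (G z) ^+ 2)
    <= 2^-1 * \int[leb3 R]_(x in @cube R) (enorm (vin x) ^+ 2)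
       + \int[leb4 R]_(z in @slab R t) dotp (F z) (v z).

(* Leray-Hopf weak solution v with gradient G and pressure p *)
Definition leray_hopf (R : realType) (nu : R) (vin : sfield R) (F v : vfield R)
    (G : spacetime R -> 'M[R]_3) (p : spacetime R -> R) : Prop :=
  [/\ [/\ initial_datum vin, xperiodic F & in_LpLq 1%:E 2%:E F],
      [/\ xperiodic v, in_LpLq +oo%E 2%:E v, weakly_continuous v
        & (fun t => Lp_norm (leb3 R) (@cube R) 2%:E
                      (fun x => v (t, x) - vin x)) @ 0^'+ --> 0%E],
      [/\ xperiodic G, in_Lp (leb4 R) (@slab R 2) 2%:E G
        & weak_gradient v G],
      [/\ divergence_free v, pressure p & momentum_equation nu vin F v p]
    & energy_inequality nu vin F v G].

(* Caffarelli-Kohn-Nirenberg *)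
Definition local_energy_inequality (R : realType) (nu : R) (F v : vfield R)
    (G : spacetime R -> 'M[R]_3) (p : spacetime R -> R) : Prop :=
  forall phi : spacetime R -> R, test phi -> (forall z, 0 <= phi z) ->
    2 * nu * \int[leb4 R]_(z in @slab R 2) (enorm (G z) ^+ 2 * phi z)
    <= \int[leb4 R]_(z in @slab R 2)
         (enorm (v z) ^+ 2 * (Dt phi z + nu * laplacian phi z)
          + (enorm (v z) ^+ 2 + 2 * p z) * (\sum_i v z 0 i * Dx i phi z)
          + 2 * dotp (F z) (v z) * phi z).

Definition suitable_leray_hopf (R : realType) (nu : R) (vin : sfield R)
    (F v : vfield R) : Prop :=
  exists G p, leray_hopf nu vin F v G p /\ local_energy_inequality nu F v G p.

(* the families vn, vinn, Fn, indexed by the viscosity nu > 0, realize v as a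
   vanishing viscosity limit; s < 1 is no restriction in the first alternative
   since the spaces L^{1+s}((0,2); C^s) decrease with s *)
Definition vanishing_viscosity_sequence (R : realType) (vin : sfield R)
    (F v : vfield R) (vinn : R -> sfield R) (Fn vn : R -> vfield R) : Prop :=
  [/\ (fun nu => Lp_norm (leb3 R) (@cube R) 2%:E
                   (fun x => vinn nu x - vin x)) @ 0^'+ --> 0%E,
      forall nu, 0 < nu -> suitable_leray_hopf nu (vinn nu) (Fn nu) (vn nu) /\
        in_Lp (leb4 R) (@slab R 2) 3%:E (vn nu),
      exists nuq : nat -> R,
        [/\ forall q, 0 < nuq q, nuq @ \oo --> (0 : R)
          & forall (phi : spacetime R -> R) (i : 'I_3), test phi ->
            (fun q => \int[leb4 R]_(z in @slab R 2) (vn (nuq q) z 0 i * phi z))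
              @ \oo -->
            \int[leb4 R]_(z in @slab R 2) (v z 0 i * phi z)]
    & (exists s : R, [/\ 0 < s < 1,
         forall nu, 0 < nu -> in_LpCs (1 + s)%:E s (Fn nu)
       & (ereal_sup [set LpCs_norm (1 + s)%R%:E s (Fn nu)
                    | nu in [set nu : R | (0 < nu)%R]] < +oo)%E]) \/
      (fun nu => LpLq_norm 1%:E 2%:E (fun z => Fn nu z - F z)) @ 0^'+
        --> 0%E].

Definition weak_physical_solution (R : realType) (vin : sfield R)
    (F v : vfield R) : Prop :=
  euler_solution vin F v /\
  exists vinn Fn vn, vanishing_viscosity_sequence vin F v vinn Fn vn.

(* Main.v *)
(* The viscous solutions are v = (p (t, y), r (t, x), Theta (t, x, y)),
   with zero pressure, where at each time at most one of p and r is nonzero.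
   On the time interval [k / (k + 1), (k + 1) / (k + 2)] the planar velocity is
   an oscillating shear in one direction, of rapidly growing frequency n k, and
   the directions alternate; the displacement of the k-th shear is of size
   1 / n k, so that velocities, and even the time derivatives that make up the
   force, are summable in Hoelder norm.  The third component Theta is a sine
   wave transported by these shears.  Stopping after an even number q of
   shears and letting q tend to infinity slowly as nu -> 0, so that nu times
   the Laplacian of v is small, gives the smooth solutions of Navier-Stokes.
   The displacements of the k-th shear, seen on the scale 1 / n k, are almost
   equidistributed.  Hence for t >= 1 the waves, whose L^2 norm is constant,
   converge weakly but not strongly, to a profile bounded by 1 / 4; since Theta
   enters the equations linearly (the term d_z (Theta ^ 2) integrates to 0), the
   weak limit solves the Euler equations with the limit force, while it stays
   at a positive distance from every viscous solution. *)
Require Import Defs.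
From mathcomp Require Import all_boot all_order all_algebra.
From mathcomp Require Import all_classical all_reals all_analysis.
From mathcomp Require Import measurable_realfun ess_sup_inf ring lra zify.

Set Implicit Arguments.
Unset Strict Implicit.
Unset Printing Implicit Defensive.

Import Order.TTheory GRing.Theory Num.Theory.
Import numFieldNormedType.Exports.

Local Open Scope classical_set_scope.
Local Open Scope ring_scope.

(** * Smooth functions *)

Section SmoothClass.
Context {R : realType}.

(** Two demands on the frequencies pull in opposite directions. Stage k displaces by 1 / n_k and
    oscillates at n_(k+1), so its force costs about n_(k+1)^alpha / n_k in C^alpha: n_(k+1) must
    stay below n_k^(1/alpha). Mixing wants n_(k+1) / n_k large: after k stages the wave has
    Lipschitz constant of order 3^k n_k, and stage k errs by a multiple of 3^k (n_k / n_(k+1) +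
    d_k), where d_k measures the rounding of its profile. With n_k = 2^(2 (k + K)^2) the ratios grow
    geometrically while n_(k+1) = n_k^(1 + o(1)); a large offset K then serves any given alpha < 1
    and absorbs the factors due to ever shorter stages. The bound 1/4 of the limit profile arises
    because the initial sine averages to exactly 0 over a wavelength and the mixing errors are tuned
    to sum to 1/4. The squared wave has mean 1/2, so for t >= 1 the L^1 distance is at least 1/4;
    with the sup bound 5/4 this yields a set of measure at least 1/16 where the difference is at
    least 1/8, hence one epsilon for all p. The viscous force is the residual of the equation, so
    each v_nu is an exact smooth solution and its energy balances are equalities. *)

Lemma is_derive_addf {V : normedModType R} (f g : V -> R) x w a b :
  is_derive x w f a -> is_derive x w g b ->
  is_derive x w (fun y => f y + g y) (a + b).
Proof. by move=> df dg; exact: (is_deriveD df dg). Qed.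

Lemma is_derive_mulf {V : normedModType R} (f g : V -> R) x w a b :
  is_derive x w f a -> is_derive x w g b ->
  is_derive x w (fun y => f y * g y) (f x * b + g x * a).
Proof. by move=> df dg; exact: (is_deriveM df dg). Qed.

(** Restriction to the line through x with direction w turns a directional derivative into an
    ordinary one, so that one-variable rules, in particular the chain rule, apply in any normed
    space. *)
Lemma is_derive_line {V : normedModType R} (f : V -> R) x w df :
  is_derive x w f df <-> is_derive (0 : R) 1 (fun h : R => f (h *: w + x)) df.
Proof.
have E : 'D_w f x = 'D_1 (fun h : R => f (h *: w + x)) 0.
  rewrite /derive; set g1 := fun h => h^-1 *: _; set g2 := fun h => h^-1 *: _.
  suff -> : g1 = g2 by [].
  by apply/funext => h; rewrite /g1 /g2 /= addr0 scale0r add0r [_%:A]mulr1.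
split=> -[d <-].
  by apply: DeriveDef => //; apply/(derivable1P f x w).
by apply: DeriveDef => //; apply/(derivable1P f x w).
Qed.

Lemma is_derive_comp1 {V : normedModType R} (phi : R -> R) (g : V -> R) x w a b :
  is_derive (g x) 1 phi a -> is_derive x w g b ->
  is_derive x w (fun y => phi (g y)) (a * b).
Proof.
move=> Dphi /is_derive_line Dg; apply/is_derive_line.
apply: (@is_derive1_comp _ phi (fun h => g (h *: w + x)) 0 a b) => //.
by rewrite scale0r add0r.
Qed.

Lemma is_derive_linear {V : normedModType R} (l : V -> R) x w :
  (forall (h : R) u v, l (h *: u + v) = h * l u + l v) -> is_derive x w l (l w).
Proof.
move=> ll; apply/is_derive_line.
have -> : (fun h : R => l (h *: w + x)) = (fun h => l x + l w * h).
  by apply/funext => h; rewrite ll addrC mulrC.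
have D := is_derive_addf (is_derive_cst (l x) (0 : R) 1)
  (is_derive_mulf (is_derive_cst (l w) (0 : R) 1) (is_derive_id (0 : R) 1)).
by apply: (is_derive_eq D); rewrite add0r mulr0 addr0 /cst mulr1.
Qed.

Section Closure.
Context {V : normedModType R}.
Implicit Types (f g : V -> R) (k : nat).

Lemma eq_Ck (U : set V) k f g : f =1 g -> Ck U k f -> Ck U k g.
Proof. by move=> /funext ->. Qed.

Lemma Ck_setT k f (U : set V) : Ck setT k f -> Ck U k f.
Proof.
elim: k f => [|k IH] f /= [cf df]; split=> //; try by move=> x _; exact: cf.
move=> w.
by have [dw ck] := df w; split=> [x _|]; [exact: dw|exact: IH].
Qed.

Lemma CkW k f : Ck setT k.+1 f -> Ck setT k f.
Proof.
elim: k f => [|k IH] f [cf df]; first by split.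
by split=> // w; have [dw ck] := df w; split=> //; exact: IH.
Qed.

Lemma Ck_cst k (c : R) : Ck setT k (fun _ : V => c).
Proof.
elim: k c => [|k IH] c; split => //; try by move=> x _; exact: cvg_cst.
move=> w; split=> [x _|]; first exact: derivable_cst.
by apply: (eq_Ck _ (IH 0)) => x; rewrite -/(cst c) derive_cst.
Qed.

Lemma CkD k f g : Ck setT k f -> Ck setT k g -> Ck setT k (fun x => f x + g x).
Proof.
elim: k f g => [|k IH] f g [cf df] [cg dg].
  by split=> // x _; apply: cvgD; [exact: cf|exact: cg].
split=> [x _|w]; first by apply: cvgD; [exact: cf|exact: cg].
have [dfw ckf] := df w; have [dgw ckg] := dg w; split=> [x _|].
  by apply: derivableD; [exact: dfw|exact: dgw].
apply: (eq_Ck _ (IH _ _ ckf ckg)) => x.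
by rewrite -(deriveD (dfw x I) (dgw x I)).
Qed.

Lemma CkM k f g : Ck setT k f -> Ck setT k g -> Ck setT k (fun x => f x * g x).
Proof.
elim: k f g => [|k IH] f g.
  move=> [cf _] [cg _]; split=> // x _.
  by apply: cvgM; [exact: cf|exact: cg].
move=> hf hg; have := CkW hf; have := CkW hg; case: hf => cf df; case: hg => cg dg.
move=> hg hf; split=> [x _|w]; first by apply: cvgM; [exact: cf|exact: cg].
have [dfw ckf] := df w; have [dgw ckg] := dg w; split=> [x _|].
  by apply: derivableM; [exact: dfw|exact: dgw].
apply: (eq_Ck _ (CkD (IH _ _ hf ckg) (IH _ _ hg ckf))) => x.
by rewrite -[LHS](deriveM (dfw x I) (dgw x I)).
Qed.

Lemma eq_smooth f g : f =1 g -> smooth_on setT f -> smooth_on setT g.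
Proof. by move=> /funext ->. Qed.

Lemma smooth_cst (c : R) : smooth_on setT (fun _ : V => c).
Proof. by move=> k; exact: Ck_cst. Qed.

Lemma smoothD f g : smooth_on setT f -> smooth_on setT g ->
  smooth_on setT (fun x => f x + g x).
Proof. by move=> hf hg k; exact: CkD. Qed.

Lemma smoothM f g : smooth_on setT f -> smooth_on setT g ->
  smooth_on setT (fun x => f x * g x).
Proof. by move=> hf hg k; exact: CkM. Qed.

Lemma smoothN f : smooth_on setT f -> smooth_on setT (fun x => - f x).
Proof.
by move=> /(smoothM (smooth_cst (-1))); apply: eq_smooth => x; rewrite mulN1r.
Qed.

Lemma smoothB f g : smooth_on setT f -> smooth_on setT g ->
  smooth_on setT (fun x => f x - g x).
Proof. by move=> hf hg; apply: smoothD => //; exact: smoothN. Qed.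

Lemma smooth_sum n (f : 'I_n -> V -> R) : (forall i, smooth_on setT (f i)) ->
  smooth_on setT (fun x => \sum_i f i x).
Proof.
elim: n f => [|n IH] f hf.
  by apply: eq_smooth (smooth_cst 0) => x; rewrite big_ord0.
have := smoothD (hf ord0) (IH _ (fun i => hf (lift ord0 i))).
by apply: eq_smooth => x; rewrite big_ord_recl.
Qed.

Lemma smooth_derive w f : smooth_on setT f -> smooth_on setT ('D_w f).
Proof. by move=> hf k; have [_ /(_ w)[]] := hf k.+1. Qed.

Lemma smooth_is_derive w x f : smooth_on setT f -> is_derive x w f ('D_w f x).
Proof.
by move=> hf; apply: derivableP; have [_ /(_ w)[+ _]] := hf 1%N; apply.
Qed.

Lemma smooth_continuous f : smooth_on setT f -> continuous f.
Proof. by move=> hf x; have [+ _] := hf 0%N; apply. Qed.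

Lemma smooth_linear (l : V -> R) :
  (forall (h : R) u v, l (h *: u + v) = h * l u + l v) -> continuous l ->
  smooth_on setT l.
Proof.
move=> ll cl [|k]; split=> //; try by move=> x _; exact: cl.
move=> w; have D x : is_derive x w l (l w) by exact: is_derive_linear.
split=> [x _|]; first exact: ex_derive.
by apply: (eq_Ck _ (Ck_cst k (l w))) => x; rewrite derive_val.
Qed.

End Closure.

(** All derivatives are supplied at once as a sequence: the chain rule can then be iterated with any
    [d n] as the outer function. *)
Definition derivatives (f : R -> R) (d : nat -> R -> R) :=
  d 0%N = f /\ forall n (x : R), is_derive x 1 (d n) (d n.+1 x).
Definition smooth1 (f : R -> R) := exists d, derivatives f d.

Lemma derivatives_continuous f d n : derivatives f d -> continuous (d n).
Proof.
move=> [_ dd] x; apply/differentiable_continuous/derivable1_diffP.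
exact: ex_derive.
Qed.

Lemma smooth_comp1 {V : normedModType R} (phi : R -> R) (g : V -> R) :
  smooth1 phi -> smooth_on setT g -> smooth_on setT (fun x => phi (g x)).
Proof.
move=> [d hd] hg k; case: (hd) => <- dd.
elim: k 0%N => [|k IH] n.
  split=> // x _; apply: (@continuous_comp _ _ _ g (d n) x).
    exact: smooth_continuous.
  exact: derivatives_continuous hd _.
have D x w : is_derive x w (fun x => d n (g x)) (d n.+1 (g x) * 'D_w g x).
  exact: (is_derive_comp1 (dd n (g x)) (smooth_is_derive w x hg)).
split=> [x _|w].
  apply: (@continuous_comp _ _ _ g (d n)).
    exact: smooth_continuous.
  exact: derivatives_continuous hd _.
split=> [x _|]; first exact: ex_derive.
have h : Ck setT k ('D_w g) by exact: smooth_derive.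
by apply: (eq_Ck _ (CkM (IH n.+1) h)) => x; rewrite derive_val.
Qed.

(** The ring generated by [gen] and the constants. If it contains the derivatives of the generators,
    it is stable under differentiation and its members are smooth; this one argument serves sine,
    the flat function and the wave profile. *)
Inductive poly_in (gen : (R -> R) -> Prop) : (R -> R) -> Prop :=
| poly_cst c : poly_in gen (fun=> c)
| poly_gen f : gen f -> poly_in gen f
| poly_add f g : poly_in gen f -> poly_in gen g -> poly_in gen (fun x => f x + g x)
| poly_mul f g : poly_in gen f -> poly_in gen g -> poly_in gen (fun x => f x * g x).

Lemma poly_in_smooth1 (gen : (R -> R) -> Prop) :
  (forall f, gen f -> exists2 f', poly_in gen f' & forall x : R, is_derive x 1 f (f' x)) ->
  forall f, poly_in gen f -> smooth1 f.
Proof.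
move=> hgen.
have step f : poly_in gen f ->
    exists2 f', poly_in gen f' & forall x : R, is_derive x 1 f (f' x).
  elim=> [c|g hg|{}f g pf [f' pf' df] pg [g' pg' dg]|{}f g pf [f' pf' df] pg [g' pg' dg]].
  - by exists (fun=> 0); [exact: poly_cst|move=> x; exact: is_derive_cst].
  - exact: hgen hg.
  - exists (fun x => f' x + g' x); first exact: poly_add.
    by move=> x; exact: (is_derive_addf (df x) (dg x)).
  - exists (fun x => f x * g' x + g x * f' x).
      by apply: poly_add; exact: poly_mul.
    by move=> x; exact: (is_derive_mulf (df x) (dg x)).
move=> f0 pf0.
(* The derivative is chosen as a map on functions that carry a membership proof, so that it can be
   iterated. *)
pose T := {f | poly_in gen f}.
have next (f : T) : {f' : T | forall x : R, is_derive x 1 (sval f) (sval f' x)}.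
  case: f => f pf /=; have [f' pf' D] := cid2 (step f pf).
  by exists (exist _ f' pf').
pose d n := iter n (fun f => sval (next f)) (exist _ f0 pf0 : T).
exists (fun n => sval (d n)); split=> // n x.
by rewrite /d iterS; exact: (svalP (next _)).
Qed.

Lemma smooth_id : smooth_on setT (fun x : R => x).
Proof.
apply: (@smooth_linear R (fun x => x)); last by move=> x; exact: cvg_id.
by move=> h u v; rewrite -[h *: u]/(h * u).
Qed.

Lemma smooth1_smooth (f : R -> R) : smooth1 f -> smooth_on setT f.
Proof. by move=> hf; exact: (smooth_comp1 hf smooth_id). Qed.

Lemma smooth1P (f : R -> R) : smooth_on setT f -> smooth1 f.
Proof.
move=> hf; pose d n := iter n (fun g : R -> R => 'D_(1 : R) g) f.
have sd n : smooth_on setT (d n).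
  by elim: n => // n IH; rewrite /d iterS; exact: smooth_derive.
exists d; split=> // n x.
exact: (smooth_is_derive (1 : R) x (sd n)).
Qed.

Lemma smooth_comp {V : normedModType R} (phi : R -> R) (g : V -> R) :
  smooth_on setT phi -> smooth_on setT g -> smooth_on setT (fun x => phi (g x)).
Proof. by move=> /smooth1P; exact: smooth_comp1. Qed.

Lemma smooth_sin : smooth_on setT (@sin R).
Proof.
apply/smooth1_smooth/(@poly_in_smooth1 (fun f => f = sin \/ f = cos)).
  move=> f [|] ->; [exists cos|exists (fun x => -1 * sin x)].
  - by apply: poly_gen; right.
  - by move=> x; exact: is_derive_sin.
  - by apply: poly_mul; [exact: poly_cst|apply: poly_gen; left].
  - by move=> x; rewrite mulN1r; exact: is_derive_cos.
by apply: poly_gen; left.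
Qed.

End SmoothClass.

(** * Smooth steps and wave profiles *)

Section SmoothStep.
Context {R : realType}.

Lemma is_derive_le_sqr (f : R -> R) C :
  f 0 = 0 -> (forall h, `|f h| <= C * h ^+ 2) -> is_derive (0 : R) 1 f 0.
Proof.
move=> f0 fC.
have C0 : 0 <= C by have := fC 1; rewrite expr1n mulr1; exact: le_trans.
have H : (fun h : R => h^-1 *: (f (h *: (1 : R) + 0) - f 0)) @ 0^' --> (0 : R).
  apply/cvgr0Pnorm_le => e e0; near=> h.
  have hn0 : h != 0 by near: h; exact: nbhs_dnbhs_neq.
  have hE : h *: (1 : R) + 0 = h by rewrite addr0 [h *: _]mulr1.
  rewrite hE f0 subr0 -[h^-1 *: _]/(h^-1 * f h) normrM normfV.
  rewrite mulrC ler_pdivrMr ?normr_gt0//.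
  apply: (le_trans (fC h)); rewrite -real_normK ?num_real// expr2 mulrA.
  rewrite ler_wpM2r// (@le_trans _ _ (C * (e / (C + 1))))//.
    rewrite ler_wpM2l//; near: h; apply: dnbhs0_le.
    by rewrite divr_gt0// ltr_wpDl.
  by rewrite mulrA ler_pdivrMr ?ltr_wpDl// mulrDr mulr1 mulrC lerDl ltW.
split; first by apply/cvg_ex; exists 0; exact: H.
by apply/cvg_lim => //; exact: H.
Unshelve. all: by end_near. Qed.

(** The negative powers make the family stable under differentiation: the derivative of [flat n]
    combines [flat n.+1] and [flat n.+2]. *)
Definition flat n (s : R) : R := if 0 < s then s^-1 ^+ n * expR (- s^-1) else 0.

(** With y = 1/s and m = n + 2, the inequality exp(y / m) >= y / m gives y^m <= m^m exp(y). The two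
    powers beyond n leave the factor s^2, which yields the derivative 0 at the origin. *)
Lemma flat_le n s : `|flat n s| <= (n.+2%:R) ^+ n.+2 * s ^+ 2.
Proof.
rewrite /flat; case: ifPn => [s0|_]; last first.
  by rewrite normr0 mulr_ge0 ?sqr_ge0// exprn_ge0.
have i0 : 0 < s^-1 by rewrite invr_gt0.
rewrite ger0_norm ?mulr_ge0 ?exprn_ge0 ?expR_ge0 ?(ltW i0)//.
have h : (s^-1 / n.+2%:R) ^+ n.+2 <= expR s^-1.
  rewrite (_ : expR s^-1 = expR (s^-1 / n.+2%:R) ^+ n.+2); last first.
    by rewrite -expRM_natl mulrC -mulrA mulVf ?mulr1 ?pnatr_eq0.
  apply: lerXn2r; rewrite ?nnegrE ?expR_ge0 ?divr_ge0 ?ltW//.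
  by apply: lt_le_trans (expR_ge1Dx _); rewrite ltrDr.
rewrite expRN ler_pdivrMr ?expR_gt0//.
apply: le_trans (ler_wpM2l _ h); last first.
  by rewrite mulr_ge0 ?sqr_ge0// exprn_ge0.
have E (A B C : R) : A != 0 -> A * B * (C / A) = B * C by move=> A0; field.
rewrite expr_div_n E ?expf_neq0 ?pnatr_eq0//.
have -> : s^-1 ^+ n.+2 = s^-1 * (s^-1 * s^-1 ^+ n) by rewrite !exprS.
have -> : s ^+ 2 * (s^-1 * (s^-1 * s^-1 ^+ n)) = s^-1 ^+ n by field; rewrite gt_eqF.
exact: lexx.
Qed.

Lemma is_derive_flat n (s : R) :
  is_derive s 1 (flat n) (- n%:R * flat n.+1 s + flat n.+2 s).
Proof.
have [s0|s0|->] := ltgtP s 0.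
- have -> : - n%:R * flat n.+1 s + flat n.+2 s = 0.
    by rewrite /flat !ltNge (ltW s0) /= mulr0 addr0.
  apply: (near_eq_is_derive _ (is_derive_cst (0 : R) s (1 : R))).
  near=> x; rewrite /flat ltNge (_ : x <= 0)//.
  by near: x; exact: (lt_le_nbhsl s0).
- have sn0 : s != 0 by rewrite gt_eqF.
  have D1 : is_derive s 1 (fun x : R => x^-1) (- s ^- 2 *: 1).
    exact: (@is_deriveV _ id).
  have DX : is_derive s^-1 1 (fun y : R => y ^+ n) (n%:R * s^-1 ^+ n.-1).
    apply: DeriveDef; first exact: exprn_derivable.
    by rewrite exp_derive -[X in X *: _]/(n%:R *: _) [LHS]mulr1.
  have DE : is_derive s^-1 1 (fun y : R => expR (- y)) (expR (- s^-1) * -1).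
    have DN : is_derive s^-1 1 (fun y : R => - y) (-1) by exact: is_deriveNid.
    exact: (is_derive_comp1 (is_derive_expR (- s^-1)) DN).
  have D := is_derive_comp1 (is_derive_mulf DX DE) D1.
  have := near_eq_is_derive _ D.
  move=> /(_ (flat n)) D'; apply: (is_derive_eq (D' _)).
    by near=> x; rewrite /flat (_ : 0 < x)//; near: x; exact: (lt_nbhsr s0).
  rewrite /flat s0 [_ *: _]mulr1.
  rewrite -exprVn; case: n {D D' DX DE} => [|n]; first by rewrite /=; ring.
  by rewrite /= !exprS expr0; ring.
- have -> : - n%:R * flat n.+1 0 + flat n.+2 0 = 0 :> R.
    by rewrite /flat ltxx mulr0 addr0.
  by apply: (is_derive_le_sqr _ (flat_le n)); rewrite /flat ltxx.
Unshelve. all: by end_near. Qed.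

Lemma smooth_flat : smooth_on setT (flat 0).
Proof.
apply/smooth1_smooth/(@poly_in_smooth1 _ (fun f => exists n, f = flat n)).
  move=> f [n ->]; exists (fun s => - n%:R * flat n.+1 s + flat n.+2 s).
    apply: poly_add; first apply: poly_mul; first exact: poly_cst.
      by apply: poly_gen; exists n.+1.
    by apply: poly_gen; exists n.+2.
  exact: is_derive_flat.
by apply: poly_gen; exists 0%N.
Qed.

(* The inner factor vanishes exactly when x >= 1, and the outer one when the
   inner one is at least exp(-1), that is when x <= 0. *)
Lemma smooth_step : exists s : R -> R,
  [/\ smooth_on setT s, forall x, x <= 0 -> s x = 0 & forall x, 1 <= x -> s x = 1].
Proof.
pose s (x : R) := expR 1 * flat 0 (1 - expR 1 * flat 0 (1 - x)).
have sid : smooth_on setT (fun x : R => x) by exact: smooth_id.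
have E1 : expR 1 * flat 0 1 = 1 :> R.
  by rewrite /flat ltr01 expr0 mul1r invr1 expRN mulfV// gt_eqF// expR_gt0.
exists s; split=> [|x x0|x x1].
- apply: smoothM; first exact: smooth_cst.
  apply: (smooth_comp smooth_flat); apply: smoothB; first exact: smooth_cst.
  apply: smoothM; first exact: smooth_cst.
  by apply: (smooth_comp smooth_flat); apply: smoothB => //; exact: smooth_cst.
- rewrite /s {1}/flat ifN ?mulr0// -leNgt subr_le0.
  have x1 : 0 < 1 - x by rewrite subr_gt0 (le_lt_trans x0).
  rewrite /flat x1 expr0 mul1r -expRD -[X in X <= _]expR0 ler_expR subr_ge0.
  by rewrite invf_le1// lerDl oppr_ge0.
- rewrite /s [flat 0 (1 - x)]/flat ifN; last by rewrite -leNgt subr_le0.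
  by rewrite mulr0 subr0.
Qed.

End SmoothStep.

Section MeanValue.
Context {R : realType}.

Lemma is_derive_mvt (f df : R -> R) (x y : R) :
  (forall s : R, is_derive s 1 f (df s)) -> x <= y ->
  exists2 s, x <= s <= y & f y - f x = df s * (y - x).
Proof.
move=> D xy.
have cf : {within `[x, y], continuous f}.
  apply/continuous_subspaceT => s.
  by apply/differentiable_continuous/derivable1_diffP; have [] := D s.
have [s] := MVT_segment xy (fun s _ => D s) cf.
by rewrite in_itv; exists s.
Qed.

Lemma is_derive_lipschitz (f df : R -> R) L :
  (forall s : R, is_derive s 1 f (df s)) -> (forall s, `|df s| <= L) ->
  forall x y, `|f x - f y| <= L * `|x - y|.
Proof.
move=> D dL x y; wlog xy : x y / y <= x.
  by move=> H; have [/H//|/ltW/H] := leP y x; rewrite distrC [`|y - x|]distrC.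
have [s _ ->] := is_derive_mvt D xy.
by rewrite normrM ler_wpM2r.
Qed.

Lemma is_derive_ndecr (f df : R -> R) :
  (forall s : R, is_derive s 1 f (df s)) -> (forall s, 0 <= df s) ->
  forall x y, x <= y -> f x <= f y.
Proof.
move=> D d0 x y xy; have [s _ E] := is_derive_mvt D xy.
by rewrite -subr_ge0 E mulr_ge0// subr_ge0.
Qed.

End MeanValue.

Section Profile.
Context {R : realType}.
Variables (d : R) (d01 : 0 < d < 2^-1).
Let r : R := cos (pi * d).
Let u (s : R) := sin (pi *+ 2 * s).
Let c (s : R) := cos (pi *+ 2 * s).
Let w (s : R) := (Num.sqrt (1 - (r * u s) ^+ 2))^-1.

(* With cos (pi * d) replaced by 1 this is a triangular wave, which pushes the
   Lebesgue measure of a period forward to that of [0, 1]. *)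
Definition profile (s : R) : R :=
  pi^-1 * asin (cos (pi * d) * sin (pi *+ 2 * s)) + 2^-1.

Let pi0 : 0 < pi :> R. Proof. exact: pi_gt0. Qed.

Let r01 : 0 < r < 1.
Proof.
have /andP[d0 d1] := d01.
have pd : 0 < pi * d < pi / 2 by rewrite mulr_gt0// ltr_pM2l//.
have /andP[pd0 pd1] := pd; apply/andP; split.
  by apply: cos_gt0_pihalf; rewrite pd1 andbT (lt_trans _ pd0)// oppr_lt0 divr_gt0.
by rewrite -cos0 ltr_cos// in_itv/= ?lexx ?pi_ge0// !ltW//= (lt_trans pd1)// ltr_pdivrMr// ltr_pMr// ltr1n.
Qed.

Let ru1 s : -1 < r * u s < 1.
Proof.
have /andP[r0 r1] := r01; rewrite -ltr_norml normrM gtr0_norm//.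
apply: (le_lt_trans _ r1); rewrite ler_piMr ?(ltW r0)//.
by rewrite ler_norml sin_geN1 sin_le1.
Qed.

Let q0 s : 0 < 1 - (r * u s) ^+ 2.
Proof. by rewrite subr_gt0 -real_normK ?num_real// exprn_ilt1// ltr_norml ru1. Qed.

Let w0 s : 0 < w s. Proof. by rewrite invr_gt0 sqrtr_gt0. Qed.

Let Dlin (s : R) : is_derive s 1 (fun s => pi *+ 2 * s) (pi *+ 2).
Proof.
have := is_derive_mulf (is_derive_cst (pi *+ 2 : R) s (1 : R)) (is_derive_id s (1 : R)).
by move/is_derive_eq; apply; rewrite mulr0 addr0 /cst mulr1.
Qed.

Let Du (s : R) : is_derive s 1 u (c s * (pi *+ 2)).
Proof. exact: (is_derive_comp1 (is_derive_sin _) (Dlin s)). Qed.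

Let Dc (s : R) : is_derive s 1 c (- u s * (pi *+ 2)).
Proof. exact: (is_derive_comp1 (is_derive_cos _) (Dlin s)). Qed.

Let Dru (s : R) : is_derive s 1 (fun s => r * u s) (r * (c s * (pi *+ 2))).
Proof.
have := is_derive_mulf (is_derive_cst r s (1 : R)) (Du s).
by move/is_derive_eq; apply; rewrite mulr0 addr0.
Qed.

Let Dw (s : R) : is_derive s 1 w (r ^+ 2 * (pi *+ 2) * (u s * (c s * (w s * (w s * w s))))).
Proof.
have Dq : is_derive s 1 (fun s => 1 - (r * u s) ^+ 2)
    (0 - (r * u s * (r * (c s * (pi *+ 2))) + r * u s * (r * (c s * (pi *+ 2))))).
  apply: (is_derive_addf (is_derive_cst (1 : R) s (1 : R))).
  exact: (is_deriveN (is_derive_mulf (Dru s) (Dru s))).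
have S0 : Num.sqrt (1 - (r * u s) ^+ 2) != 0 by rewrite gt_eqF// sqrtr_gt0.
have DS := @is_derive_comp1 R _ Num.sqrt (fun s => 1 - (r * u s) ^+ 2) s 1 _ _
  (is_derive1_sqrt (q0 s)) Dq.
have DV := @is_deriveV R (fun s => Num.sqrt (1 - (r * u s) ^+ 2)) s _ 1 S0 DS.
apply: (is_derive_eq DV).
rewrite -[X in X = _]/(_ * _) /w; move: S0; set S := Num.sqrt _ => S0.
by field.
Qed.

Let Dprofile (s : R) : is_derive s 1 profile (2 * r * (c s * w s)).
Proof.
have DA := @is_derive_comp1 R _ (@asin R) (fun s => r * u s) s 1 _ _
  (is_derive1_asin (ru1 s)) (Dru s).
have := is_derive_addf (is_derive_mulf (is_derive_cst (pi^-1 : R) s (1 : R)) DA)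
  (is_derive_cst (2^-1 : R) s (1 : R)).
move/is_derive_eq; apply; rewrite /cst /= -/(w s) mulr0 !addr0 mulr2n.
have pn : pi != 0 :> R by rewrite gt_eqF.
by move: (pi : R) pn => p pn; field.
Qed.

(** The derivatives of [u], [c], [w] and of the profile are polynomials in [u], [c] and [w]. The
    factor cos (pi d) < 1 keeps the argument of the arcsine inside ]-1, 1[, hence [w] finite. *)
Lemma smooth_profile : smooth_on setT profile.
Proof.
apply/smooth1_smooth/(@poly_in_smooth1 _ (fun f => [\/ f = u, f = c, f = w | f = profile])).
  have pu : poly_in (fun f => [\/ f = u, f = c, f = w | f = profile]) u.
    by apply: poly_gen; exact: Or41.
  have pc : poly_in (fun f => [\/ f = u, f = c, f = w | f = profile]) c.
    by apply: poly_gen; exact: Or42.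
  have pw : poly_in (fun f => [\/ f = u, f = c, f = w | f = profile]) w.
    by apply: poly_gen; exact: Or43.
  move=> f [] ->.
  - exists (fun s => c s * (pi *+ 2)); last exact: Du.
    by apply: poly_mul => //; exact: poly_cst.
  - exists (fun s => -1 * u s * (pi *+ 2)); last by move=> s; rewrite mulN1r; exact: Dc.
    by repeat (apply: poly_mul => //); exact: poly_cst.
  - exists (fun s => r ^+ 2 * (pi *+ 2) * (u s * (c s * (w s * (w s * w s))))).
      by repeat (apply: poly_mul => //); exact: poly_cst.
    exact: Dw.
  - exists (fun s => 2 * r * (c s * w s)); last exact: Dprofile.
    by repeat (apply: poly_mul => //); exact: poly_cst.
by apply: poly_gen; exact: Or44.
Qed.

(** (r c)^2 = r^2 - (r u)^2 <= 1 - (r u)^2, so |r c w| <= 1: the slope never exceeds that of the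
    triangular wave. *)
Let profile_slope s : `|2 * r * (c s * w s)| <= 2.
Proof.
have /andP[r0 r1] := r01.
rewrite -mulrA normrM ger0_norm// -[leRHS]mulr1 ler_pM2l//.
rewrite mulrA normrM [`|w s|]gtr0_norm// /w ler_pdivrMr ?sqrtr_gt0// mul1r.
have E : (r * c s) ^+ 2 = r ^+ 2 - (r * u s) ^+ 2.
  by rewrite exprMn /c [cos (pi *+ 2 * s) ^+ 2]cos2sin2 -/(u s) mulrBr mulr1 -exprMn.
rewrite -sqrtr_sqr ler_sqrt ?(ltW (q0 s))// E.
by rewrite lerD2r expr_le1// ltW.
Qed.

Lemma profile_lipschitz x y : `|profile x - profile y| <= 2 * `|x - y|.
Proof. exact: is_derive_lipschitz Dprofile profile_slope _ _. Qed.

Lemma profile_range s : 0 <= profile s <= 1.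
Proof.
have /andP[h1 h2] := ru1 s.
have h : -1 <= r * u s <= 1 by rewrite !ltW.
have a1 : - 2^-1 <= pi^-1 * asin (r * u s).
  by rewrite mulrC ler_pdivlMr// mulNr [2^-1 * _]mulrC asin_geNpi2.
have a2 : pi^-1 * asin (r * u s) <= 2^-1.
  by rewrite mulrC ler_pdivrMr// [2^-1 * _]mulrC asin_lepi2.
by rewrite /profile -/r -/(u s); apply/andP; split; lra.
Qed.

Lemma profile_periodic s : profile (s + 1) = profile s.
Proof. by rewrite /profile mulrDr mulr1 sinD2pi. Qed.

Lemma profile_reflect s : profile (2^-1 - s) = profile s.
Proof.
rewrite /profile mulrBr (_ : pi *+ 2 * 2^-1 = pi); last first.
  by move: (pi : R) => p; rewrite mulr2n; field.
by rewrite [pi - _]addrC sinDpi sinN opprK.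
Qed.

Lemma profile_near s : `|s| <= 4^-1 -> `|profile s - (2 * s + 2^-1)| <= d.
Proof.
move=> sq.
have /andP[d0 d1] := d01.
pose D s := 2 * s + 2^-1 - profile s.
have dD (x : R) : is_derive x 1 D (2 - 2 * r * (c x * w x)).
  have D2 := is_derive_mulf (is_derive_cst (2 : R) x (1 : R)) (is_derive_id x (1 : R)).
  have D3 := is_derive_addf D2 (is_derive_cst (2^-1 : R) x (1 : R)).
  apply: (is_derive_eq (is_deriveB D3 (Dprofile x))).
  by rewrite /cst mulr0 !addr0 mulr1.
have ndD x y : x <= y -> D x <= D y.
  apply: (is_derive_ndecr dD) => z; rewrite subr_ge0.
  by have := profile_slope z; rewrite ler_norml => /andP[].
have rE : r = sin (pi / 2 - pi * d).
  by rewrite -cosBpihalf addrAC subrr sub0r cosN.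
have hin : (pi / 2 - pi * d : R) \in `[- (pi / 2), pi / 2].
  rewrite in_itv/= lerBlDr lerDl mulr_ge0 ?(ltW d0) ?(ltW pi0)// andbT.
  rewrite -subr_ge0 opprK addrAC -splitr -{1}[pi]mulr1 -mulrBr mulr_ge0// ?ltW//.
  by rewrite subr_gt0 (lt_trans d1)// invf_lt1// ltr1n.
have hin' : - (pi / 2 - pi * d : R) \in `[- (pi / 2), pi / 2].
  by move: hin; rewrite !in_itv/= => /andP[h1 h2]; rewrite lerN2 h2 lerNl h1.
have p4 : pi *+ 2 * 4^-1 = pi / 2 :> R.
  by move: (pi : R) => p; rewrite mulr2n; field.
have p4N : pi *+ 2 * - 4^-1 = - (pi / 2) :> R by rewrite mulrN p4.
have pn : pi != 0 :> R by rewrite gt_eqF.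
have D4 : D 4^-1 = d.
  rewrite /D /profile -/r p4 sin_pihalf mulr1 rE sinK//.
  by move: (pi : R) pn => p pn'; field.
have DN4 : D (- 4^-1) = - d.
  rewrite /D /profile -/r p4N sinN sin_pihalf mulrN1 rE -sinN sinK//.
  by move: (pi : R) pn => p pn'; field.
move: sq; rewrite ler_norml => /andP[s1 s2].
rewrite distrC -/(D s) ler_norml -D4 ndD// andbT D4 -DN4 ndD//.
Qed.

End Profile.

(** * Integrals of bounded functions *)

Definition bdd {R : realType} {T : Type} (D : set T) (f : T -> R) :=
  exists C, forall x, D x -> `|f x| <= C.

Section Bounded.
Context {R : realType} {T : Type} (D : set T).
Implicit Types f g : T -> R.

Lemma bdd_cst (c : R) : bdd D (fun=> c).
Proof. by exists `|c|. Qed.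

Lemma bddD f g : bdd D f -> bdd D g -> bdd D (fun x => f x + g x).
Proof.
move=> [C fC] [C' gC]; exists (C + C') => x Dx.
by apply: (le_trans (ler_normD _ _)); apply: lerD; [exact: fC|exact: gC].
Qed.

Lemma bddN f : bdd D f -> bdd D (fun x => - f x).
Proof. by move=> [C fC]; exists C => x Dx; rewrite normrN; exact: fC. Qed.

Lemma bddB f g : bdd D f -> bdd D g -> bdd D (fun x => f x - g x).
Proof. by move=> hf hg; apply: bddD => //; exact: bddN. Qed.

Lemma bddM f g : bdd D f -> bdd D g -> bdd D (fun x => f x * g x).
Proof.
move=> [C fC] [C' gC]; exists (C * C') => x Dx; rewrite normrM.
by apply: ler_pM => //; [exact: fC|exact: gC].
Qed.

Lemma bddX f n : bdd D f -> bdd D (fun x => f x ^+ n).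
Proof.
by move=> [C fC]; exists (C ^+ n) => x Dx; rewrite normrX lerXn2r ?nnegrE ?fC//
  (le_trans _ (fC x Dx)).
Qed.

End Bounded.

Section BoundedIntegral.
Context {R : realType} {d : measure_display} {T : measurableType d}.
Variables (mu : {measure set T -> \bar R}) (D : set T).
Hypotheses (mD : measurable D) (Doo : (mu D < +oo)%E).
Implicit Types f g : T -> R.

Lemma bdd_integrable f : measurable_fun D f -> bdd D f ->
  mu.-integrable D (EFin \o f).
Proof.
move=> mf [C fC]; apply: measurable_bounded_integrable => //.
exists C; split; first exact: num_real.
by move=> M CM x Dx; exact: le_trans (fC x Dx) (ltW CM).
Qed.

Lemma le_Rintegral_bdd f C : measurable_fun D f -> (forall x, D x -> `|f x| <= C) ->
  `|\int[mu]_(x in D) f x| <= C * fine (mu D).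
Proof.
move=> mf fC; have fi : mu.-integrable D (EFin \o f) by apply: bdd_integrable => //; exists C.
apply: (le_trans (le_normr_Rintegral mD fi)).
rewrite -(Rintegral_cst _ mD); apply: le_Rintegral => //.
- apply: bdd_integrable; first exact: measurableT_comp.
  by exists C => x Dx; rewrite normr_id; exact: fC.
- by apply: bdd_integrable; [exact: measurable_cst|exact: bdd_cst].
Qed.

End BoundedIntegral.

(** * Fubini's theorem for bounded functions *)

Section ProductIntegral.
Context {R : realType} {d1 d2 : measure_display}.
Context {T1 : measurableType d1} {T2 : measurableType d2}.
Variables (m1 : {sigma_finite_measure set T1 -> \bar R}).
Variables (m2 : {sigma_finite_measure set T2 -> \bar R}).
Variables (A : set T1) (B : set T2).
Hypotheses (mA : measurable A) (mB : measurable B).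
Hypotheses (Aoo : (m1 A < +oo)%E) (Boo : (m2 B < +oo)%E).
Variable f : T1 * T2 -> R.
Hypotheses (mf : measurable_fun setT f) (bf : bdd (A `*` B) f).

Lemma measurable_prod_lty : ((m1 \x m2)%E (A `*` B) < +oo)%E.
Proof. by rewrite product_measure1E// lte_mul_pinfty// ge0_fin_numE. Qed.

Let fAB := (EFin \o f) \_ (A `*` B).

Let ifAB : (m1 \x m2)%E.-integrable setT fAB.
Proof.
have mAB : measurable (A `*` B) by exact: measurableX.
have H := @integrable_mkcond _ _ R (m1 \x m2)%E (A `*` B) (EFin \o f) mAB.
apply/H; apply: bdd_integrable => //.
- exact: measurable_prod_lty.
- exact: measurable_funTS.
Qed.

Lemma Rintegral_prod1 : \int[(m1 \x m2)%E]_(z in A `*` B) f z =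
  \int[m1]_(x in A) \int[m2]_(y in B) f (x, y).
Proof.
rewrite /Rintegral integral_mkcond -integral12_prod_meas1//.
congr fine; rewrite [RHS]integral_mkcond; apply: eq_integral => x _.
rewrite patchE; case: ifPn => [/set_mem xA|/negP xA].
  rewrite fineK.
    rewrite [RHS]integral_mkcond; apply: eq_integral => y _.
    by rewrite /fAB !patchE in_setX mem_set.
  apply: integrable_fin_num => //; apply: bdd_integrable => //.
    by apply/measurable_funTS; exact: measurableT_comp mf (pair1_measurable _).
  by have [C fC] := bf; exists C => y By; exact: fC.
rewrite /fubini_F integral0_eq// => y _; rewrite /fAB patchE in_setX.
by case: ifPn => // /andP[/xA].
Qed.

Lemma Rintegral_prod2 : \int[(m1 \x m2)%E]_(z in A `*` B) f z =
  \int[m2]_(y in B) \int[m1]_(x in A) f (x, y).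
Proof.
rewrite /Rintegral integral_mkcond -integral21_prod_meas1//.
congr fine; rewrite [RHS]integral_mkcond; apply: eq_integral => y _.
rewrite patchE; case: ifPn => [/set_mem yB|/negP yB].
  rewrite fineK.
    rewrite [RHS]integral_mkcond; apply: eq_integral => x _.
    by rewrite /fAB !patchE in_setX (mem_set yB) andbT.
  apply: integrable_fin_num => //; apply: bdd_integrable => //.
    by apply/measurable_funTS; exact: measurableT_comp mf (pair2_measurable _).
  by have [C fC] := bf; exists C => x Ax; exact: fC.
rewrite /fubini_G integral0_eq// => x _; rewrite /fAB patchE in_setX.
by case: ifPn => // /andP[_ /yB].
Qed.

End ProductIntegral.

(** * Measurability of functions continuous in one variable *)

Section Caratheodory.
Context {R : realType} {d : measure_display} {T : measurableType d}.

(** Rounding t down to a multiple of 1/(n+1) gives a function that depends on y alone on each of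
    countably many strips, hence is measurable; by continuity in t these functions converge
    pointwise to f. *)
Lemma measurable_caratheodory_fun (f : measurableTypeR R * T -> R) :
  (forall t, measurable_fun setT (fun y => f (t, y))) ->
  (forall y, continuous (fun t : R => f (t, y))) -> measurable_fun setT f.
Proof.
move=> mf cf.
pose fn n (z : measurableTypeR R * T) := f (n.+1%:R^-1 * (Num.floor (n.+1%:R * z.1))%:~R, z.2).
apply: (@measurable_fun_cvg _ _ _ setT fn) => [n|[t y] _]; last first.
  pose tn n : R := n.+1%:R^-1 * (Num.floor (n.+1%:R * t))%:~R.
  have : tn @ \oo --> t.
    apply/cvgrPdist_le => e e0; near=> n.
    have n0 : 0 < n.+1%:R :> R by [].
    have /andP[h1 h2] := Num.Theory.floor_itv (n.+1%:R * t).
    rewrite (_ : t - tn n = n.+1%:R^-1 * (n.+1%:R * t - (Num.floor (n.+1%:R * t))%:~R)).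
      rewrite normrM gtr0_norm ?invr_gt0// ger0_norm ?subr_ge0//.
      rewrite (@le_trans _ _ (n.+1%:R^-1 * 1))//.
        by rewrite ler_wpM2l ?invr_ge0// lerBlDr addrC -intrD1 ltW.
      by rewrite mulr1 ltW//; near: n; exact: near_infty_natSinv_lt (PosNum e0).
    by rewrite mulrBr mulKf// gt_eqF.
  by move=> tnt; apply: (cvg_comp _ _ tnt (cf y t)).
move=> _ B mB; rewrite setTI.
rewrite (_ : _ @^-1` B = \bigcup_(k : int)
    ([set t : measurableTypeR R | Num.floor (n.+1%:R * t) = k] `*`
     (fun y => f (n.+1%:R^-1 * k%:~R, y)) @^-1` B)).
  apply: countable_bigcupT_measurable => [|k]; first exact: countableP.
  apply: measurableX.
    rewrite (_ : [set t | _] = `[n.+1%:R^-1 * k%:~R, n.+1%:R^-1 * (k + 1)%:~R[%classic).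
      exact: measurable_itv.
    apply/seteqP; split => t /=; rewrite in_itv /= ![n.+1%:R^-1 * _]mulrC.
      by move=> <-; rewrite ler_pdivrMr// ltr_pdivlMr// [t * _]mulrC Num.Theory.floor_itv.
    rewrite ler_pdivrMr// ltr_pdivlMr// [t * _]mulrC => h.
    exact: Num.Theory.floor_def.
  by rewrite -[X in measurable X]setTI; exact: mf.
apply/seteqP; split => [[t y] /= h|[t y] [k _] [/= <-]//].
by exists (Num.floor (n.+1%:R * t)).
Unshelve. all: by end_near. Qed.

End Caratheodory.

(** * Integrals over intervals of the line *)

Lemma leb1_itv {R : realType} (s1 s2 : bool) (a b : R) : a <= b ->
  leb1 R [set` Interval (BSide s1 a) (BSide s2 b)] = (b - a)%:E.
Proof.
move=> ab; have := @lebesgue_measure_itv R (Interval (BSide s1 a) (BSide s2 b)).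
rewrite /= lte_fin => ->.
by case: ltgtP ab => // ->; rewrite subrr.
Qed.

(** Half-open like the sides of the fundamental cube, so that consecutive intervals tile the
    line. *)
Definition ival {R : realType} (a b : R) (h : R -> R) : R :=
  \int[leb1 R]_(x in `[a, b[%classic) h x.

Section Primitive.
Context {R : realType}.
Implicit Types (h H : R -> R) (a b c : R).

Lemma is_derive_continuous H h : (forall x : R, is_derive x 1 H (h x)) -> continuous H.
Proof.
by move=> D x; apply/differentiable_continuous/derivable1_diffP; have [] := D x.
Qed.

Lemma continuous_itv_integrable a b h : continuous h ->
  (leb1 R).-integrable `[a, b] (EFin \o h).
Proof.
move=> ch; apply: continuous_compact_integrable; first exact: segment_compact.
exact: continuous_subspaceT.
Qed.

Lemma ival_cc a b h : continuous h -> ival a b h = \int[leb1 R]_(x in `[a, b]) h x.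
Proof.
move=> ch; apply: Rintegral_itv_bndo_bndc.
apply: integrableS (continuous_itv_integrable a b ch) => //.
exact: subset_itv_co_cc.
Qed.

Lemma ival_FTC H h a b : (forall x : R, is_derive x 1 H (h x)) -> continuous h -> a <= b ->
  ival a b h = H b - H a.
Proof.
move=> D ch; rewrite le_eqVlt => /predU1P[->|ab].
  by rewrite subrr /ival set_itvco0 // Rintegral_set0.
have cH := is_derive_continuous D.
rewrite ival_cc// /Rintegral (@continuous_FTC2 R h H a b)//.
- exact: continuous_subspaceT.
- split; first by move=> x _; have [] := D x.
    exact/cvg_at_right_filter/cH.
  exact/cvg_at_left_filter/cH.
- by move=> x _; rewrite derive1E; have [_ ->] := D x.
Qed.

(** The integral from -M is known to be a primitive only to the right of -M. Subtracting its value
    at 0 makes it independent of M, so that M may vary with the point. *)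
Lemma primitive_exists h : continuous h ->
  exists H, forall x : R, is_derive x 1 H (h x).
Proof.
move=> ch.
pose P (M x : R) := \int[leb1 R]_(t in `[- M, x]) h t.
have PD (M x : R) : - M < x -> is_derive x 1 (P M) (h x).
  move=> Mx.
  have x1 : x < x + 1 by rewrite ltrDl.
  have [d e] := continuous_FTC1_closed x1 (continuous_itv_integrable (- M) (x + 1) ch) Mx (ch x).
  by apply: DeriveDef => //; rewrite -derive1E e.
have Pconst (M N x : R) : 0 < M -> 0 < N -> - M < x -> - N < x ->
    P M x - P M 0 = P N x - P N 0.
  move=> M0 N0 Mx Nx.
  suff: (P M x - P N x) = (P M 0 - P N 0) by lra.
  have PDD (y : R) : - M < y -> - N < y -> is_derive y 1 (fun y => P M y - P N y) 0.
    move=> My Ny; have := is_deriveB (PD M y My) (PD N y Ny).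
    by move/is_derive_eq; apply; rewrite subrr.
  have key (a b : R) : a <= b -> - M < a -> - N < a -> P M b - P N b = P M a - P N a.
    move=> ab Ma Na.
    have D s : s \in `]a, b[ -> is_derive s 1 (fun y => P M y - P N y) ((fun=> 0) s).
      by rewrite in_itv/= => /andP[s1 _]; apply: PDD; exact: lt_trans s1.
    have C : {within `[a, b], continuous (fun y => P M y - P N y)}.
      apply: derivable_within_continuous => y; rewrite in_itv/= => /andP[ya _].
      by have [] := PDD y (lt_le_trans Ma ya) (lt_le_trans Na ya).
    have [s _] := MVT_segment ab D C.
    by rewrite mul0r => /subr0_eq.
  have [x0|/ltW x0] := leP 0 x; first by apply: key => //; rewrite oppr_lt0.
  by apply/esym; exact: key.
pose N (x : R) : R := `|x| + 1.
have N0 x : 0 < N x by rewrite /N ltr_wpDl.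
exists (fun x => P (N x) x - P (N x) 0) => x.
(* A fixed lower end that is valid for all points near x, where the varying one gives the same
   values. *)
pose M := N x + 1.
have Mx : - M < x.
  by rewrite ltrNl; apply: (le_lt_trans (ler_norm _)); rewrite normrN /M /N -addrA ltrDl.
have M0 : 0 < M by rewrite /M ltr_wpDl// ltW.
have D : is_derive x 1 (fun y => P M y - P M 0) (h x).
  have := is_deriveB (PD M x Mx) (is_derive_cst (P M 0) x (1 : R)).
  by move/is_derive_eq; apply; rewrite subr0.
apply: (near_eq_is_derive _ D); near=> y.
apply: Pconst => //; last first.
  by rewrite ltrNl; apply: (le_lt_trans (ler_norm _)); rewrite normrN /N ltrDl.
near: y; apply: lt_nbhsr.
exact: Mx.
Unshelve. all: by end_near. Qed.

End Primitive.

Section Ival.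
Context {R : realType}.
Implicit Types (h g : R -> R) (a b c : R).

(** A primitive on the whole line reduces this rule and the following ones (substitution,
    reflection, periodicity) to identities between its values. *)
Lemma ival_split h a b c : continuous h -> a <= b -> b <= c ->
  ival a c h = ival a b h + ival b c h.
Proof.
move=> ch ab bc; have [H D] := primitive_exists ch.
by rewrite !(ival_FTC D)// ?(le_trans ab)//; ring.
Qed.

Lemma ival_affine h a b k c : continuous h -> 0 < k -> a <= b ->
  ival a b (fun x => h (k * x + c)) = k^-1 * ival (k * a + c) (k * b + c) h.
Proof.
move=> ch k0 ab; have [H D] := primitive_exists ch.
have Dl (x : R) : is_derive x 1 (fun x => k * x + c) k.
  have := is_derive_addf (is_derive_mulf (is_derive_cst k x (1 : R)) (is_derive_id x (1 : R)))
    (is_derive_cst c x (1 : R)).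
  by move/is_derive_eq; apply; rewrite /cst mulr0 !addr0 mulr1.
have Dk (x : R) : is_derive x 1 (fun x => k^-1 * H (k * x + c)) (h (k * x + c)).
  have := is_derive_mulf (is_derive_cst k^-1 x (1 : R)) (is_derive_comp1 (D _) (Dl x)).
  by move/is_derive_eq; apply; rewrite /cst mulr0 addr0 mulrCA mulVf ?mulr1 ?gt_eqF.
have chl : continuous (fun x => h (k * x + c)).
  move=> x; apply: (@continuous_comp _ _ _ (fun x => k * x + c) h); last exact: ch.
  exact: (is_derive_continuous Dl).
rewrite (ival_FTC Dk)// (ival_FTC D)//; first by rewrite mulrBr.
by rewrite lerD2r ler_pM2l.
Qed.

Lemma ival_reflect h a b c : continuous h -> a <= b ->
  ival a b (fun x => h (c - x)) = ival (c - b) (c - a) h.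
Proof.
move=> ch ab; have [H D] := primitive_exists ch.
have Dl (x : R) : is_derive x 1 (fun x => c - x) (-1).
  have := is_deriveB (is_derive_cst c x (1 : R)) (is_derive_id x (1 : R)).
  by move/is_derive_eq; apply; rewrite sub0r.
have Dk (x : R) : is_derive x 1 (fun x => -1 * H (c - x)) (h (c - x)).
  have := is_derive_mulf (is_derive_cst (-1 : R) x (1 : R)) (is_derive_comp1 (D _) (Dl x)).
  by move/is_derive_eq; apply; rewrite /cst mulr0 addr0 mulrCA mulN1r opprK mulr1.
have chl : continuous (fun x => h (c - x)).
  move=> x; apply: (@continuous_comp _ _ _ (fun x => c - x) h); last exact: ch.
  exact: (is_derive_continuous Dl).
rewrite (ival_FTC Dk)// (ival_FTC D)//; first by ring.
by rewrite lerD2l lerN2.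
Qed.

Lemma ival_period h a : continuous h -> (forall x, h (x + 1) = h x) ->
  ival a (a + 1) h = ival 0 1 h.
Proof.
move=> ch ph; have [H D] := primitive_exists ch.
have Dl (x : R) : is_derive x 1 (fun x => x + 1) 1.
  have := is_derive_addf (is_derive_id x (1 : R)) (is_derive_cst (1 : R) x (1 : R)).
  by move/is_derive_eq; apply; rewrite addr0.
have DD (x : R) : is_derive x 1 (fun x => H (x + 1) - H x) 0.
  have := is_deriveB (is_derive_comp1 (D _) (Dl x)) (D x).
  by move/is_derive_eq; apply; rewrite mulr1 ph subrr.
rewrite !(ival_FTC D)// ?lerDl//.
by rewrite (is_derive_0_is_cst a 0 DD) add0r.
Qed.

Lemma ival_shift h c : continuous h -> (forall x, h (x + 1) = h x) ->
  ival 0 1 (fun x => h (x + c)) = ival 0 1 h.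
Proof.
move=> ch ph; rewrite -(ival_period c ch ph).
under [X in ival 0 1 X]eq_fun do rewrite -[X in h (X + c)]mul1r.
by rewrite ival_affine// invr1 mul1r mulr0 mulr1 add0r addrC.
Qed.

Let mI a b : measurable (`[a, b[%classic : set (measurableTypeR R)).
Proof. exact: measurable_itv. Qed.

Let ii h a b : continuous h -> (leb1 R).-integrable `[a, b[ (EFin \o h).
Proof.
move=> ch; apply: integrableS (continuous_itv_integrable a b ch) => //.
exact: subset_itv_co_cc.
Qed.

Lemma ivalD h g a b : continuous h -> continuous g ->
  ival a b (fun x => h x + g x) = ival a b h + ival a b g.
Proof. by move=> ch cg; apply: RintegralD => //; exact: ii. Qed.

Lemma ivalZ h k a b : continuous h -> ival a b (fun x => k * h x) = k * ival a b h.
Proof. by move=> ch; apply: RintegralZl => //; exact: ii. Qed.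

Lemma ivalB h g a b : continuous h -> continuous g ->
  ival a b (fun x => h x - g x) = ival a b h - ival a b g.
Proof. by move=> ch cg; apply: RintegralB => //; exact: ii. Qed.

Lemma eq_ival h g a b : (forall x, a <= x < b -> h x = g x) -> ival a b h = ival a b g.
Proof.
by move=> e; apply: eq_Rintegral => x /set_mem/=; rewrite in_itv/=; exact: e.
Qed.

Lemma ival_norm h a b C : a <= b -> continuous h -> (forall x, a <= x < b -> `|h x| <= C) ->
  `|ival a b h| <= C * (b - a).
Proof.
move=> ab ch hC.
have E : leb1 R `[a, b[%classic = (b - a)%:E by exact: leb1_itv.
have Eoo : (leb1 R `[a, b[%classic < +oo)%E by rewrite E ltry.
rewrite -[b - a]/(fine (b - a)%:E) -E; apply: le_Rintegral_bdd => //.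
exact: (measurable_funTS (continuous_measurable_fun ch)).
Qed.

End Ival.

Section Slices.
Context {R : realType}.

Lemma continuous_pairl {U V W : topologicalType} (f : U * V -> W) (u : U) :
  continuous f -> continuous (fun v => f (u, v)).
Proof.
move=> cf v; apply: (@continuous_comp _ _ _ (fun v => (u, v)) f); last exact: cf.
by apply: cvg_pair; [exact: cvg_cst|exact: cvg_id].
Qed.

Lemma continuous_pairr {U V W : topologicalType} (f : U * V -> W) (v : V) :
  continuous f -> continuous (fun u => f (u, v)).
Proof.
move=> cf u; apply: (@continuous_comp _ _ _ (fun u => (u, v)) f); last exact: cf.
by apply: cvg_pair; [exact: cvg_id|exact: cvg_cst].
Qed.

Lemma continuous_measurable2 (f : R * R -> R) : continuous f ->
  measurable_fun (setT : set (measurableTypeR R * measurableTypeR R)) f.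
Proof.
move=> cf; apply: (@measurable_caratheodory_fun R _ (measurableTypeR R) f).
  move=> t; have ct : continuous (fun y : R => f (t, y)) by exact: continuous_pairl.
  exact: (continuous_measurable_fun ct).
by move=> y; exact: continuous_pairr.
Qed.

Lemma continuous_measurable3 (f : R * R * R -> R) : continuous f ->
  measurable_fun (setT : set (mspace R)) f.
Proof.
move=> cf.
(* The criterion expects the continuous variable first, while [mspace] associates to the left: the
   factors are exchanged. *)
pose g (z : measurableTypeR R * (measurableTypeR R * measurableTypeR R)) := f (z.2, z.1).
have mg : measurable_fun setT g.
  apply: (@measurable_caratheodory_fun R _ (measurableTypeR R * measurableTypeR R)%type g).
    move=> t; have ct : continuous (fun y : R * R => f (y, t)) by exact: continuous_pairr.
    exact: (continuous_measurable2 ct).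
  move=> y; have ct : continuous (fun t : R => f ((y : R * R), t)) by exact: continuous_pairl.
  exact: ct.
have ms : measurable_fun (setT : set (mspace R)) (fun z : mspace R => (z.2, z.1)).
  exact: measurable_fun_pair.
have -> : f = g \o (fun z : mspace R => (z.2, z.1)) by apply/funext => -[].
exact: (measurableT_comp mg ms).
Qed.

Lemma continuous_measurable4 (f : spacetime R -> R) : continuous f ->
  measurable_fun (setT : set (mspacetime R)) f.
Proof.
move=> cf; apply: (@measurable_caratheodory_fun R _ (mspace R) f).
  move=> t; have ct : continuous (fun y : R * R * R => f (t, y)) by exact: continuous_pairl.
  exact: (continuous_measurable3 ct).
by move=> y; exact: continuous_pairr.
Qed.

End Slices.

Section Periodic.
Context {R : realType}.

Lemma periodic_int (g : R -> R) : (forall x, g (x + 1) = g x) ->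
  forall x (m : int), g (x + m%:~R) = g x.
Proof.
move=> pg; have pn x (n : nat) : g (x + n%:R) = g x.
  by elim: n => [|n IH]; rewrite ?addr0// -addn1 natrD addrA pg.
by move=> x [n|n]; [exact: pn|rewrite NegzE mulrNz -(pn _ n.+1) subrK].
Qed.

Lemma evec_coord (x : R * R * R) s (i : 'I_3) : x + s *: evec R i =
  (x.1.1 + s * (val i == 0%N)%:R, x.1.2 + s * (val i == 1%N)%:R, x.2 + s * (val i == 2%N)%:R).
Proof. by case: x => [[a b] c]. Qed.

Definition fract (x : R) : R := x - (Num.floor x)%:~R.

Lemma fract_itv x : 0 <= fract x < 1.
Proof.
have := Num.Theory.floor_itv x; rewrite /fract intrD1 => /andP[h1 h2].
by rewrite subr_ge0 h1 ltrBlDl.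
Qed.

Lemma periodic_fract (g : R * R * R -> R) : Defs.periodic g ->
  forall x, g x = g (fract x.1.1, fract x.1.2, fract x.2).
Proof.
move=> pg [[a b] c] /=.
have p0 b' c' x : g (x + 1, b', c') = g (x, b', c').
  rewrite -[RHS](pg _ ord0); congr g; rewrite -[evec R ord0]scale1r evec_coord /=.
  by rewrite !mul1r /= !addr0.
have p1 a' c' x : g (a', x + 1, c') = g (a', x, c').
  rewrite -[RHS](pg _ (inord 1)); congr g; rewrite -[evec R _]scale1r evec_coord /= inordK//=.
  by rewrite !mul1r /= !addr0.
have p2 a' b' x : g (a', b', x + 1) = g (a', b', x).
  rewrite -[RHS](pg _ (inord 2)); congr g; rewrite -[evec R _]scale1r evec_coord /= inordK//=.
  by rewrite !mul1r /= !addr0.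
rewrite -(periodic_int (p0 _ _) (fract a) (Num.floor a)) subrK.
rewrite -(periodic_int (p1 _ _) (fract b) (Num.floor b)) subrK.
by rewrite -(periodic_int (p2 _ _) (fract c) (Num.floor c)) subrK.
Qed.

(** Passing to fractional parts brings every point into the compact set [a, b] x [0, 1]^3. *)
Lemma periodic_bdd (a b : R) (f : spacetime R -> R) : a <= b -> continuous f -> xperiodic f ->
  exists2 C, 0 <= C & forall z, a <= z.1 <= b -> `|f z| <= C.
Proof.
move=> ab cf pf.
pose K : set (spacetime R) := `[a, b] `*` ((`[0, 1] `*` `[0, 1]) `*` `[0, 1]).
have cK : compact K by do !apply: compact_setX; exact: segment_compact.
have K0 : K !=set0.
  by exists (a, ((0, 0), 0)); rewrite /K /= !in_itv /= lexx ab ler01 lexx.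
have cnf : {within K, continuous (fun z => `|f z|)}.
  apply: continuous_subspaceT => z; apply: (@continuous_comp _ _ _ f Num.norm); first exact: cf.
  exact: norm_continuous.
have [c _ cM] := compact_EVT_max K0 cK cnf.
exists `|f c|; first by [].
move=> [t x] /= tab; rewrite (periodic_fract (pf t)); apply: cM; apply/mem_set.
have h y : 0 <= fract y <= 1 by have /andP[-> /ltW ->] := fract_itv y.
by rewrite /K /= !in_itv /= tab !h.
Qed.

End Periodic.

(** * Integration over the periodicity cell *)

Definition set_coord {R : realType} (i : 'I_3) (s : R) (x : R * R * R) : R * R * R :=
  match val i with
  | 0%N => (s, x.1.2, x.2)
  | 1%N => (x.1.1, s, x.2)
  | _ => (x.1.1, x.1.2, s)
  end.

Section Box.
Context {R : realType}.
Let Q : set (measurableTypeR R) := `[0, 1[%classic.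

Let mQ : measurable Q. Proof. exact: measurable_itv. Qed.
Let mQQ : measurable (Q `*` Q). Proof. exact: measurableX. Qed.

Lemma measurable_cube : measurable (@cube R).
Proof. by apply: measurableX => //; exact: measurableX. Qed.

Let leb1Q : leb1 R Q = 1%E.
Proof. by rewrite /Q leb1_itv// subr0. Qed.

Let leb1Qoo : (leb1 R Q < +oo)%E. Proof. by rewrite leb1Q ltry. Qed.

Let leb2Q : leb2 R (Q `*` Q) = 1%E.
Proof. by rewrite /leb2 [LHS]product_measure1E// -[LHS]/(leb1 R Q * leb1 R Q)%E leb1Q mule1. Qed.

Let leb2Qoo : (leb2 R (Q `*` Q) < +oo)%E. Proof. by rewrite leb2Q ltry. Qed.

Lemma leb3_cube : leb3 R (@cube R) = 1%E.
Proof. by rewrite /leb3 [LHS]product_measure1E// -[LHS]/(leb2 R (Q `*` Q) * leb1 R Q)%E leb1Q leb2Q mule1. Qed.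

Lemma leb3_cube_lty : (leb3 R (@cube R) < +oo)%E. Proof. by rewrite leb3_cube ltry. Qed.

Definition box (J : set (measurableTypeR R)) : set (mspacetime R) := J `*` @cube R.

Lemma leb4_box J : measurable J -> leb4 R (box J) = leb1 R J.
Proof.
move=> mJ; rewrite /leb4 /box [LHS]product_measure1E//; last exact: measurable_cube.
by rewrite -[LHS]/(leb1 R J * leb3 R (@cube R))%E leb3_cube mule1.
Qed.

Lemma measurable_box J : measurable J -> measurable (box J).
Proof. by move=> mJ; apply: measurableX => //; exact: measurable_cube. Qed.

Lemma leb4_box_lty J : measurable J -> (leb1 R J < +oo)%E -> (leb4 R (box J) < +oo)%E.
Proof. by move=> mJ Joo; rewrite leb4_box. Qed.

Lemma measurable_slice {d1 d2 d3 : measure_display} {T1 : measurableType d1}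
    {T2 : measurableType d2} {T3 : measurableType d3} (f : T1 * T2 -> T3) :
  measurable_fun setT f -> (forall x, measurable_fun setT (fun y => f (x, y))) /\
    (forall y, measurable_fun setT (fun x => f (x, y))).
Proof.
move=> mf; split=> [x|y].
  exact: (measurableT_comp mf (pair1_measurable x)).
exact: (measurableT_comp mf (pair2_measurable y)).
Qed.

(** Fubini with coordinate i innermost. Divergences, translations and shears act along one
    coordinate line at a time, so this form covers them all. *)
Lemma eq_cube_integral (i : 'I_3) (g h : R * R * R -> R) :
  measurable_fun (setT : set (mspace R)) g -> measurable_fun (setT : set (mspace R)) h ->
  bdd (@cube R) g -> bdd (@cube R) h ->
  (forall x, ival 0 1 (fun s => g (set_coord i s x)) =
             ival 0 1 (fun s => h (set_coord i s x))) ->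
  \int[leb3 R]_(x in @cube R) g x = \int[leb3 R]_(x in @cube R) h x.
Proof.
move=> mg mh bg bh; case: i => -[|[|[|//]]] /= i3 gh.
- have F f : measurable_fun (setT : set (mspace R)) f -> bdd (@cube R) f ->
      \int[leb3 R]_(x in @cube R) f x =
      \int[leb1 R]_(z in Q) \int[leb1 R]_(y in Q) ival 0 1 (fun x => f (x, y, z)).
    move=> mf [C fC]; rewrite [LHS](Rintegral_prod2 mQQ mQ leb2Qoo leb1Qoo mf); last by exists C.
    apply: eq_Rintegral => z /set_mem zQ.
    have [_ mfz] := measurable_slice mf.
    rewrite [LHS](Rintegral_prod2 mQ mQ leb1Qoo leb1Qoo (mfz z)) //.
    by exists C => -[x y] [xQ yQ]; exact: fC.
  rewrite [LHS](F g mg bg) [RHS](F h mh bh); apply: eq_Rintegral => z _; apply: eq_Rintegral => y _.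
  exact: (gh (0, y, z)).
- have F f : measurable_fun (setT : set (mspace R)) f -> bdd (@cube R) f ->
      \int[leb3 R]_(x in @cube R) f x =
      \int[leb1 R]_(z in Q) \int[leb1 R]_(x in Q) ival 0 1 (fun y => f (x, y, z)).
    move=> mf [C fC]; rewrite [LHS](Rintegral_prod2 mQQ mQ leb2Qoo leb1Qoo mf); last by exists C.
    apply: eq_Rintegral => z /set_mem zQ.
    have [_ mfz] := measurable_slice mf.
    rewrite [LHS](Rintegral_prod1 mQ mQ leb1Qoo leb1Qoo (mfz z)) //.
    by exists C => -[x y] [xQ yQ]; exact: fC.
  rewrite [LHS](F g mg bg) [RHS](F h mh bh); apply: eq_Rintegral => z _; apply: eq_Rintegral => x _.
  exact: (gh (x, 0, z)).
- have F f : measurable_fun (setT : set (mspace R)) f -> bdd (@cube R) f ->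
      \int[leb3 R]_(x in @cube R) f x =
      \int[leb2 R]_(x in Q `*` Q) ival 0 1 (fun z => f (x, z)).
    by move=> mf bf; rewrite [LHS](Rintegral_prod1 mQQ mQ leb2Qoo leb1Qoo mf).
  rewrite [LHS](F g mg bg) [RHS](F h mh bh); apply: eq_Rintegral => -[x y] _.
  exact: (gh (x, y, 0)).
Qed.

Section Time.
Variable J : set (measurableTypeR R).
Hypotheses (mJ : measurable J) (Joo : (leb1 R J < +oo)%E).

Lemma box_integral_time (f : spacetime R -> R) :
  measurable_fun (setT : set (mspacetime R)) f -> bdd (box J) f ->
  \int[leb4 R]_(z in box J) f z = \int[leb1 R]_(t in J) \int[leb3 R]_(x in @cube R) f (t, x).
Proof.
by move=> mf bf; rewrite [LHS](Rintegral_prod1 mJ measurable_cube Joo leb3_cube_lty mf).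
Qed.

Lemma box_integral_space (f : spacetime R -> R) :
  measurable_fun (setT : set (mspacetime R)) f -> bdd (box J) f ->
  \int[leb4 R]_(z in box J) f z = \int[leb3 R]_(x in @cube R) \int[leb1 R]_(t in J) f (t, x).
Proof.
by move=> mf bf; rewrite [LHS](Rintegral_prod2 mJ measurable_cube Joo leb3_cube_lty mf).
Qed.

Lemma eq_box_integral (i : 'I_3) (f g : spacetime R -> R) :
  measurable_fun (setT : set (mspacetime R)) f ->
  measurable_fun (setT : set (mspacetime R)) g ->
  bdd (box J) f -> bdd (box J) g ->
  (forall t x, J t -> ival 0 1 (fun s => f (t, set_coord i s x)) =
                      ival 0 1 (fun s => g (t, set_coord i s x))) ->
  \int[leb4 R]_(z in box J) f z = \int[leb4 R]_(z in box J) g z.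
Proof.
move=> mf mg bf bg fg; rewrite [LHS](box_integral_time mf bf) [RHS](box_integral_time mg bg).
apply: eq_Rintegral => t /set_mem tJ.
have [mft _] := measurable_slice mf; have [mgt _] := measurable_slice mg.
apply: (eq_cube_integral (i := i)) => //.
- by case: bf => C fC; exists C => x xc; exact: fC.
- by case: bg => C gC; exists C => x xc; exact: gC.
- by move=> x; exact: fg.
Qed.

Lemma box_integrable (f : spacetime R -> R) :
  measurable_fun (setT : set (mspacetime R)) f -> bdd (box J) f ->
  (leb4 R).-integrable (box J) (EFin \o f).
Proof.
move=> mf bf; apply: bdd_integrable => //.
- exact: measurable_box.
- exact: leb4_box_lty.
- exact: measurable_funTS.
Qed.

End Time.

Lemma cube_integrable (f : R * R * R -> R) :
  measurable_fun (setT : set (mspace R)) f -> bdd (@cube R) f ->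
  (leb3 R).-integrable (@cube R) (EFin \o f).
Proof.
move=> mf bf; apply: bdd_integrable => //.
- exact: measurable_cube.
- exact: leb3_cube_lty.
- exact: measurable_funTS.
Qed.

End Box.

(** * Integration by parts on the torus *)

Section Divergence.
Context {R : realType}.

Lemma is_derive_slice {V : normedModType R} (F : R -> R) (f : V -> R) (z w : V) (s a : R) :
  (forall h, F (h + s) = f (h *: w + z)) -> is_derive z w f a -> is_derive s 1 F a.
Proof.
move=> Ff /is_derive_line D; apply/is_derive_line.
have -> : (fun h : R => F (h *: 1 + s)) = fun h => f (h *: w + z).
  by apply/funext => h; rewrite -Ff -[h *: 1]/(h * 1) mulr1.
exact: D.
Qed.

Lemma set_coordE (i : 'I_3) (x : R * R * R) s h :
  set_coord i (h + s) x = h *: evec R i + set_coord i s x.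
Proof.
rewrite [RHS]addrC evec_coord; case: x => [[a b] c].
by case: i => -[|[|[|//]]] ?; rewrite /set_coord /= !mulr0 !addr0 mulr1 addrC.
Qed.

Lemma is_derive_coord (f : spacetime R -> R) (i : 'I_3) t x (s : R) : smooth_on setT f ->
  is_derive s 1 (fun s => f (t, set_coord i s x)) (Dx i f (t, set_coord i s x)).
Proof.
move=> sf; apply: is_derive_slice (smooth_is_derive _ _ sf) => h.
rewrite set_coordE; congr f; congr pair.
by rewrite -[RHS]/(h * 0 + t) mulr0 add0r.
Qed.

Lemma is_derive_time (f : spacetime R -> R) x (t : R) : smooth_on setT f ->
  is_derive t 1 (fun t => f (t, x)) (Dt f (t, x)).
Proof.
move=> sf; apply: is_derive_slice (smooth_is_derive _ _ sf) => h.
congr f; congr pair; first by rewrite -[RHS]/(h * 1 + t) mulr1.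
by rewrite -[RHS]/(h *: (0 : R * R * R) + x) scaler0 add0r.
Qed.

End Divergence.

Section PeriodicDerivatives.
Context {R : realType}.

Lemma derive_translate {V : normedModType R} (f : V -> R) p w z :
  (forall z, f (z + p) = f z) -> 'D_w f (z + p) = 'D_w f z.
Proof.
move=> fp; rewrite /derive.
set g1 := fun h => h^-1 *: _; set g2 := fun h => h^-1 *: _.
suff -> : g1 = g2 by [].
by apply/funext => h; rewrite /g1 /g2 /= addrA !fp.
Qed.

Lemma xperiodicP {Y : Type} (f : spacetime R -> Y) :
  xperiodic f <-> forall i z, f (z + (0, evec R i)) = f z.
Proof.
split=> pf; first by move=> i [t x]; rewrite -[RHS](pf t x i) -[t in RHS]addr0.
by move=> t x i; rewrite -[RHS](pf i (t, x)) -[t in LHS]addr0.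
Qed.

Lemma xperiodic_derive (f : spacetime R -> R) w : xperiodic f -> xperiodic ('D_w f).
Proof.
move=> /xperiodicP pf; apply/xperiodicP => i z.
by apply: derive_translate => z'; exact: pf.
Qed.

Lemma xperiodic_comp2 {Y Z W : Type} (op : Y -> Z -> W) (f : spacetime R -> Y)
    (g : spacetime R -> Z) :
  xperiodic f -> xperiodic g -> xperiodic (fun z => op (f z) (g z)).
Proof. by move=> pf pg t x i; rewrite pf pg. Qed.

Lemma smooth_Dx i (f : spacetime R -> R) : smooth_on setT f -> smooth_on setT (Dx i f).
Proof. exact: smooth_derive. Qed.

Lemma smooth_Dt (f : spacetime R -> R) : smooth_on setT f -> smooth_on setT (Dt f).
Proof. exact: smooth_derive. Qed.

Lemma smooth_measurable (f : spacetime R -> R) : smooth_on setT f ->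
  measurable_fun (setT : set (mspacetime R)) f.
Proof. by move=> sf; exact: (continuous_measurable4 (smooth_continuous sf)). Qed.

Lemma smooth_bounded (f : spacetime R -> R) : smooth_on setT f -> xperiodic f ->
  exists2 C, 0 <= C & forall z, 0 <= z.1 <= 2 -> `|f z| <= C.
Proof. by move=> sf pf; exact: (periodic_bdd (ler0n R 2) (smooth_continuous sf) pf). Qed.

(** Confinement to [0, 2] makes smooth periodic functions bounded on the corresponding boxes, since
    periodicity concerns the space variables alone. *)
Definition slice_interval (J : set (measurableTypeR R)) :=
  measurable J /\ J `<=` `[0, 2].

Lemma slice_interval_lty J : slice_interval J -> (leb1 R J < +oo)%E.
Proof.
move=> [mJ J2]; apply: (@le_lt_trans _ _ (leb1 R `[0, 2]%classic)).
  by apply: le_measure; rewrite ?inE//; exact: measurable_itv.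
by rewrite leb1_itv// ltry.
Qed.

Lemma smooth_bdd J (f : spacetime R -> R) : slice_interval J -> smooth_on setT f ->
  xperiodic f -> bdd (box J) f.
Proof.
move=> [_ J2] sf pf; have [C _ fC] := smooth_bounded sf pf.
by exists C => -[t x] [/J2 tJ _]; apply: fC; move: tJ; rewrite /= in_itv.
Qed.

Lemma time_slab (t : R) : 0 <= t <= 2 -> slice_interval `]0, t[.
Proof.
move=> /andP[t0 t2]; split; first exact: measurable_itv.
by move=> s /=; rewrite !in_itv/= => /andP[/ltW -> /ltW h]; exact: le_trans t2.
Qed.

Lemma slab_box (t : R) : slab t = box `]0, t[.
Proof. by []. Qed.

Lemma smooth_box_integrable J (f : spacetime R -> R) : slice_interval J ->
  smooth_on setT f -> xperiodic f -> (leb4 R).-integrable (box J) (EFin \o f).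
Proof.
move=> hJ sf pf; apply: box_integrable; first by case: hJ.
- exact: slice_interval_lty.
- exact: smooth_measurable.
- exact: smooth_bdd.
Qed.

Lemma xperiodic_set_coord (f : spacetime R -> R) i t s x : xperiodic f ->
  f (t, set_coord i (s + 1) x) = f (t, set_coord i s x).
Proof.
by move=> pf; rewrite addrC set_coordE scale1r [_ + set_coord _ _ _]addrC pf.
Qed.

(** On each coordinate line the fundamental theorem of calculus leaves the difference of the values
    at 1 and 0, which periodicity makes 0. *)
Lemma box_divergence J i (f : spacetime R -> R) : slice_interval J ->
  smooth_on setT f -> xperiodic f -> \int[leb4 R]_(z in box J) Dx i f z = 0.
Proof.
move=> hJ sf pf.
have sD := smooth_Dx i sf; have pD : xperiodic (Dx i f) by exact: xperiodic_derive.
have E : \int[leb4 R]_(z in box J) Dx i f z = \int[leb4 R]_(z in box J) (fun=> 0) z.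
  apply: (eq_box_integral hJ.1 (slice_interval_lty hJ) (i := i)).
  - exact: smooth_measurable.
  - exact: measurable_cst.
  - exact: smooth_bdd.
  - exact: bdd_cst.
  move=> t x _; have D s := is_derive_coord i t x s sf.
  have cD : continuous (fun s => Dx i f (t, set_coord i s x)).
    by apply: (@is_derive_continuous _ _ (fun s => Dx i (Dx i f) (t, set_coord i s x))) => s; exact: is_derive_coord.
  rewrite (ival_FTC D)//.
  have -> : f (t, set_coord i 1 x) = f (t, set_coord i 0 x).
    by rewrite -(xperiodic_set_coord i t 0 x pf) add0r.
  by rewrite subrr /ival /Rintegral integral0.
by rewrite E /Rintegral integral0.
Qed.

Lemma slab_time_derivative (t : R) (f : spacetime R -> R) : 0 <= t <= 2 ->
  smooth_on setT f -> xperiodic f ->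
  \int[leb4 R]_(z in slab t) Dt f z =
  \int[leb3 R]_(x in @cube R) f (t, x) - \int[leb3 R]_(x in @cube R) f (0, x).
Proof.
move=> ht sf pf; have /andP[t0 t2] := ht.
have sD := smooth_Dt sf; have pD : xperiodic (Dt f) by exact: xperiodic_derive.
have hJ := time_slab ht.
have bf s : 0 <= s <= 2 -> bdd (@cube R) (fun x => f (s, x)).
  by move=> hs; have [C _ fC] := smooth_bounded sf pf; exists C => x _; exact: fC.
have cf s : continuous (fun x => f (s, x)).
  by apply: continuous_pairl; exact: smooth_continuous.
have mf s : measurable_fun (setT : set (mspace R)) (fun x => f (s, x)).
  exact: continuous_measurable3 (cf s).
have fi s : 0 <= s <= 2 -> (leb3 R).-integrable (@cube R) (EFin \o (fun x => f (s, x))).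
  by move=> hs; apply: cube_integrable => //; exact: bf.
rewrite [LHS](box_integral_space hJ.1 (slice_interval_lty hJ) (smooth_measurable sD)
  (smooth_bdd hJ sD pD)).
rewrite -[RHS]RintegralB//; first last.
- by apply: fi; rewrite lexx ler0n.
- exact: fi.
- exact: measurable_cube.
apply: eq_Rintegral => x _.
have D s := is_derive_time x s sf.
have cD : continuous (fun s => Dt f (s, x)).
  by apply: (@is_derive_continuous _ _ (fun s => Dt (Dt f) (s, x))) => s; exact: is_derive_time.
rewrite -(ival_FTC D)//; apply: Rintegral_itv_obnd_cbnd.
apply: integrableS (continuous_itv_integrable 0 t cD) => //.
exact: subset_itv_oo_cc.
Qed.

End PeriodicDerivatives.

(** * Hoelder and Lebesgue norms *)

Section Holder.
Context {R : realType}.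

Lemma ler_norm_pair1 {U V : normedModType R} (z : U * V) : `|z.1| <= `|z|.
Proof. by rewrite prod_normE le_max lexx. Qed.

Lemma ler_norm_pair2 {U V : normedModType R} (z : U * V) : `|z.2| <= `|z|.
Proof. by rewrite prod_normE le_max lexx orbT. Qed.

Lemma enorm_ge0 m n (A : 'M[R]_(m, n)) : 0 <= enorm A.
Proof. exact: sqrtr_ge0. Qed.

Lemma sqr_enorm m n (A : 'M[R]_(m, n)) : enorm A ^+ 2 = \sum_i \sum_j A i j ^+ 2.
Proof. by rewrite sqr_sqrtr// sumr_ge0// => i _; apply: sumr_ge0 => j _; exact: sqr_ge0. Qed.

Lemma sqr_enorm_row (u : 'rV[R]_3) : enorm u ^+ 2 = \sum_j u 0 j ^+ 2.
Proof. by rewrite sqr_enorm big_ord1. Qed.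

(** The factor 2 stands for the square root of 3, which keeps all constants rational. *)
Lemma enorm_le (u : 'rV[R]_3) c : (forall j, `|u 0 j| <= c) -> enorm u <= 2 * c.
Proof.
move=> uc; have c0 : 0 <= c := le_trans (normr_ge0 _) (uc ord0).
rewrite -(ler_pXn2r (n := 2)) ?nnegrE ?enorm_ge0 ?mulr_ge0// sqr_enorm_row.
apply: (@le_trans _ _ (\sum_(j < 3) c ^+ 2)).
  by apply: ler_sum => j _; rewrite -real_normK ?num_real// lerXn2r ?nnegrE.
rewrite sumr_const card_ord exprMn -[X in X <= _]mulr_natl ler_wpM2r ?sqr_ge0//.
by rewrite -natrX ler_nat.
Qed.

Lemma coord_le_enorm (u : 'rV[R]_3) j : `|u 0 j| <= enorm u.
Proof.
rewrite -(ler_pXn2r (n := 2)) ?nnegrE ?enorm_ge0// sqr_enorm_row real_normK ?num_real//.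
by rewrite (bigD1 j)//= lerDl sumr_ge0// => i _; exact: sqr_ge0.
Qed.

(** The points are joined by changing the time and then the three coordinates in turn; the path
    stays at times in [0, 2], where the derivatives are bounded. *)
Lemma smooth_lipschitz (f : spacetime R -> R) : smooth_on setT f -> xperiodic f ->
  exists2 L, 0 <= L & forall z w, 0 <= z.1 <= 2 -> 0 <= w.1 <= 2 ->
    `|f z - f w| <= L * `|z - w|.
Proof.
move=> sf pf.
have pD w : xperiodic ('D_w f) by exact: xperiodic_derive.
have [Ct Ct0 hCt] := smooth_bounded (smooth_Dt sf) (pD _).
have /choice[C hC] : forall i, exists C, 0 <= C /\ forall z, 0 <= z.1 <= 2 -> `|Dx i f z| <= C.
  by move=> i; have [c c0 hc] := smooth_bounded (smooth_Dx i sf) (pD _); exists c.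
pose i0 : 'I_3 := ord0; pose i1 : 'I_3 := inord 1; pose i2 : 'I_3 := inord 2.
have v1 : val i1 = 1%N by rewrite /= inordK.
have v2 : val i2 = 2%N by rewrite /= inordK.
have stepx i t x s s' : 0 <= t <= 2 ->
    `|f (t, set_coord i s x) - f (t, set_coord i s' x)| <= C i * `|s - s'|.
  move=> ht; apply: (is_derive_lipschitz (fun s => is_derive_coord i t x s sf)) => s0.
  exact: (hC i).2.
have stept x s s' : 0 <= s <= 2 -> 0 <= s' <= 2 ->
    `|f (s, x) - f (s', x)| <= Ct * `|s - s'|.
  move=> hs hs'; wlog ss : s s' hs hs' / s' <= s.
    by move=> H; have [/H->//|/ltW/H] := leP s' s; rewrite distrC [`|s' - s|]distrC; apply.
  have [r /andP[r1 r2] ->] := is_derive_mvt (fun s => is_derive_time x s sf) ss.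
  rewrite normrM ler_wpM2r//; apply: hCt => /=.
  by move: hs hs' => /andP[_ h2] /andP[h3 _]; rewrite (le_trans h3)// (le_trans r2).
exists (Ct + (C i0 + (C i1 + C i2))).
  by rewrite !addr_ge0// ; apply: (hC _).1.
move=> [t [[a b] c]] [t' [[a' b'] c']] /= ht ht'.
set z := (t, _); set w := (t', _).
have zw0 : `|t - t'| <= `|z - w| by exact: (ler_norm_pair1 (z - w)).
have zw1 : `|a - a'| <= `|z - w|.
  apply: le_trans (ler_norm_pair2 (z - w)); apply: le_trans (ler_norm_pair1 _).
  exact: (ler_norm_pair1 (z - w).2.1).
have zw2 : `|b - b'| <= `|z - w|.
  apply: le_trans (ler_norm_pair2 (z - w)); apply: le_trans (ler_norm_pair1 _).
  exact: (ler_norm_pair2 (z - w).2.1).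
have zw3 : `|c - c'| <= `|z - w|.
  apply: le_trans (ler_norm_pair2 (z - w)).
  exact: (ler_norm_pair2 (z - w).2).
have h0 := stept ((a, b), c) t t' ht ht'.
have h1 := stepx i0 t' ((a, b), c) a a' ht'.
have h2 := stepx i1 t' ((a', b), c) b b' ht'.
have h3 := stepx i2 t' ((a', b'), c) c c' ht'.
move: h1 h2 h3; rewrite /set_coord v1 v2 /= => h1 h2 h3.
have E : f z - f w = (f z - f (t', ((a, b), c))) + ((f (t', ((a, b), c)) - f (t', ((a', b), c)))
   + ((f (t', ((a', b), c)) - f (t', ((a', b'), c))) + (f (t', ((a', b'), c)) - f w))) by ring.
rewrite E !mulrDl.
apply: (le_trans (ler_normD _ _)); apply: lerD.
  by apply: (le_trans h0); rewrite ler_wpM2l.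
apply: (le_trans (ler_normD _ _)); apply: lerD.
  by apply: (le_trans h1); rewrite ler_wpM2l//; exact: (hC _).1.
apply: (le_trans (ler_normD _ _)); apply: lerD.
  by apply: (le_trans h2); rewrite ler_wpM2l//; exact: (hC _).1.
by apply: (le_trans h3); rewrite ler_wpM2l//; exact: (hC _).1.
Qed.

(** One constant controls both the supremum and the seminorm of a scalar function: such bounds add
    up over the stages and pass to pointwise limits. *)
Definition holder_le {V : normedModType R} (D : set V) (a : R) (g : V -> R) (C : R) :=
  (forall z, D z -> `|g z| <= C) /\
  forall z w, D z -> D w -> `|g z - g w| <= C * `|z - w| `^ a.

Lemma holder_norm_le {V : normedModType R} (D : set V) a (f : V -> 'rV[R]_3) C :
  D !=set0 -> (forall j, holder_le D a (fun z => f z 0 j) C) ->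
  (holder_norm D a f <= (4 * C)%:E)%E.
Proof.
move=> [z0 Dz0] fC.
have -> : 4 * C = 2 * C + 2 * C by ring.
rewrite EFinD; apply: leeD.
  apply: ub_ereal_sup => _ [z Dz <-]; rewrite lee_fin; apply: enorm_le => j.
  exact: (fC j).1.
apply: ub_ereal_sup => _ [[z w] /= [Dz Dw zw] <-]; rewrite lee_fin.
have zw0 : 0 < `|z - w| `^ a by rewrite powR_gt0// normr_gt0 subr_eq0.
rewrite ler_pdivrMr// -mulrA; apply: enorm_le => j.
by rewrite !mxE; exact: (fC j).2.
Qed.

Lemma holder_leD {V : normedModType R} (D : set V) a (f g : V -> R) C C' :
  holder_le D a f C -> holder_le D a g C' -> holder_le D a (fun z => f z + g z) (C + C').
Proof.
move=> [f1 f2] [g1 g2]; split=> [z Dz|z w Dz Dw].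
  by apply: (le_trans (ler_normD _ _)); apply: lerD; [exact: f1|exact: g1].
rewrite opprD addrACA mulrDl.
by apply: (le_trans (ler_normD _ _)); apply: lerD; [exact: f2|exact: g2].
Qed.

Lemma holder_leZ {V : normedModType R} (D : set V) a (f : V -> R) C k :
  holder_le D a f C -> holder_le D a (fun z => k * f z) (`|k| * C).
Proof.
move=> [f1 f2]; split=> [z Dz|z w Dz Dw].
  by rewrite normrM ler_wpM2l// f1.
by rewrite -mulrBr normrM -mulrA ler_wpM2l// f2.
Qed.

Lemma holder_leW {V : normedModType R} (D : set V) a (f : V -> R) C C' : C <= C' ->
  holder_le D a f C -> holder_le D a f C'.
Proof.
move=> CC [f1 f2]; split=> [z Dz|z w Dz Dw]; first exact: le_trans (f1 z Dz) CC.
by apply: (le_trans (f2 z w Dz Dw)); rewrite ler_wpM2r// powR_ge0.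
Qed.

Lemma holder_le_cvg {V : normedModType R} (D : set V) a (f : nat -> V -> R) g C :
  (forall n, holder_le D a (f n) C) -> (forall z, D z -> f ^~ z @ \oo --> g z) ->
  holder_le D a g C.
Proof.
move=> hf fg; split=> [z Dz|z w Dz Dw].
  have h : (fun n => `|f n z|) @ \oo --> `|g z| by apply: cvg_norm; exact: fg.
  rewrite -(cvg_lim _ h)//; apply: limr_le; first by apply/cvg_ex; exists `|g z|.
  by apply: nearW => n; exact: (hf n).1.
have h : (fun n => `|f n z - f n w|) @ \oo --> `|g z - g w|.
  by apply: cvg_norm; apply: cvgB; exact: fg.
rewrite -(cvg_lim _ h)//; apply: limr_le; first by apply/cvg_ex; exists `|g z - g w|.
by apply: nearW => n; exact: (hf n).2.
Qed.

(* Interpolation between the sup norm and the Lipschitz constant at scale 1/N. *)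
Lemma holder_le_lipschitz {V : normedModType R} (D : set V) a (f : V -> R) S N :
  0 < a < 1 -> 1 <= N -> (forall z, D z -> `|f z| <= S) ->
  (forall z w, D z -> D w -> `|f z - f w| <= S * N * `|z - w|) ->
  0 <= S -> holder_le D a f (2 * S * N `^ a).
Proof.
move=> /andP[a0 a1] N1 fS fL S0.
have Na1 : 1 <= N `^ a by rewrite -(powRr0 N) ler_powR// ltW.
split=> [z Dz|z w Dz Dw].
  apply: (le_trans (fS z Dz)); rewrite -[leLHS]mulr1; apply: ler_pM => //.
  by rewrite mulr_natl mulr2n lerDl.
set u := `|z - w|; have u0 : 0 <= u by exact: normr_ge0.
have N0 : 0 <= N by rewrite (le_trans ler01).
rewrite -[leRHS]mulrA -powRM//; have [Nu|/ltW Nu] := leP 1 (N * u).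
  apply: (@le_trans _ _ (2 * S * 1)).
    rewrite mulr1 mulr_natl mulr2n; apply: (le_trans (ler_normB _ _)).
    by apply: lerD; exact: fS.
  rewrite ler_wpM2l ?mulr_ge0//.
  by rewrite -(powRr0 (N * u)) ler_powR// ltW.
apply: (le_trans (fL z w Dz Dw)); rewrite -/u -[leLHS]mulrA.
apply: ler_pM => //; first by rewrite mulr_ge0.
  by rewrite mulr_natl mulr2n lerDl.
have [->|Nu0] := eqVneq (N * u) 0; first exact: powR_ge0.
apply: ger1_powR; last exact: ltW.
by rewrite Nu andbT lt_neqAle eq_sym Nu0 mulr_ge0.
Qed.

Lemma smooth_holder a (f : spacetime R -> R) : 0 < a < 1 -> smooth_on setT f ->
  xperiodic f -> exists C, holder_le (@strip R) a f C.
Proof.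
move=> ha sf pf.
have [S S0 hS] := smooth_bounded sf pf; have [L L0 hL] := smooth_lipschitz sf pf.
have st z : strip z -> 0 <= z.1 <= 2.
  by move=> [/=]; rewrite in_itv /= => /andP[/ltW-> /ltW->].
exists (2 * (S + L) * 1 `^ a); apply: holder_le_lipschitz => //.
- by move=> z /st/hS h; apply: (le_trans h); rewrite lerDl.
- move=> z w /st hz /st hw; rewrite mulr1; apply: (le_trans (hL z w hz hw)).
  by rewrite ler_wpM2r// lerDr.
- by rewrite addr_ge0.
Qed.

End Holder.

(** * Bounds on Lebesgue norms uniform in the exponent *)

Section LpBounds.
Context {R : realType}.
Local Open Scope ereal_scope.

(** Compares the suprema over simple functions that define the two integrals; this covers the norms,
    which are defined for arbitrary functions. *)
Lemma ge0_le_integral_pointwise {d} {T : measurableType d}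
    (mu : {measure set T -> \bar R}) (f g : T -> \bar R) :
  (forall x, 0 <= f x) -> (forall x, f x <= g x) -> \int[mu]_x f x <= \int[mu]_x g x.
Proof.
move=> f0 fg; have g0 x : 0 <= g x := le_trans (f0 x) (fg x).
rewrite !ge0_integralTE//; apply: le_ereal_sup => _ [h hf <-].
by exists h => // x; exact: le_trans (hf x) (fg x).
Qed.

(** Since M >= 1, M^(1/p) <= M, so that one bound serves all exponents, the infinite one
    included. *)
Lemma Lnorm_le {d} {T : measurableType d} (mu : {measure set T -> \bar R}) (D : set T)
    (g : T -> \bar R) (C M : R) p :
  measurable D -> mu D <= M%:E -> (1 <= M)%R -> (0 <= C)%R ->
  (forall x, D x -> 0 <= g x <= C%:E) -> 1 <= p ->
  'N[mu]_p[g \_ D] <= (C * M)%:E.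
Proof.
move=> mD DM M1 C0 gC; have M0 : (0 <= M)%R by exact: le_trans M1.
have CM0 : (0 <= C * M)%R by rewrite mulr_ge0.
have CCM : (C <= C * M)%R by rewrite ler_peMr.
have gD x : 0 <= (g \_ D) x <= C%:E.
  by rewrite patchE; case: ifPn => [/set_mem/gC//|_]; rewrite lexx lee_fin.
have gDa x : `|(g \_ D) x| = (g \_ D) x by rewrite gee0_abs//; have /andP[] := gD x.
rewrite unlock; case: p => [p|_|//].
- rewrite lee_fin => p1; have p0 : (0 < p)%R by exact: lt_le_trans p1.
  have pn0 : p != 0%R by rewrite gt_eqF.
  have CMp : (0 <= C `^ p * M)%R by rewrite mulr_ge0// powR_ge0.
  have I : \int[mu]_x `|(g \_ D) x| `^ p <= (C `^ p * M)%:E.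
    apply: (@le_trans _ _ (\int[mu]_x ((cst (C `^ p)%:E) \_ D) x)).
      apply: ge0_le_integral_pointwise => x; first exact: poweR_ge0.
      rewrite gDa !patchE; case: ifPn => [/set_mem Dx|_]; last by rewrite poweR0r.
      have /andP[g0 gc] := gC x Dx; rewrite -poweR_EFin.
      by apply: gt0_ler_poweR => //; rewrite ?in_itv/= ?g0 ?leey ?lee_fin ?C0// ltW.
    rewrite -integral_mkcond integral_cst// EFinM.
    by apply: lee_wpmul2l => //; rewrite lee_fin powR_ge0.
  apply: (@le_trans _ _ ((C `^ p * M)%:E `^ p^-1)).
    apply: gt0_ler_poweR => //; rewrite ?in_itv/= ?leey ?lee_fin ?CMp ?invr_ge0 ?(ltW p0)//.
    by rewrite integral_ge0// => x _; exact: poweR_ge0.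
  rewrite poweR_EFin lee_fin powRM ?powR_ge0// -powRrM mulfV// powRr1//.
  by rewrite ler_wpM2l// ler1_powR// invf_le1.
- case: ifPn => _; last by rewrite lee_fin.
  apply/ess_supP; apply: nearW => x /=; rewrite gDa.
  by have /andP[_ h] := gD x; apply: (le_trans h); rewrite lee_fin.
Qed.

Lemma Lp_norm_le {d} {T : measurableType d} (mu : {measure set T -> \bar R}) (D : set T)
    m n (f : T -> 'M[R]_(m, n)) (C M : R) p :
  measurable D -> mu D <= M%:E -> (1 <= M)%R -> (0 <= C)%R ->
  (forall x, D x -> (enorm (f x) <= C)%R) -> 1 <= p ->
  Lp_norm mu D p f <= (C * M)%:E.
Proof.
move=> mD DM M1 C0 fC p1; apply: Lnorm_le => // x Dx.
by rewrite !lee_fin enorm_ge0 fC.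
Qed.

(** Since m <= 1, m^(1/p) >= m. This is the source of a lower bound that does not depend on p. *)
Lemma Lnorm_ge {d} {T : measurableType d} (mu : {measure set T -> \bar R}) (A : set T)
    (g : T -> \bar R) (c m : R) p :
  measurable A -> (0 < m <= 1)%R -> (0 < c)%R -> m%:E <= mu A ->
  (forall x, 0 <= g x) -> (forall x, A x -> c%:E <= g x) -> 1 <= p ->
  (c * m)%:E <= 'N[mu]_p[g].
Proof.
move=> mA /andP[m0 m1] c0 mmA g0 gc.
have ga x : `|g x| = g x by rewrite gee0_abs.
have m0E : 0 < mu A by apply: lt_le_trans mmA; rewrite lte_fin.
rewrite unlock; case: p => [p|_|//].
- rewrite lee_fin => p1; have p0 : (0 < p)%R by exact: lt_le_trans p1.
  have pn0 : p != 0%R by rewrite gt_eqF.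
  have I : (c `^ p * m)%:E <= \int[mu]_x `|g x| `^ p.
    apply: (@le_trans _ _ (\int[mu]_x ((cst (c `^ p)%:E) \_ A) x)); last first.
      apply: ge0_le_integral_pointwise => x.
        by rewrite patchE; case: ifPn => //; rewrite lee_fin powR_ge0.
      rewrite ga patchE; case: ifPn => [/set_mem Ax|_]; last exact: poweR_ge0.
      rewrite /= -poweR_EFin; apply: gt0_ler_poweR; rewrite ?in_itv/= ?leey ?g0 ?gc//.
        exact: ltW.
      by rewrite lee_fin (ltW c0).
    rewrite -integral_mkcond integral_cst// EFinM.
    by apply: lee_wpmul2l => //; rewrite lee_fin powR_ge0.
  have cm0 : (0 <= c `^ p * m)%R by rewrite mulr_ge0 ?powR_ge0// (ltW m0).
  apply: (@le_trans _ _ ((c `^ p * m)%:E `^ p^-1)); last first.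
    apply: gt0_ler_poweR => //; rewrite ?in_itv/= ?leey ?lee_fin ?cm0 ?invr_ge0 ?(ltW p0)//.
    by rewrite integral_ge0// => x _; exact: poweR_ge0.
  rewrite poweR_EFin lee_fin powRM ?powR_ge0 ?(ltW m0)// -powRrM mulfV// powRr1 ?(ltW c0)//.
  by rewrite ler_pM2l// ger1_powR ?m0 ?invf_le1.
- have muT : 0 < mu [set: T].
    by apply: lt_le_trans m0E _; apply: le_measure; rewrite ?inE.
  rewrite muT; apply: (@le_trans _ _ c%:E); first by rewrite lee_fin ler_piMr// (ltW c0).
  rewrite leNgt; apply/negP => lt.
  (* For infinite p: if the essential supremum were below c, the set A would be contained in a null
     set. *)
  have [N [mN N0 sN]] := ess_sup_ge mu (abse \o g).
  have : mu A <= mu N.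
    apply: le_measure; rewrite ?inE// => x Ax; apply: sN => /=; apply/negP.
    by rewrite -ltNge ga; apply: lt_le_trans (gc x Ax).
  by rewrite N0 leNgt m0E.
Qed.

End LpBounds.

(** * Classical solutions *)

Section DerivativeRules.
Context {R : realType} {V : normedModType R}.
Implicit Types f g : V -> R.

Lemma smooth_deriveD w f g z : smooth_on setT f -> smooth_on setT g ->
  'D_w (fun z => f z + g z) z = 'D_w f z + 'D_w g z.
Proof.
move=> sf sg; have := is_derive_addf (smooth_is_derive w z sf) (smooth_is_derive w z sg).
by case.
Qed.

Lemma smooth_deriveM w f g z : smooth_on setT f -> smooth_on setT g ->
  'D_w (fun z => f z * g z) z = f z * 'D_w g z + g z * 'D_w f z.
Proof.
move=> sf sg; have := is_derive_mulf (smooth_is_derive w z sf) (smooth_is_derive w z sg).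
by case.
Qed.

Lemma smooth_deriveZ w f z k : smooth_on setT f ->
  'D_w (fun z => k * f z) z = k * 'D_w f z.
Proof.
move=> sf; rewrite (smooth_deriveM w z (smooth_cst k) sf) -/(cst k) derive_cst.
by rewrite mulr0 addr0.
Qed.

Lemma smooth_deriveN w f z : smooth_on setT f ->
  'D_w (fun z => - f z) z = - 'D_w f z.
Proof.
move=> sf; rewrite -mulN1r -(smooth_deriveZ w z (-1) sf).
by congr ('D_w _ _); apply/funext => y; rewrite mulN1r.
Qed.

Lemma smooth_deriveB w f g z : smooth_on setT f -> smooth_on setT g ->
  'D_w (fun z => f z - g z) z = 'D_w f z - 'D_w g z.
Proof.
by move=> sf sg; rewrite (smooth_deriveD w z sf (smoothN sg)) smooth_deriveN.
Qed.

Lemma smooth_derive_sum w n (f : 'I_n -> V -> R) z : (forall i, smooth_on setT (f i)) ->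
  'D_w (fun z => \sum_i f i z) z = \sum_i 'D_w (f i) z.
Proof.
elim: n f => [|n IH] f sf.
  rewrite big_ord0 (_ : (fun z => _) = cst 0) ?derive_cst//.
  by apply/funext => y; rewrite big_ord0.
rewrite big_ord_recl -(IH (fun i => f (lift ord0 i)) (fun i => sf (lift ord0 i))).
rewrite -(smooth_deriveD w z (sf ord0) (smooth_sum (fun i => sf (lift ord0 i)))).
by congr ('D_w _ _); apply/funext => y; rewrite big_ord_recl.
Qed.

End DerivativeRules.

Lemma big_ord3 {R : realType} (f : 'I_3 -> R) :
  \sum_i f i = f ord0 + f (inord 1) + f (inord 2).
Proof.
rewrite !big_ord_recl big_ord0 addr0 addrA.
by congr (_ + f _ + f _); apply/val_inj; rewrite /= inordK.
Qed.

Section Classical.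
Context {R : realType}.
Implicit Types (f g phi : spacetime R -> R).

Definition smooth_periodic f := smooth_on setT f /\ xperiodic f.

Lemma spM f g : smooth_periodic f -> smooth_periodic g -> smooth_periodic (fun z => f z * g z).
Proof.
by move=> [sf pf] [sg pg]; split; [exact: smoothM|exact: xperiodic_comp2].
Qed.

Lemma spD f g : smooth_periodic f -> smooth_periodic g -> smooth_periodic (fun z => f z + g z).
Proof.
by move=> [sf pf] [sg pg]; split; [exact: smoothD|exact: xperiodic_comp2].
Qed.

Lemma spB f g : smooth_periodic f -> smooth_periodic g -> smooth_periodic (fun z => f z - g z).
Proof.
by move=> [sf pf] [sg pg]; split; [exact: smoothB|exact: (xperiodic_comp2 (fun a b => a - b) pf pg)].
Qed.

Lemma sp_cst (k : R) : smooth_periodic (fun=> k).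
Proof. by split; [exact: smooth_cst|]. Qed.

Lemma spZ k f : smooth_periodic f -> smooth_periodic (fun z => k * f z).
Proof. by move=> sf; apply: spM => //; exact: sp_cst. Qed.

Lemma sp_sum n (f : 'I_n -> spacetime R -> R) : (forall i, smooth_periodic (f i)) ->
  smooth_periodic (fun z => \sum_i f i z).
Proof.
move=> sf; split; first by apply: smooth_sum => i; exact: (sf i).1.
by move=> t x j; apply: eq_bigr => i _; exact: (sf i).2.
Qed.

Lemma sp_derive w f : smooth_periodic f -> smooth_periodic ('D_w f).
Proof. by move=> [sf pf]; split; [exact: smooth_derive|exact: xperiodic_derive]. Qed.

Lemma sp_Dx i f : smooth_periodic f -> smooth_periodic (Dx i f).
Proof. exact: sp_derive. Qed.

Lemma sp_Dt f : smooth_periodic f -> smooth_periodic (Dt f).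
Proof. exact: sp_derive. Qed.

Lemma sp_laplacian f : smooth_periodic f -> smooth_periodic (laplacian f).
Proof. by move=> sf; apply: sp_sum => i; do 2!apply: sp_Dx. Qed.

Lemma sp_integrable J f : slice_interval J -> smooth_periodic f ->
  (leb4 R).-integrable (box J) (EFin \o f).
Proof. by move=> hJ [sf pf]; exact: smooth_box_integrable. Qed.

(** The weak identities in spacetime are proved by writing the integrand as D_t A + div B: the
    divergence integrates to 0, and only the values of A at the two end times remain. *)
Lemma slab_flux (t : R) f A (B : 'I_3 -> spacetime R -> R) : 0 <= t <= 2 ->
  smooth_periodic A -> (forall j, smooth_periodic (B j)) ->
  (forall z, f z = Dt A z + \sum_j Dx j (B j) z) ->
  \int[leb4 R]_(z in slab t) f z =
  \int[leb3 R]_(x in @cube R) A (t, x) - \int[leb3 R]_(x in @cube R) A (0, x).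
Proof.
move=> ht hA hB fE; have hJ := time_slab ht.
rewrite -(slab_time_derivative ht hA.1 hA.2).
have -> : \int[leb4 R]_(z in slab t) f z =
    \int[leb4 R]_(z in box `]0, t[) (Dt A z + \sum_j Dx j (B j) z).
  by apply: eq_Rintegral => z _; rewrite fE.
have mb : measurable (box `]0, t[) by apply: measurable_box; case: hJ.
have hsum : smooth_periodic (fun z => \sum_j Dx j (B j) z).
  by apply: sp_sum => j; exact: sp_Dx.
rewrite [LHS]RintegralD//; [|exact/sp_integrable/sp_Dt|exact: sp_integrable].
rewrite -[RHS]addr0; congr (_ + _).
have -> : \int[leb4 R]_(z in box `]0, t[) (\sum_j Dx j (B j) z) =
    \int[leb4 R]_(z in box `]0, t[)
      (Dx ord0 (B ord0) z + (Dx (inord 1) (B (inord 1)) z + Dx (inord 2) (B (inord 2)) z)).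
  by apply: eq_Rintegral => z _; rewrite big_ord3 addrA.
have i j : (leb4 R).-integrable (box `]0, t[) (EFin \o Dx j (B j)).
  exact/sp_integrable/sp_Dx.
have h12 : smooth_periodic (fun z => Dx (inord 1) (B (inord 1)) z + Dx (inord 2) (B (inord 2)) z).
  by apply: spD; exact: sp_Dx.
rewrite [LHS]RintegralD//; last exact: (sp_integrable hJ h12).
rewrite [X in _ + X]RintegralD//.
by rewrite !(fun j => box_divergence j hJ (hB j).1 (hB j).2) !addr0.
Qed.

End Classical.

(** * Weak identities satisfied by smooth solutions *)

Definition vcomp {R : realType} (v : vfield R) (i : 'I_3) : spacetime R -> R :=
  fun z => v z 0 i.

Section PointwiseAlgebra.
Context {R : realType}.

(** The product rule with the derivatives replaced by free variables, so that [ring] decides it. The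
    equation eliminates the force, and the divergence condition one derivative of the velocity. *)
Lemma momentum_algebra (nu vi phi dtphi dtv F : R) (w dphi ddphi dvi ddvi dw : 'I_3 -> R) :
  \sum_j dw j = 0 -> dtv + \sum_j w j * dvi j = nu * (\sum_j ddvi j) + F ->
  vi * dtphi + \sum_j vi * w j * dphi j + 0 + nu * vi * (\sum_j ddphi j) + F * phi =
  (vi * dtphi + phi * dtv) +
  \sum_j (vi * w j * dphi j + phi * (vi * dw j + w j * dvi j)
    + nu * (vi * ddphi j + dphi j * dvi j - (phi * ddvi j + dvi j * dphi j))).
Proof.
rewrite !big_ord3; set i1 := inord 1; set i2 := inord 2.
move: (w ord0) (w i1) (w i2) (dw ord0) (dw i1) (dw i2) (dphi ord0) (dphi i1) (dphi i2)
  (ddphi ord0) (ddphi i1) (ddphi i2) (dvi ord0) (dvi i1) (dvi i2) (ddvi ord0) (ddvi i1) (ddvi i2).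
move=> w0 w1 w2 dw0 dw1 dw2 p0 p1 p2 pp0 pp1 pp2 d0 d1 d2 dd0 dd1 dd2 h e.
have -> : F = dtv + (w0 * d0 + w1 * d1 + w2 * d2) - nu * (dd0 + dd1 + dd2).
  by rewrite e addrAC subrr add0r.
have -> : dw0 = - dw1 - dw2 by move: h => /eqP; rewrite -addrA addr_eq0 opprD => /eqP.
by ring.
Qed.

(** The equation contracted with 2 v, again over free variables: the squared gradient is what 2 nu v
    . Laplacian v leaves beside a divergence. *)
Lemma energy_algebra (nu phi dtphi : R) (v dtv F dphi ddphi : 'I_3 -> R)
    (dv ddv : 'I_3 -> 'I_3 -> R) :
  let E := \sum_i v i * v i in
  let dE j := \sum_i 2 * v i * dv i j in
  \sum_j dv j j = 0 ->
  (forall i, dtv i + \sum_j v j * dv i j = nu * (\sum_j ddv i j) + F i) ->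
  E * (dtphi + nu * \sum_j ddphi j) + E * (\sum_j v j * dphi j)
    + 2 * (\sum_i F i * v i) * phi - 2 * nu * ((\sum_i \sum_j dv i j ^+ 2) * phi) =
  (E * dtphi + phi * \sum_i 2 * v i * dtv i) +
  \sum_j (E * v j * dphi j + phi * (E * dv j j + v j * dE j)
    + nu * (E * ddphi j + dphi j * dE j
       - (phi * (\sum_i 2 * (v i * ddv i j + dv i j * dv i j)) + dE j * dphi j))).
Proof.
move=> E dE h e; have := h; have := e ord0; have := e (inord 1); have := e (inord 2).
rewrite /dE /E {h e dE E} !big_ord3; set i1 := inord 1; set i2 := inord 2.
move: (v ord0) (v i1) (v i2) (dtv ord0) (dtv i1) (dtv i2) (dphi ord0) (dphi i1) (dphi i2)
  (ddphi ord0) (ddphi i1) (ddphi i2) (F ord0) (F i1) (F i2)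
  (dv ord0 ord0) (dv ord0 i1) (dv ord0 i2) (dv i1 ord0) (dv i1 i1) (dv i1 i2)
  (dv i2 ord0) (dv i2 i1) (dv i2 i2)
  (ddv ord0 ord0) (ddv ord0 i1) (ddv ord0 i2) (ddv i1 ord0) (ddv i1 i1) (ddv i1 i2)
  (ddv i2 ord0) (ddv i2 i1) (ddv i2 i2).
move=> v0 v1 v2 t0 t1 t2 p0 p1 p2 pp0 pp1 pp2 F0 F1 F2 a00 a01 a02 a10 a11 a12 a20 a21 a22
  b00 b01 b02 b10 b11 b12 b20 b21 b22 e2 e1 e0 h.
have -> : F0 = t0 + (v0 * a00 + v1 * a01 + v2 * a02) - nu * (b00 + b01 + b02).
  by rewrite e0 addrAC subrr add0r.
have -> : F1 = t1 + (v0 * a10 + v1 * a11 + v2 * a12) - nu * (b10 + b11 + b12).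
  by rewrite e1 addrAC subrr add0r.
have -> : F2 = t2 + (v0 * a20 + v1 * a21 + v2 * a22) - nu * (b20 + b21 + b22).
  by rewrite e2 addrAC subrr add0r.
have -> : a00 = - a11 - a22 by move: h => /eqP; rewrite -addrA addr_eq0 opprD => /eqP.
by ring.
Qed.

End PointwiseAlgebra.

Section ClassicalSolution.
Context {R : realType}.
Variables (nu : R) (F v : vfield R).
Let V := vcomp v.
Hypothesis hv : forall i, smooth_periodic (vcomp v i).
Hypothesis hF : forall i, smooth_periodic (vcomp F i).
Hypothesis div0 : forall z, \sum_i Dx i (vcomp v i) z = 0.
Hypothesis eqn : forall z i, Dt (vcomp v i) z + \sum_j vcomp v j z * Dx j (vcomp v i) z =
  nu * laplacian (vcomp v i) z + vcomp F i z.

Let sv i : smooth_on setT (V i) := (hv i).1.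

Let sD i w : smooth_on setT ('D_w (V i)). Proof. exact: smooth_derive (sv i). Qed.

Lemma test0_sp (phi : spacetime R -> R) : test0 phi -> smooth_periodic phi.
Proof. by case. Qed.

Lemma test0_end (phi : spacetime R -> R) x : test0 phi -> phi (2, x) = 0.
Proof. by case=> _ _ [d d0]; apply; rewrite ltrBlDr ltrDl. Qed.

Let le02 : 0 <= (2 : R) <= 2. Proof. by rewrite ler0n lexx. Qed.

Let cube0 (A : R * R * R -> R) : (forall x, A x = 0) ->
  \int[leb3 R]_(x in @cube R) A x = 0.
Proof.
move=> A0; have -> : A = fun=> 0 by apply/funext.
by rewrite /Rintegral integral0.
Qed.

Lemma classical_divergence_free : divergence_free v.
Proof.
move=> phi [/test0_sp tphi _].
rewrite (@slab_flux _ 2 _ (fun=> 0) (fun j z => V j z * phi z))//.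
- by rewrite !cube0// subrr.
- exact: sp_cst.
- by move=> j; apply: spM.
move=> z; rewrite /Dt -/(cst 0) derive_cst add0r.
transitivity (\sum_j (V j z * Dx j phi z) + phi z * \sum_j Dx j (V j) z).
  by rewrite div0 mulr0 addr0.
rewrite mulr_sumr -big_split; apply: eq_bigr => j _ /=.
by rewrite /Dx (smooth_deriveM _ z (sv j) tphi.1).
Qed.

Lemma classical_momentum : momentum_equation nu (fun x => v (0, x)) F v (fun=> 0).
Proof.
move=> phi i tphi0; have tphi := test0_sp tphi0.
have sphi := tphi.1.
have sp w : smooth_on setT ('D_w phi) by exact: smooth_derive sphi.
(* The divergence of the bracket after nu is v_i Laplacian phi - phi Laplacian v_i, which moves the
   viscous term onto the test function. *)
pose B j z := V i z * V j z * phi z + nu * (V i z * Dx j phi z - phi z * Dx j (V i) z).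
rewrite (@slab_flux _ 2 _ (fun z => V i z * phi z) B)//.
- rewrite [X in X - _ + _]cube0 ?sub0r ?addNr//.
  by move=> x; rewrite (test0_end _ tphi0) mulr0.
- exact: spM.
- move=> j; apply: spD; first by do 2!apply: spM => //.
  by apply: spZ; apply: spB; apply: spM => //; exact: sp_Dx.
move=> z.
have DB j : Dx j (B j) z =
    V i z * V j z * Dx j phi z + phi z * (V i z * Dx j (V j) z + V j z * Dx j (V i) z)
    + nu * (V i z * Dx j (Dx j phi) z + Dx j phi z * Dx j (V i) z
      - (phi z * Dx j (Dx j (V i)) z + Dx j (V i) z * Dx j phi z)).
  have s1 := smoothM (sv i) (sv j); have s2 := smoothM s1 sphi.
  have s3 := smoothM (sv i) (sp (0, evec R j)).
  have s4 := smoothM sphi (sD i (0, evec R j)).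
  rewrite /Dx /B (smooth_deriveD _ z s2 (smoothM (smooth_cst nu) (smoothB s3 s4))).
  rewrite (smooth_deriveM _ z s1 sphi) (smooth_deriveM _ z (sv i) (sv j)).
  rewrite (smooth_deriveZ _ z nu (smoothB s3 s4)) (smooth_deriveB _ z s3 s4).
  by rewrite (smooth_deriveM _ z (sv i) (sp _)) (smooth_deriveM _ z sphi (sD i _)).
under [X in _ = _ + X]eq_bigr do rewrite DB.
rewrite /Dt (smooth_deriveM _ z (sv i) sphi) mul0r.
exact: (momentum_algebra (V i z) (phi z) _ _ _ (div0 z) (eqn z i)).
Qed.

Definition gradient (z : spacetime R) : 'M[R]_3 := \matrix_(i, j) Dx j (vcomp v i) z.

Lemma classical_weak_gradient : weak_gradient v gradient.
Proof.
move=> phi i j [tphi0 _]; have tphi := test0_sp tphi0.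
have hVD : smooth_periodic (fun z => V i z * Dx j phi z) by apply: spM => //; exact: sp_Dx.
have hDV : smooth_periodic (fun z => Dx j (V i) z * phi z) by apply: spM => //; exact: sp_Dx.
have hJ := time_slab le02.
apply/eqP; rewrite -subr_eq0 opprK; apply/eqP.
have -> : \int[leb4 R]_(z in slab 2) (gradient z i j * phi z) =
    \int[leb4 R]_(z in box `]0, 2[) (Dx j (V i) z * phi z).
  by apply: eq_Rintegral => z _; rewrite mxE.
have mb : measurable (box (`]0, 2[%classic : set (measurableTypeR R))).
  by apply: measurable_box; case: hJ.
rewrite -[LHS](RintegralD mb (sp_integrable hJ hVD) (sp_integrable hJ hDV)).
rewrite (@slab_flux _ 2 _ (fun=> 0) (fun k z => if k == j then V i z * phi z else 0))//.
- by rewrite !cube0// subrr.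
- exact: sp_cst.
- by move=> k; case: (k == j); [exact: spM|exact: sp_cst].
move=> z; rewrite /Dt -/(cst 0) derive_cst add0r (bigD1 j)//= eqxx big1 => [|k /negbTE ->].
  by rewrite addr0 /Dx (smooth_deriveM _ z (sv i) tphi.1) [phi z * _]mulrC.
by rewrite /Dx -/(cst 0) derive_cst.
Qed.

Let E z := \sum_i V i z * V i z.

Let hE : smooth_periodic E. Proof. by apply: sp_sum => i; exact: spM. Qed.

Let DE w z : 'D_w E z = \sum_i 2 * V i z * 'D_w (V i) z.
Proof.
rewrite /E smooth_derive_sum; last by move=> i; exact: smoothM.
by apply: eq_bigr => i _; rewrite (smooth_deriveM _ z (sv i) (sv i)); ring.
Qed.

Let DDE j z : Dx j (Dx j E) z =
  \sum_i 2 * (V i z * Dx j (Dx j (V i)) z + Dx j (V i) z * Dx j (V i) z).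
Proof.
have -> : Dx j E = fun z => \sum_i 2 * V i z * Dx j (V i) z.
  by apply/funext => y; rewrite /Dx DE.
have s2 i : smooth_on setT (fun z => 2 * V i z) by exact: smoothM (smooth_cst 2) (sv i).
rewrite /Dx smooth_derive_sum; last by move=> i; exact: smoothM (s2 i) (sD i _).
apply: eq_bigr => i _; rewrite (smooth_deriveM _ z (s2 i) (sD i _)).
by rewrite (smooth_deriveZ _ z 2 (sv i)); ring.
Qed.

(** One balance law for both energy inequalities: phi = 1 gives the global one and a test function
    the local one, each time with equality. *)
Lemma classical_energy_flux phi z : smooth_periodic phi ->
  E z * (Dt phi z + nu * laplacian phi z) + E z * (\sum_i V i z * Dx i phi z)
    + 2 * (\sum_i vcomp F i z * V i z) * phi z
    - 2 * nu * ((\sum_i \sum_j Dx j (V i) z ^+ 2) * phi z) =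
  Dt (fun z => E z * phi z) z +
  \sum_j Dx j (fun z => E z * V j z * phi z + nu * (E z * Dx j phi z - phi z * Dx j E z)) z.
Proof.
move=> tphi; have sphi := tphi.1; have sE := hE.1.
have sp w : smooth_on setT ('D_w phi) by exact: smooth_derive sphi.
have sDE w : smooth_on setT ('D_w E) by exact: smooth_derive sE.
have DB j : Dx j (fun z => E z * V j z * phi z + nu * (E z * Dx j phi z - phi z * Dx j E z)) z =
    E z * V j z * Dx j phi z + phi z * (E z * Dx j (V j) z + V j z * Dx j E z)
    + nu * (E z * Dx j (Dx j phi) z + Dx j phi z * Dx j E z
      - (phi z * Dx j (Dx j E) z + Dx j E z * Dx j phi z)).
  have s1 := smoothM sE (sv j); have s2 := smoothM s1 sphi.
  have s3 := smoothM sE (sp (0, evec R j)).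
  have s4 := smoothM sphi (sDE (0, evec R j)).
  rewrite /Dx (smooth_deriveD _ z s2 (smoothM (smooth_cst nu) (smoothB s3 s4))).
  rewrite (smooth_deriveM _ z s1 sphi) (smooth_deriveM _ z sE (sv j)).
  rewrite (smooth_deriveZ _ z nu (smoothB s3 s4)) (smooth_deriveB _ z s3 s4).
  by rewrite (smooth_deriveM _ z sE (sp _)) (smooth_deriveM _ z sphi (sDE _)).
have DE' j : Dx j E z = \sum_i 2 * V i z * Dx j (V i) z by exact: DE.
under [X in _ = _ + X]eq_bigr do rewrite DB DDE DE'.
rewrite /Dt (smooth_deriveM _ z sE sphi) DE.
exact: (energy_algebra (phi z) _ _ _ (dv := fun i j => Dx j (V i) z) (div0 z) (eqn z)).
Qed.

End ClassicalSolution.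

Section SmoothSlices.
Context {R : realType}.

Lemma is_derive_comp_snd {U V : normedModType R} (psi : V -> R) (z w : U * V) a :
  is_derive z.2 w.2 psi a -> is_derive z w (fun z => psi z.2) a.
Proof. by move=> /is_derive_line D; apply/is_derive_line. Qed.

Lemma smooth_comp_snd {U V : normedModType R} (psi : V -> R) : smooth_on setT psi ->
  smooth_on setT (fun z : U * V => psi z.2).
Proof.
move=> spsi k; elim: k psi spsi => [|k IH] psi spsi.
  split=> // x _; apply: (@continuous_comp _ _ _ snd psi); first exact: cvg_snd.
  exact: smooth_continuous.
split=> [x _|w].
  apply: (@continuous_comp _ _ _ snd psi); first exact: cvg_snd.
  exact: smooth_continuous.
have D z : is_derive z w (fun z : U * V => psi z.2) ('D_(w.2) psi z.2).
  exact/is_derive_comp_snd/smooth_is_derive.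
split=> [x _|]; first exact: ex_derive.
by apply: (eq_Ck _ (IH _ (smooth_derive w.2 spsi))) => x; rewrite derive_val.
Qed.

Lemma smooth_slice {U V : normedModType R} (f : U * V -> R) (u : U) : smooth_on setT f ->
  smooth_on setT (fun v => f (u, v)).
Proof.
move=> sf k; elim: k f sf => [|k IH] f sf.
  by split=> // x _; apply: continuous_pairl; exact: smooth_continuous.
have D (x w : V) : is_derive x w (fun v => f (u, v)) ('D_((0, w) : U * V) f (u, x)).
  have /is_derive_line D := smooth_is_derive ((0, w) : U * V) (u, x) sf.
  apply/is_derive_line; move: D.
  rewrite (_ : (fun h : R => f (h *: (0, w) + (u, x))) = (fun h : R => f (u, h *: w + x)))//.
  by apply/funext => h; congr f; congr pair; rewrite -[LHS]/(h *: (0 : U) + u) scaler0 add0r.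
split=> [x _|w]; first by apply: continuous_pairl; exact: smooth_continuous.
split=> [x _|]; first exact: ex_derive.
by apply: (eq_Ck _ (IH _ (smooth_derive ((0, w) : U * V) sf))) => x; rewrite derive_val.
Qed.

Lemma cube_divergence i (t : R) (f : spacetime R -> R) : smooth_periodic f ->
  \int[leb3 R]_(x in @cube R) Dx i f (t, x) = 0.
Proof.
move=> hf; have [sf pf] := hf; have [sD pD] := sp_Dx i hf.
have cD : continuous (fun x => Dx i f (t, x)).
  by apply: continuous_pairl; exact: smooth_continuous.
have E : \int[leb3 R]_(x in @cube R) Dx i f (t, x) = \int[leb3 R]_(x in @cube R) (fun=> 0) x.
  apply: (eq_cube_integral (i := i)).
  - exact: continuous_measurable3 cD.
  - exact: measurable_cst.
  - have tt : - `|t| <= `|t| by rewrite ge0_cp.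
    have [C _ hC] := periodic_bdd tt (smooth_continuous sD) pD.
    by exists C => x _; apply: hC; rewrite -ler_norml.
  - exact: bdd_cst.
  move=> x; have D s := is_derive_coord i t x s sf.
  have cDi : continuous (fun s => Dx i f (t, set_coord i s x)).
    by apply: (@is_derive_continuous _ _ (fun s => Dx i (Dx i f) (t, set_coord i s x))) => s; exact: is_derive_coord.
  rewrite (ival_FTC D)//.
  have -> : f (t, set_coord i 1 x) = f (t, set_coord i 0 x).
    by rewrite -(xperiodic_set_coord i t 0 x pf) add0r.
  by rewrite subrr /ival /Rintegral integral0.
by rewrite E /Rintegral integral0.
Qed.

End SmoothSlices.

Section VectorBounds.
Context {R : realType}.

Lemma enorm_le_mx m n (A : 'M[R]_(m, n)) c : 0 <= c -> (forall i j, `|A i j| <= c) ->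
  enorm A <= (m * n)%:R * c.
Proof.
move=> c0 Ac.
rewrite -(ler_pXn2r (n := 2)) ?nnegrE ?enorm_ge0 ?mulr_ge0// sqr_enorm.
apply: (@le_trans _ _ (\sum_(i < m) \sum_(j < n) c ^+ 2)).
  apply: ler_sum => i _; apply: ler_sum => j _.
  by rewrite -real_normK ?num_real// lerXn2r ?nnegrE.
rewrite (eq_bigr (fun=> c ^+ 2 *+ n)); last by move=> i _; rewrite sumr_const card_ord.
rewrite sumr_const card_ord -mulrnA mulnC exprMn -[leLHS]mulr_natl ler_wpM2r ?sqr_ge0//.
by rewrite -natrX ler_nat; case: (m * n)%N => // k; rewrite expnS expn1 leq_pmulr.
Qed.

Lemma measurable_enorm {d} {T : measurableType d} (D : set T) m n (f : T -> 'M[R]_(m, n)) :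
  measurable D -> (forall i j, measurable_fun D (fun x => f x i j)) ->
  measurable_fun D (fun x => enorm (f x)).
Proof.
move=> mD mf; rewrite /enorm.
have ms : measurable_fun (setT : set (measurableTypeR R)) (@Num.sqrt R).
  by apply: continuous_measurable_fun; exact: sqrt_continuous.
apply: (measurableT_comp ms); apply: measurable_sum => i; apply: measurable_sum => j.
exact: measurable_funX.
Qed.

Lemma smooth_vector_bounded (v : vfield R) : (forall i, smooth_periodic (vcomp v i)) ->
  exists2 C, 0 <= C & forall z, 0 <= z.1 <= 2 -> enorm (v z) <= C.
Proof.
move=> hv.
have /choice[C hC] : forall i, exists C, 0 <= C /\ forall z, 0 <= z.1 <= 2 -> `|vcomp v i z| <= C.
  by move=> i; have [c c0 hc] := smooth_bounded (hv i).1 (hv i).2; exists c.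
have C0 i : 0 <= C i by exact: (hC i).1.
exists (2 * \sum_i C i); first by rewrite mulr_ge0// sumr_ge0.
move=> z hz; apply: enorm_le => j; apply: (le_trans ((hC j).2 z hz)).
by rewrite (bigD1 j)//= lerDl sumr_ge0.
Qed.

Lemma smooth_vector_lipschitz (v : vfield R) : (forall i, smooth_periodic (vcomp v i)) ->
  exists2 C, 0 <= C & forall z w, 0 <= z.1 <= 2 -> 0 <= w.1 <= 2 ->
    enorm (v z - v w) <= C * `|z - w|.
Proof.
move=> hv.
have /choice[C hC] : forall i, exists C, 0 <= C /\ forall z w, 0 <= z.1 <= 2 -> 0 <= w.1 <= 2 ->
    `|vcomp v i z - vcomp v i w| <= C * `|z - w|.
  by move=> i; have [c c0 hc] := smooth_lipschitz (hv i).1 (hv i).2; exists c.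
have C0 i : 0 <= C i by exact: (hC i).1.
exists (2 * \sum_i C i); first by rewrite mulr_ge0// sumr_ge0.
move=> z w hz hw; rewrite -mulrA; apply: enorm_le => j; rewrite !mxE.
apply: (le_trans ((hC j).2 z w hz hw)).
by rewrite ler_wpM2r// (bigD1 j)//= lerDl sumr_ge0.
Qed.

Lemma slab_itv (t : R) z : t <= 2 -> slab t z -> 0 <= z.1 <= 2.
Proof.
move=> t2 [/= + _]; rewrite in_itv /= => /andP[/ltW -> /ltW h].
exact: le_trans h t2.
Qed.

Lemma measurable_slab (t : R) : measurable (@slab R t).
Proof. by apply: measurableX; [exact: measurable_itv|exact: measurable_cube]. Qed.

Lemma leb4_slab2 : leb4 R (@slab R 2) = 2%:E.
Proof.
rewrite slab_box leb4_box; last exact: measurable_itv.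
by rewrite leb1_itv// subr0.
Qed.

Lemma leb4_slab2_le : (leb4 R (@slab R 2) <= 2%:E)%E.
Proof. by rewrite leb4_slab2. Qed.

Lemma leb3_cube_le : (leb3 R (@cube R) <= 1%:E)%E.
Proof. by rewrite leb3_cube. Qed.

Lemma leb1_timeI_le : (leb1 R (@timeI R) <= 2%:E)%E.
Proof. by rewrite /timeI leb1_itv// subr0. Qed.

Lemma smooth_in_Lp (v : vfield R) p : (1 <= p)%E -> (forall i, smooth_periodic (vcomp v i)) ->
  in_Lp (leb4 R) (@slab R 2) p v.
Proof.
move=> p1 hv; split.
  by move=> i j; rewrite (ord1 i); exact: measurable_funTS (smooth_measurable (hv j).1).
have [C C0 hC] := smooth_vector_bounded hv.
apply: (@le_lt_trans _ _ (C * 2)%:E); last exact: ltry.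
apply: Lp_norm_le => //; first exact: measurable_slab.
- exact: leb4_slab2_le.
- by rewrite ler1n.
- by move=> z hz; apply: hC; exact: slab_itv hz.
Qed.

Lemma LpLq_norm_le (f : vfield R) C p q : 0 <= C -> (1 <= p)%E -> (1 <= q)%E ->
  (forall t x, 0 < t < 2 -> enorm (f (t, x)) <= C) -> (LpLq_norm p q f <= (C * 2)%:E)%E.
Proof.
move=> C0 p1 q1 fC; apply: Lnorm_le => //.
- exact: measurable_itv.
- exact: leb1_timeI_le.
- by rewrite ler1n.
move=> t tI; apply/andP; split; first exact: Lnorm_ge0.
rewrite -[X in (X)%:E]mulr1; apply: Lp_norm_le => //; first exact: measurable_cube.
- exact: leb3_cube_le.
- by move=> x _; apply: fC; move: tI; rewrite /timeI /= in_itv.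
Qed.

Lemma smooth_in_LpLq (v : vfield R) p q : (1 <= p)%E -> (1 <= q)%E ->
  (forall i, smooth_periodic (vcomp v i)) -> in_LpLq p q v.
Proof.
move=> p1 q1 hv; split.
  by move=> i j; rewrite (ord1 i); exact: measurable_funTS (smooth_measurable (hv j).1).
have [C C0 hC] := smooth_vector_bounded hv.
apply: (@le_lt_trans _ _ (C * 2)%:E); last exact: ltry.
apply: LpLq_norm_le => // t x /andP[t0 t2]; apply: hC.
by rewrite /= !ltW.
Qed.

Lemma smooth_slice_in_Lp (v : vfield R) (t : R) p : (1 <= p)%E -> 0 <= t <= 2 ->
  (forall i, smooth_periodic (vcomp v i)) ->
  in_Lp (leb3 R) (@cube R) p (fun x => v (t, x)).
Proof.
move=> p1 ht hv; split.
  move=> i j; rewrite (ord1 i); apply: measurable_funTS.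
  have c : continuous (fun x => vcomp v j (t, x)).
    by apply: continuous_pairl; apply: smooth_continuous; exact: (hv j).1.
  exact: continuous_measurable3 c.
have [C C0 hC] := smooth_vector_bounded hv.
apply: (@le_lt_trans _ _ (C * 1)%:E); last exact: ltry.
apply: Lp_norm_le => //; first exact: measurable_cube.
- exact: leb3_cube_le.
- by move=> x _; exact: hC.
Qed.

End VectorBounds.

Section DotProduct.
Context {R : realType}.

Lemma dotp_le (u w : 'rV[R]_3) : `|dotp u w| <= 3 * enorm u * enorm w.
Proof.
apply: (le_trans (ler_norm_sum _ _ _)).
apply: (@le_trans _ _ (\sum_(i < 3) enorm u * enorm w)).
  by apply: ler_sum => i _; rewrite normrM ler_pM ?coord_le_enorm.
by rewrite sumr_const card_ord -[leLHS]mulr_natl mulrA.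
Qed.

Lemma dotpBl (u u' w : 'rV[R]_3) : dotp (u - u') w = dotp u w - dotp u' w.
Proof. by rewrite /dotp -sumrB; apply: eq_bigr => i _; rewrite !mxE mulrBl. Qed.

(** On a set of finite measure |w| <= 1 + |w|^2 suffices. *)
Lemma in_L2_integrable (w : R * R * R -> 'rV[R]_3) :
  (forall i j, measurable_fun (@cube R) (fun x => w x i j)) ->
  (Lp_norm (leb3 R) (@cube R) 2%:E w < +oo)%E ->
  (leb3 R).-integrable (@cube R) (EFin \o (fun x => enorm (w x))).
Proof.
move=> mw; have mc := @measurable_cube R; have me := measurable_enorm mc mw.
have n2 : 2^-1 != 0 :> R by rewrite invr_neq0.
rewrite /Lp_norm unlock => /(lty_poweRy n2) h2.
have i2 : (leb3 R).-integrable (@cube R) (EFin \o (fun x => enorm (w x) ^+ 2)).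
  apply/integrableP; split; first by apply/measurable_EFinP; exact: measurable_funX.
  rewrite integral_mkcond; apply: le_lt_trans h2; rewrite le_eqVlt; apply/orP; left; apply/eqP.
  apply: eq_integral => x _; rewrite !patchE; case: ifPn => // _.
    by rewrite /= powR_mulrn// normrX.
  by rewrite -[point]/(0%E : \bar R) abse0 poweR0r.
have i1 : (leb3 R).-integrable (@cube R) (EFin \o (fun x => 1 + enorm (w x) ^+ 2)).
  have b1 : (leb3 R).-integrable (@cube R) (EFin \o (fun=> 1)).
    by apply: cube_integrable; [exact: measurable_cst|exact: bdd_cst].
  by have := integrableD mc b1 i2; apply: eq_integrable => // x _; rewrite /= EFinD.
apply: (le_integrable mc _ _ i1); first exact/measurable_EFinP.
move=> x _; rewrite /= lee_fin !ger0_norm ?enorm_ge0 ?addr_ge0 ?sqr_ge0//.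
by have := sqr_ge0 (enorm (w x) - 2^-1); rewrite sqrrB; set a := enorm _; lra.
Qed.

End DotProduct.

(** * Smooth periodic solutions are suitable Leray-Hopf solutions *)

Section Suitable.
Context {R : realType}.
Variables (nu : R) (F v : vfield R).
Let V := vcomp v.
Hypothesis hv : forall i, smooth_periodic (vcomp v i).
Hypothesis hF : forall i, smooth_periodic (vcomp F i).
Hypothesis div0 : forall z, \sum_i Dx i (vcomp v i) z = 0.
Hypothesis eqn : forall z i, Dt (vcomp v i) z + \sum_j vcomp v j z * Dx j (vcomp v i) z =
  nu * laplacian (vcomp v i) z + vcomp F i z.

Lemma vector_xperiodic (u : vfield R) : (forall i, smooth_periodic (vcomp u i)) -> xperiodic u.
Proof. by move=> hu t x i; apply/rowP => j; exact: (hu j).2. Qed.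

Let le01' : (1 <= 2%:E :> \bar R)%E. Proof. by rewrite lee_fin ler1n. Qed.

Lemma classical_initial_datum : initial_datum (fun x => v (0, x)).
Proof.
split.
- exact: (vector_xperiodic hv 0).
- by apply: smooth_slice_in_Lp => //; rewrite lexx ler0n.
- move=> psi spsi ppsi.
  (* A spatial test function is read as a time-independent function on spacetime, so that the
     spacetime calculus applies at t = 0. *)
  pose phi (z : spacetime R) := psi z.2.
  have hphi : smooth_periodic phi.
    by split; [exact: smooth_comp_snd|move=> t x i; exact: ppsi].
  have hB j : smooth_periodic (fun z => V j z * phi z) by exact: spM.
  have Dpsi x (k : 'I_3) : 'D_(evec R k) psi x = Dx k phi (0, x).
    have D := smooth_is_derive (evec R k) x spsi.
    have [_ e] := @is_derive_comp_snd R R _ psi (0, x) (0, evec R k) _ D.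
    exact: (esym e).
  have E x : \sum_i v (0, x) 0 i * 'D_(evec R i) psi x =
      \sum_i Dx i (fun z => V i z * phi z) (0, x).
    transitivity (\sum_i (V i (0, x) * Dx i phi (0, x)) + phi (0, x) * \sum_i Dx i (V i) (0, x)).
      by rewrite div0 mulr0 addr0; apply: eq_bigr => k _; rewrite Dpsi.
    rewrite mulr_sumr -big_split; apply: eq_bigr => i _ /=.
    by rewrite /Dx (smooth_deriveM _ _ (hv i).1 hphi.1).
  have -> : \int[leb3 R]_(x in @cube R) (\sum_i v (0, x) 0 i * 'D_(evec R i) psi x) =
      \int[leb3 R]_(x in @cube R) (Dx ord0 (fun z => V ord0 z * phi z) (0, x) +
       (Dx (inord 1) (fun z => V (inord 1) z * phi z) (0, x) +
        Dx (inord 2) (fun z => V (inord 2) z * phi z) (0, x))).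
    by apply: eq_Rintegral => x _; rewrite E big_ord3 addrA.
  have i f : smooth_periodic f -> (leb3 R).-integrable (@cube R) (EFin \o (fun x => f (0, x))).
    move=> hf; have c : continuous (fun x => f (0, x)).
      by apply: continuous_pairl; apply: smooth_continuous; exact: hf.1.
    apply: cube_integrable; first exact: continuous_measurable3 c.
    by have [C _ hC] := smooth_bounded hf.1 hf.2; exists C => x _; apply: hC; rewrite lexx ler0n.
  have iD j : (leb3 R).-integrable (@cube R) (EFin \o (fun x => Dx j (fun z => V j z * phi z) (0, x))).
    by apply: i; exact: sp_Dx.
  have h12 : smooth_periodic (fun z => Dx (inord 1) (fun z => V (inord 1) z * phi z) z +
      Dx (inord 2) (fun z => V (inord 2) z * phi z) z) by apply: spD; exact: sp_Dx.
  have mc := @measurable_cube R.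
  rewrite [LHS](RintegralD mc (iD _) (i _ h12)) [X in _ + X](RintegralD mc (iD _) (iD _)).
  by rewrite !(fun j => cube_divergence j 0 (hB j)) !addr0.
Qed.

Lemma zero_pressure : pressure (fun=> 0 : R).
Proof.
split=> //; split=> [i j|].
  exact: measurable_cst.
apply: (@le_lt_trans _ _ (0 * 2)%:E); last exact: ltry.
apply: Lp_norm_le => //.
- exact: measurable_slab.
- exact: leb4_slab2_le.
- move=> z _; rewrite /enorm !big_ord1 !mxE /= mulr1n expr0n sqrtr0//.
- by rewrite lee_fin ler_pdivlMr// mul1r ler_nat.
Qed.

Lemma classical_time_lipschitz : exists2 L, 0 <= L & forall t s x, 0 <= t <= 2 -> 0 <= s <= 2 ->
  enorm (v (t, x) - v (s, x)) <= L * `|t - s|.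
Proof.
have [L L0 hL] := smooth_vector_lipschitz hv; exists L => // t s x ht hs.
have := hL (t, x) (s, x) ht hs; rewrite prod_normE /= subrr normr0.
by have /max_idPl -> : 0 <= `|t - s| by [].
Qed.

(** The flow is Lipschitz in time uniformly in x, and w, though possibly unbounded, is integrable:
    the pairing is Lipschitz in time with constant 3 L times the integral of |w|. *)
Lemma classical_weakly_continuous : weakly_continuous v.
Proof.
split=> [t /andP[t0 t2]|w [mw wL2] t].
  by apply: smooth_slice_in_Lp => //; rewrite !ltW.
rewrite in_itv/= => /andP[t0 t2].
have iw := in_L2_integrable mw wL2.
have mw' := measurable_enorm (@measurable_cube R) mw.
have [C C0 hC] := smooth_vector_bounded hv.
have [L L0 hL] := classical_time_lipschitz.
have md s : measurable_fun (@cube R) (fun x => dotp (v (s, x)) (w x)).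
  apply: measurable_sum => i; apply: measurable_funM; last exact: mw.
  apply: measurable_funTS.
  have c : continuous (fun x => vcomp v i (s, x)).
    by apply: continuous_pairl; apply: smooth_continuous; exact: (hv i).1.
  exact: continuous_measurable3 c.
have mc := @measurable_cube R.
have ik k : (leb3 R).-integrable (@cube R) (EFin \o (fun x => k * enorm (w x))).
  by have := integrableZl mc k iw; apply: eq_integrable => // x _; rewrite /= EFinM.
have id s : 0 <= s <= 2 -> (leb3 R).-integrable (@cube R) (EFin \o (fun x => dotp (v (s, x)) (w x))).
  move=> hs; apply: (le_integrable mc _ _ (ik (3 * C))); first exact/measurable_EFinP.
  move=> x _; rewrite /= lee_fin; apply: (le_trans (dotp_le _ _)).
  rewrite (le_trans _ (ler_norm _))// ler_wpM2r ?enorm_ge0//.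
  by rewrite ler_wpM2l// hC.
pose W := \int[leb3 R]_(x in @cube R) enorm (w x).
have key s : 0 <= s <= 2 -> `|\int[leb3 R]_(x in @cube R) dotp (v (t, x)) (w x) -
    \int[leb3 R]_(x in @cube R) dotp (v (s, x)) (w x)| <= 3 * L * `|t - s| * W.
  move=> hs; have ht : 0 <= t <= 2 by rewrite !ltW.
  rewrite -(RintegralB mc (id t ht) (id s hs)).
  have iB : (leb3 R).-integrable (@cube R)
      (EFin \o (fun x => dotp (v (t, x)) (w x) - dotp (v (s, x)) (w x))).
    have := integrableB mc (id t ht) (id s hs).
    by apply: eq_integrable => // x _; rewrite /= EFinB.
  apply: (le_trans (le_normr_Rintegral mc iB)).
  rewrite -(RintegralZl _ mc iw); apply: le_Rintegral => //.
  - have := integrable_abse iB; by apply: eq_integrable.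
  - move=> x _; rewrite -dotpBl; apply: (le_trans (dotp_le _ _)).
    by rewrite ler_wpM2r ?enorm_ge0// -mulrA ler_wpM2l// hL.
have W0 : 0 <= W by apply: Rintegral_ge0 => x _; exact: enorm_ge0.
have K0 : 0 <= 3 * L * W by rewrite !mulr_ge0.
apply/cvgrPdist_le => e e0; near=> s.
have hs : 0 <= s <= 2.
  apply/andP; split; near: s.
    by apply: filterS (lt_nbhsr t0) => s /ltW.
  exact: lt_le_nbhsl.
apply: (le_trans (key s hs)).
rewrite mulrAC; apply: (@le_trans _ _ (3 * L * W * (e / (3 * L * W + 1)))).
  rewrite ler_wpM2l//; near: s.
  exists (e / (3 * L * W + 1)) => /=; first by rewrite divr_gt0// ltr_wpDl.
  by move=> s /= /ltW.
by rewrite mulrA ler_pdivrMr ?ltr_wpDl// mulrDr mulr1 mulrC lerDl ltW.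
Unshelve. all: by end_near. Qed.

Lemma classical_initial_trace : (fun t => Lp_norm (leb3 R) (@cube R) 2%:E
  (fun x => v (t, x) - v (0, x))) @ 0^'+ --> 0%E.
Proof.
have [L L0 hL] := classical_time_lipschitz.
apply: (@squeeze_cvge _ _ _ _ (cst 0%E) _ (fun t => (L * t * 1)%:E)).
- near=> t; apply/andP; split; first exact: Lnorm_ge0.
  have t0 : 0 < t by near: t; exact: nbhs_right_gt.
  have t2 : t <= 2 by near: t; apply: nbhs_right_le.
  apply: Lp_norm_le => //; first exact: measurable_cube.
  + exact: leb3_cube_le.
  + by rewrite mulr_ge0// ltW.
  + move=> x _; apply: (le_trans (hL t 0 x _ _)); rewrite ?lexx ?ler0n// ?(ltW t0)//.
    by rewrite subr0 gtr0_norm.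
- exact: cvg_cst.
- apply: cvg_EFin; first by near=> t.
  have -> : (fine \o (fun t => (L * t * 1)%:E)) = fun t => L * t * 1 by [].
  have : (fun t : R => L * t * 1) @ (0 : R) --> L * 0 * 1.
    by apply: cvgMl; apply: cvgMr; exact: cvg_id.
  rewrite mulr0 mul0r; exact: cvg_at_right_filter.
Unshelve. all: by end_near. Qed.

Let G := gradient v.

Let sE : smooth_periodic (fun z => \sum_i V i z * V i z).
Proof. by apply: sp_sum => i; exact: spM. Qed.

Let enormv z : enorm (v z) ^+ 2 = \sum_i V i z * V i z.
Proof. by rewrite sqr_enorm_row; apply: eq_bigr => i _; rewrite expr2. Qed.

Let enormG z : enorm (G z) ^+ 2 = \sum_i \sum_j Dx j (V i) z ^+ 2.
Proof.
by rewrite sqr_enorm; apply: eq_bigr => i _; apply: eq_bigr => j _; rewrite mxE.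
Qed.

Let sG : smooth_periodic (fun z => \sum_i \sum_j Dx j (V i) z ^+ 2).
Proof.
apply: sp_sum => i; apply: sp_sum => j; have h := sp_Dx j (hv i).
rewrite (_ : (fun z => _) = fun z => Dx j (V i) z * Dx j (V i) z); first exact: spM.
by apply/funext => z; rewrite expr2.
Qed.

Let sFv : smooth_periodic (fun z => \sum_i vcomp F i z * V i z).
Proof. by apply: sp_sum => i; exact: spM. Qed.

Let energy_flux phi : smooth_periodic phi ->
  (forall j, smooth_periodic (fun z => (\sum_i V i z * V i z) * V j z * phi z +
   nu * ((\sum_i V i z * V i z) * Dx j phi z - phi z * Dx j (fun z => \sum_i V i z * V i z) z))).
Proof.
move=> hphi j; apply: spD; first by do 2!apply: spM => //.
by apply: spZ; apply: spB; apply: spM => //; exact: sp_Dx.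
Qed.

Lemma classical_energy_inequality : energy_inequality nu (fun x => v (0, x)) F v G.
Proof.
move=> t /andP[t0 t2]; have ht : 0 <= t <= 2 by rewrite !ltW.
have hJ := time_slab ht.
(* The flux identity is applied to phi = 1, whose derivatives vanish; it gives twice the energy
   balance. *)
have h1 := sp_cst (1 : R).
have hf : smooth_periodic (fun z => 2 * (\sum_i vcomp F i z * V i z)) by exact: spZ.
have hg : smooth_periodic (fun z => 2 * nu * (\sum_i \sum_j Dx j (V i) z ^+ 2)) by exact: spZ.
have mb : measurable (@slab R t) by exact: measurable_slab.
have D0 (w z : spacetime R) : 'D_w (fun _ : spacetime R => 1 : R) z = 0.
  by rewrite -/(cst 1) derive_cst.
have DF i : Dx i (fun _ : spacetime R => 1 : R) = fun=> 0.
  by apply/funext => z; exact: D0.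
have Pf z : 2 * (\sum_i vcomp F i z * V i z) - 2 * nu * (\sum_i \sum_j Dx j (V i) z ^+ 2) =
    (\sum_i V i z * V i z) * (Dt (fun=> 1) z + nu * laplacian (fun=> 1) z)
    + (\sum_i V i z * V i z) * (\sum_i V i z * Dx i (fun=> 1) z)
    + 2 * (\sum_i vcomp F i z * V i z) * 1
    - 2 * nu * ((\sum_i \sum_j Dx j (V i) z ^+ 2) * 1).
  have DD i : Dx i (Dx i (fun=> 1 : R)) z = 0.
    by rewrite DF /Dx -/(cst 0) derive_cst.
  have L0 : laplacian (fun=> 1) z = 0 by rewrite /laplacian big1.
  have T0 : Dt (fun=> 1) z = 0 by exact: D0.
  have S0 : \sum_i V i z * Dx i (fun=> 1) z = 0.
    by rewrite big1// => i _; rewrite DF mulr0.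
  by rewrite L0 T0 S0 !(mulr0, addr0, add0r, mulr1).
have H := slab_flux ht (spM sE h1) (energy_flux h1)
  (fun z => etrans (Pf z) (classical_energy_flux hv div0 eqn z h1)).
have E1 s : \int[leb3 R]_(x in @cube R) ((\sum_i V i (s, x) * V i (s, x)) * 1) =
    \int[leb3 R]_(x in @cube R) (enorm (v (s, x)) ^+ 2).
  by apply: eq_Rintegral => x _; rewrite mulr1 enormv.
have E2 : \int[leb4 R]_(z in slab t) (enorm (G z) ^+ 2) =
    \int[leb4 R]_(z in slab t) (\sum_i \sum_j Dx j (V i) z ^+ 2).
  by apply: eq_Rintegral => x _; rewrite enormG.
rewrite [LHS](RintegralB mb (sp_integrable hJ hf) (sp_integrable hJ hg)) in H.
rewrite [X in X - _](RintegralZl _ mb (sp_integrable hJ sFv)) in H.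
rewrite [X in _ - X](RintegralZl _ mb (sp_integrable hJ sG)) in H.
rewrite !E1 in H; rewrite E2 /dotp -/V.
set I1 := \int[_]_(_ in _) _ in H *; lra.
Qed.

Lemma classical_local_energy_inequality : local_energy_inequality nu F v G (fun=> 0).
Proof.
move=> phi [tphi0 [d d0 phi0]] _; have hphi := test0_sp tphi0.
have le02 : 0 <= (2 : R) <= 2 by rewrite ler0n lexx.
have hJ := time_slab le02.
have mb : measurable (@slab R 2) by exact: measurable_slab.
pose f z := (\sum_i V i z * V i z) * (Dt phi z + nu * laplacian phi z)
  + (\sum_i V i z * V i z) * (\sum_i V i z * Dx i phi z)
  + 2 * (\sum_i vcomp F i z * V i z) * phi z.
pose g z := (\sum_i \sum_j Dx j (V i) z ^+ 2) * phi z.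
have hg : smooth_periodic g by exact: spM.
have hf : smooth_periodic f.
  have h1 := spM sE (spD (sp_Dt hphi) (spZ nu (sp_laplacian hphi))).
  have h2 := spM sE (sp_sum (fun i => spM (hv i) (sp_Dx i hphi))).
  exact: spD (spD h1 h2) (spM (spZ 2 sFv) hphi).
have Ef : \int[leb4 R]_(z in slab 2)
    (enorm (v z) ^+ 2 * (Dt phi z + nu * laplacian phi z)
     + (enorm (v z) ^+ 2 + 2 * 0) * (\sum_i v z 0 i * Dx i phi z)
     + 2 * dotp (F z) (v z) * phi z) = \int[leb4 R]_(z in slab 2) f z.
  by apply: eq_Rintegral => z _; rewrite mulr0 addr0 enormv.
have Eg : \int[leb4 R]_(z in slab 2) (enorm (G z) ^+ 2 * phi z) =
    \int[leb4 R]_(z in slab 2) g z.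
  by apply: eq_Rintegral => z _; rewrite enormG.
rewrite Ef Eg -subr_ge0.
rewrite -(RintegralZl (2 * nu) mb (sp_integrable hJ hg)).
rewrite -(RintegralB mb (sp_integrable hJ hf) (sp_integrable hJ (spZ (2 * nu) hg))).
rewrite (slab_flux le02 (spM sE hphi) (energy_flux hphi)).
  have z0 s : (forall x, phi (s, x) = 0) ->
      \int[leb3 R]_(x in @cube R) ((\sum_i V i (s, x) * V i (s, x)) * phi (s, x)) = 0.
    move=> ps; rewrite (_ : (fun x => _) = fun=> 0); first by rewrite /Rintegral integral0.
    by apply/funext => x; rewrite ps mulr0.
  rewrite !z0 ?subrr// => x; [exact: phi0|exact: test0_end].
by move=> z; rewrite -(classical_energy_flux hv div0 eqn z hphi).
Qed.

Lemma gradient_in_L2 : in_Lp (leb4 R) (@slab R 2) 2%:E G.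
Proof.
split=> [i j|].
  rewrite (_ : (fun x => _) = Dx j (V i)); last by apply/funext => z; rewrite mxE.
  by apply: measurable_funTS; apply: smooth_measurable; exact: (sp_Dx j (hv i)).1.
have /choice[C hC] : forall ij : 'I_3 * 'I_3, exists C, 0 <= C /\ forall z, 0 <= z.1 <= 2 ->
    `|Dx ij.2 (V ij.1) z| <= C.
  move=> [i j]; have h := sp_Dx j (hv i).
  by have [c c0 hc] := smooth_bounded h.1 h.2; exists c.
have S0 : 0 <= \sum_ij C ij by apply: sumr_ge0 => ij _; exact: (hC ij).1.
apply: (@le_lt_trans _ _ ((3 * 3)%:R * (\sum_ij C ij) * 2)%:E); last exact: ltry.
apply: Lp_norm_le => //.
- exact: measurable_slab.
- exact: leb4_slab2_le.
- by rewrite mulr_ge0.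
move=> z hz; apply: enorm_le_mx => // i j; rewrite mxE.
apply: (le_trans ((hC (i, j)).2 z (slab_itv (lexx _) hz))).
by rewrite (bigD1 (i, j))//= lerDl sumr_ge0// => ij _; exact: (hC ij).1.
Qed.

Lemma classical_suitable : suitable_leray_hopf nu (fun x => v (0, x)) F v.
Proof.
exists G, (fun=> 0); split; last exact: classical_local_energy_inequality.
split.
- split; [exact: classical_initial_datum|exact: vector_xperiodic|].
  exact: smooth_in_LpLq.
- split; [exact: vector_xperiodic| |exact: classical_weakly_continuous|].
    by apply: smooth_in_LpLq => //; exact: leey.
  exact: classical_initial_trace.
- split; [|exact: gradient_in_L2|exact: classical_weak_gradient].
  by move=> t x i; apply/matrixP => k l; rewrite !mxE; exact: (sp_Dx l (hv k)).2.
- split; [exact: classical_divergence_free|exact: zero_pressure|].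
  exact: classical_momentum.
- exact: classical_energy_inequality.
Qed.

End Suitable.

(** * Alternating shears *)

Section Coordinates.
Context {R : realType}.

Definition tcoord (z : spacetime R) : R := z.1.
Definition xcoord (z : spacetime R) : R := z.2.1.1.
Definition ycoord (z : spacetime R) : R := z.2.1.2.

Lemma smooth_tcoord : smooth_on setT tcoord.
Proof. by apply: smooth_linear => [h u v|z]; [by []|exact: cvg_fst]. Qed.

Lemma smooth_xcoord : smooth_on setT xcoord.
Proof.
apply: smooth_linear => [h u v|z]; first by [].
apply: (@continuous_comp _ _ _ (fun z : spacetime R => z.2.1) fst); last exact: cvg_fst.
by apply: (@continuous_comp _ _ _ snd fst); [exact: cvg_snd|exact: cvg_fst].
Qed.

Lemma smooth_ycoord : smooth_on setT ycoord.
Proof.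
apply: smooth_linear => [h u v|z]; first by [].
apply: (@continuous_comp _ _ _ (fun z : spacetime R => z.2.1) snd); last exact: cvg_snd.
by apply: (@continuous_comp _ _ _ snd fst); [exact: cvg_snd|exact: cvg_fst].
Qed.

Lemma derive_linear {V : normedModType R} (l : V -> R) w z :
  (forall (h : R) u v, l (h *: u + v) = h * l u + l v) -> 'D_w l z = l w.
Proof. by move=> ll; have [] := is_derive_linear z w ll. Qed.

Lemma derive_const_line {V : normedModType R} (f : V -> R) w z c :
  (forall h : R, f (h *: w + z) = c) -> 'D_w f z = 0.
Proof.
move=> fc; suff [] : is_derive z w f 0 by [].
apply/is_derive_line; rewrite (_ : (fun h : R => f (h *: w + z)) = cst c).
  exact: is_derive_cst.
by apply/funext => h; rewrite fc.
Qed.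

Lemma derive_comp1 {V : normedModType R} (phi : R -> R) (g : V -> R) w z :
  smooth_on setT phi -> smooth_on setT g ->
  'D_w (fun z => phi (g z)) z = 'D_(1 : R) phi (g z) * 'D_w g z.
Proof.
move=> sphi sg.
by case: (is_derive_comp1 (smooth_is_derive (1 : R) (g z) sphi) (smooth_is_derive w z sg)).
Qed.

Lemma smooth_scale {V : normedModType R} k (a : V -> R) : smooth_on setT a ->
  smooth_on setT (fun z => k * a z).
Proof. by move=> sa; apply: smoothM => //; exact: smooth_cst. Qed.

End Coordinates.

(** * Differentiation along the flow *)

Section MaterialDerivative.
Context {R : realType}.
Variables (c : 'I_3 -> R) (z : spacetime R).

(** The velocity is frozen at its value c at the point z, which makes this a derivation at z with
    constant coefficients. *)
Definition Dm (f : spacetime R -> R) : R := Dt f z + \sum_j c j * Dx j f z.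

Lemma DmD f g : smooth_on setT f -> smooth_on setT g ->
  Dm (fun z => f z + g z) = Dm f + Dm g.
Proof.
move=> sf sg; rewrite /Dm /Dt (smooth_deriveD _ _ sf sg) addrACA -big_split.
by congr (_ + _); apply: eq_bigr => j _; rewrite /= /Dx (smooth_deriveD _ _ sf sg) mulrDr.
Qed.

Lemma DmM f g : smooth_on setT f -> smooth_on setT g ->
  Dm (fun z => f z * g z) = f z * Dm g + g z * Dm f.
Proof.
move=> sf sg; rewrite /Dm /Dt (smooth_deriveM _ _ sf sg) !mulrDr !mulr_sumr addrACA -big_split.
congr (_ + _); apply: eq_bigr => j _; rewrite /= /Dx (smooth_deriveM _ _ sf sg) mulrDr.
by rewrite mulrCA [in X in _ + X]mulrCA.
Qed.

Lemma DmZ k f : smooth_on setT f -> Dm (fun z => k * f z) = k * Dm f.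
Proof.
move=> sf; rewrite /Dm /Dt (smooth_deriveZ _ _ k sf) mulrDr mulr_sumr.
congr (_ + _); apply: eq_bigr => j _; rewrite /Dx (smooth_deriveZ _ _ k sf).
by rewrite mulrCA.
Qed.

Lemma Dm_comp phi f : smooth_on setT phi -> smooth_on setT f ->
  Dm (fun z => phi (f z)) = 'D_(1 : R) phi (f z) * Dm f.
Proof.
move=> sp sf; rewrite /Dm /Dt (derive_comp1 _ _ sp sf) mulrDr mulr_sumr.
congr (_ + _); apply: eq_bigr => j _; rewrite /Dx (derive_comp1 _ _ sp sf).
by rewrite mulrCA.
Qed.

Lemma Dm_tcoord : Dm tcoord = 1.
Proof.
rewrite /Dm /Dt derive_linear// big1 ?addr0// => j _.
by rewrite /Dx derive_linear// mulr0.
Qed.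

Lemma Dm_xcoord : Dm xcoord = c ord0.
Proof.
rewrite /Dm /Dt derive_linear// add0r big_ord3 /Dx !derive_linear//.
by rewrite /xcoord /= !inordK//= mulr1 !mulr0 !addr0.
Qed.

Lemma Dm_ycoord : Dm ycoord = c (inord 1).
Proof.
rewrite /Dm /Dt derive_linear// add0r big_ord3 /Dx !derive_linear//.
by rewrite /ycoord /= !inordK//= mulr1 !mulr0 addr0 add0r.
Qed.

End MaterialDerivative.

(* The velocities in the two directions: coordinates are exchanged after each
   stage, so that every stage displaces the second coordinate by a function of
   the first one, and an even number of stages restores the order. *)
Fixpoint alternate {R : realType} (w : nat -> R -> R -> R) q (t a : R) : R * R :=
  if q is q'.+1 then ((alternate w q' t a).2, (alternate w q' t a).1 - w q' t a) else (0, 0).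

(** * The flow generated by alternating shears *)

Section Shears.
Context {R : realType}.
Variables (N : nat -> nat) (f sg : nat -> R -> R).
Hypothesis sf : forall k, smooth_on setT (f k).
Hypothesis pf : forall k x, f k (x + 1) = f k x.
Hypothesis ssg : forall k, smooth_on setT (sg k).
Let dsg k : R -> R := 'D_(1 : R) (sg k).
Hypothesis sg_start : forall k t, sg k t = 0 \/ forall j, (j < k)%N -> dsg j t = 0.
Hypothesis dsg_disjoint : forall j k t, j <> k -> dsg j t = 0 \/ dsg k t = 0.

Let n k : R := (N k)%:R.

Let sdsg k : smooth_on setT (dsg k). Proof. exact: smooth_derive. Qed.

(** Amplitude and frequency belong to consecutive scales: the displacement has the size 1 / n_k of
    the structure made so far, while n_(k+1) sets the scale of the next one. *)
Definition stage_velocity k (t a : R) : R := (n k)^-1 * 'D_(1 : R) (sg k) t * f k (n k.+1 * a).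

Local Notation pr := (alternate stage_velocity).

(** The displacement enters with a plus sign, whereas [alternate] subtracts the velocity: stage k is
    undone and the coordinates are exchanged. Iterated by [back] from the last stage on, this leads
    from a position at time t to the initial one. *)
Definition shear k (t : R) (ab : R * R) : R * R :=
  (ab.2 + (n k)^-1 * sg k t * f k (n k.+1 * ab.1), ab.1).

Fixpoint back q t ab := if q is q'.+1 then back q' t (shear q' t ab) else ab.

Definition tracer q (t a b : R) : R := sin (pi *+ 2 * (n 0 * (back q t (a, b)).1)).

Definition flow q : vfield R := fun z => \row_j
  match val j with
  | 0%N => (pr q (tcoord z) (ycoord z)).1
  | 1%N => (pr q (tcoord z) (xcoord z)).2
  | _ => tracer q (tcoord z) (xcoord z) (ycoord z)
  end.

Lemma pr_eq0 q t : (forall j, (j < q)%N -> dsg j t = 0) -> forall a, pr q t a = (0, 0).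
Proof.
elim: q => //= q IH h a; rewrite IH /=; last by move=> j jq; apply: h; exact: ltnW.
by rewrite /stage_velocity -/(dsg q t) h// mulr0 mul0r subrr.
Qed.

(** At each time at most one stage has a nonzero rate. It contributes to a single slot, and the
    later stages, being at rest, only exchange the slots. *)
Lemma pr_disjoint q t : (forall a, (pr q t a).1 = 0) \/ (forall a, (pr q t a).2 = 0).
Proof.
have h : forall q, (forall j, (j < q)%N -> dsg j t = 0) \/
    exists2 k, (k < q)%N & forall j, (j < q)%N -> j <> k -> dsg j t = 0.
  move=> q'; have [[k [kq k0]]|H] := pselect (exists k, (k < q')%N /\ dsg k t <> 0).
    by right; exists k => // j jq jk; have [//|/k0] := dsg_disjoint t jk.
  by left=> j jq; apply: contrapT => h; apply: H; exists j.
have {h} [h|[k kq]] := h q; first by left=> a; rewrite pr_eq0.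
elim: q kq => // q IH; rewrite ltnS leq_eqVlt => /predU1P[->|kq] h.
  have z := @pr_eq0 q t; left=> a; rewrite /= z// => j jq; apply: h; first exact: ltnW.
  by move=> jE; rewrite jE ltnn in jq.
have hq : dsg q t = 0 by apply: h => // qk; rewrite qk ltnn in kq.
have v0 a : stage_velocity q t a = 0 by rewrite /stage_velocity -/(dsg q t) hq mulr0 mul0r.
have [p|r] := IH kq (fun j jq => h j (ltnW jq)).
  by right=> a /=; rewrite p v0 subrr.
by left=> a /=.
Qed.

Lemma smooth_velocity k (a b : spacetime R -> R) : smooth_on setT a -> smooth_on setT b ->
  smooth_on setT (fun z => stage_velocity k (a z) (b z)).
Proof.
move=> sa sb; apply: smoothM.
  exact: smooth_scale (smooth_comp (sdsg k) sa).
exact: smooth_comp (sf k) (smooth_scale _ sb).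
Qed.

Lemma smooth_pr q (a b : spacetime R -> R) : smooth_on setT a -> smooth_on setT b ->
  smooth_on setT (fun z => (pr q (a z) (b z)).1) /\
  smooth_on setT (fun z => (pr q (a z) (b z)).2).
Proof.
move=> sa sb; elim: q => [|q [IH1 IH2]]; first by split; exact: smooth_cst.
by split=> //=; apply: smoothB => //; exact: smooth_velocity.
Qed.

Let smooth_shear q (a b : spacetime R -> R) : smooth_on setT a -> smooth_on setT b ->
  smooth_on setT (fun z => b z + (n q)^-1 * sg q (tcoord z) * f q (n q.+1 * a z)).
Proof.
move=> sa sb; apply: smoothD => //; apply: smoothM.
  exact: smooth_scale (smooth_comp (ssg q) smooth_tcoord).
exact: smooth_comp (sf q) (smooth_scale _ sa).
Qed.

Lemma smooth_back q (a b : spacetime R -> R) : smooth_on setT a -> smooth_on setT b ->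
  smooth_on setT (fun z => (back q (tcoord z) (a z, b z)).1).
Proof.
elim: q a b => //= q IH a b sa sb; rewrite /shear /=.
by apply: (IH _ a) => //; exact: smooth_shear.
Qed.

Let smooth_phase k : smooth_on setT (fun x : R => sin (pi *+ 2 * (k * x))).
Proof.
apply: smooth_comp smooth_sin _; apply: smoothM; first exact: smooth_cst.
by apply: smoothM; [exact: smooth_cst|exact: smooth_id].
Qed.

Lemma smooth_tracer q :
  smooth_on setT (fun z => tracer q (tcoord z) (xcoord z) (ycoord z)).
Proof.
apply: (smooth_comp (smooth_phase (n 0))).
by apply: smooth_back; [exact: smooth_xcoord|exact: smooth_ycoord].
Qed.

(** Induction on the last stage q, whose own time derivative cancels the q-th velocity. What remains
    involves both the displacement [sg q] and the velocities of the earlier stages, and by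
    [sg_start] one of the two is 0: a stage starts only after the earlier ones have come to rest. *)
Lemma back_transport c z q (a b : spacetime R -> R) :
  smooth_on setT a -> smooth_on setT b ->
  Dm c z a = (pr q (tcoord z) (b z)).1 -> Dm c z b = (pr q (tcoord z) (a z)).2 ->
  Dm c z (fun z => (back q (tcoord z) (a z, b z)).1) = 0.
Proof.
elim: q a b => [|q IH] a b sa sb //= Da Db.
have s1 := smooth_scale (n q)^-1 (smooth_comp (ssg q) smooth_tcoord).
have s2 := smooth_comp (sf q) (smooth_scale (n q.+1) sa).
rewrite /shear /=; apply: (IH _ a) => //; first exact: smooth_shear.
- rewrite (DmD _ _ sb (smoothM s1 s2)) (DmM _ _ s1 s2) (Dm_comp _ _ (sf q) (smooth_scale _ sa)).
  rewrite (DmZ _ _ _ sa) (DmZ _ _ _ (smooth_comp (ssg q) smooth_tcoord)).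
  rewrite (Dm_comp _ _ (ssg q) smooth_tcoord) Dm_tcoord Da Db /stage_velocity.
  have [->|/pr_eq0 r0] := sg_start q (tcoord z); last by rewrite !r0 /=; ring.
  by ring.
- rewrite Da; have [->|/pr_eq0 r0] := sg_start q (tcoord z); last by rewrite !r0.
  by rewrite mulr0 mul0r addr0.
Qed.

(** The frequencies are integers, so an integer translation leaves each displacement unchanged and
    is handed on from stage to stage: the shears act on the torus. *)
Lemma back_period q t a b (m m' : int) : exists k : int,
  (back q t (a + m%:~R, b + m'%:~R)).1 = (back q t (a, b)).1 + k%:~R.
Proof.
elim: q a b m m' => [|q IH] a b m m' /=; first by exists m.
rewrite /shear /= mulrDr.
have -> : n q.+1 * m%:~R = ((N q.+1)%:Z * m)%:~R by rewrite intrM.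
by rewrite (periodic_int (pf q)) addrAC; exact: IH.
Qed.

Lemma tracer_period q t a b (m m' : int) :
  tracer q t (a + m%:~R) (b + m'%:~R) = tracer q t a b.
Proof.
rewrite /tracer; have [k ->] := back_period q t a b m m'.
rewrite mulrDr (_ : n 0 * k%:~R = ((N 0)%:Z * k)%:~R); last by rewrite intrM.
apply: (periodic_int (g := fun x => sin (pi *+ 2 * x))) => x.
by rewrite mulrDr mulr1 sinD2pi.
Qed.

Lemma pr_period q t a (m : int) : pr q t (a + m%:~R) = pr q t a.
Proof.
elim: q => //= q ->; congr (_, _ - _); rewrite /stage_velocity mulrDr.
have -> : n q.+1 * m%:~R = ((N q.+1)%:Z * m)%:~R by rewrite intrM.
by rewrite (periodic_int (pf q)).
Qed.

Lemma flow0E q (h : (0 < 3)%N) : vcomp (flow q) (Ordinal h) =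
  fun z => (pr q (tcoord z) (ycoord z)).1.
Proof. by apply/funext => z; rewrite /vcomp mxE. Qed.

Lemma flow1E q (h : (1 < 3)%N) : vcomp (flow q) (Ordinal h) =
  fun z => (pr q (tcoord z) (xcoord z)).2.
Proof. by apply/funext => z; rewrite /vcomp mxE. Qed.

Lemma flow2E q (h : (2 < 3)%N) : vcomp (flow q) (Ordinal h) =
  fun z => tracer q (tcoord z) (xcoord z) (ycoord z).
Proof. by apply/funext => z; rewrite /vcomp mxE. Qed.

Lemma flow_smooth_periodic q i : smooth_periodic (vcomp (flow q) i).
Proof.
case: i => -[|[|[|//]]] h; split.
- rewrite flow0E; exact: (smooth_pr q smooth_tcoord smooth_ycoord).1.
- by move=> t x i; rewrite flow0E -[X in _ = X](congr1 fst (pr_period q t _ (val i == 1%N : nat))).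
- rewrite flow1E; exact: (smooth_pr q smooth_tcoord smooth_xcoord).2.
- by move=> t x i; rewrite flow1E -[X in _ = X](congr1 snd (pr_period q t _ (val i == 0%N : nat))).
- rewrite flow2E; exact: smooth_tracer.
- move=> t x i; rewrite flow2E.
  by rewrite -[RHS](tracer_period q t _ _ (val i == 0%N : nat) (val i == 1%N : nat)).
Qed.

Let evec0 (z : spacetime R) h (i : 'I_3) : tcoord (h *: (0, evec R i) + z) = tcoord z.
Proof. by rewrite /tcoord /= -[LHS]/(h * 0 + z.1) mulr0 add0r. Qed.

Let evecx (z : spacetime R) h (i : 'I_3) : val i <> 0%N ->
  xcoord (h *: (0, evec R i) + z) = xcoord z.
Proof.
move=> /eqP/negbTE i0; rewrite /xcoord /= -[LHS]/(h * (val i == 0%N)%:R + z.2.1.1) i0.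
by rewrite mulr0 add0r.
Qed.

Let evecy (z : spacetime R) h (i : 'I_3) : val i <> 1%N ->
  ycoord (h *: (0, evec R i) + z) = ycoord z.
Proof.
move=> /eqP/negbTE i0; rewrite /ycoord /= -[LHS]/(h * (val i == 1%N)%:R + z.2.1.2) i0.
by rewrite mulr0 add0r.
Qed.

Lemma flow_divergence_free q z : \sum_i Dx i (vcomp (flow q) i) z = 0.
Proof.
apply: big1 => i _; case: i => -[|[|[|//]]] h.
- rewrite flow0E; apply: (@derive_const_line _ _ _ _ _ (pr q (tcoord z) (ycoord z)).1) => k.
  by rewrite evec0 evecy.
- rewrite flow1E; apply: (@derive_const_line _ _ _ _ _ (pr q (tcoord z) (xcoord z)).2) => k.
  by rewrite evec0 evecx.
- rewrite flow2E.
  apply: (@derive_const_line _ _ _ _ _ (tracer q (tcoord z) (xcoord z) (ycoord z))) => k.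
  by rewrite evec0 evecx// evecy.
Qed.

Definition euler_force q : vfield R := fun z =>
  \row_j (if val j == 2%N then 0 else Dt (vcomp (flow q) j) z).

(** The first component depends on (t, y) and the second on (t, x), so that each is constant along
    its own direction; the cross terms vanish because one of the two is 0 at each time. The third is
    constant along trajectories, hence needs no force. *)
Lemma flow_euler q z i : Dt (vcomp (flow q) i) z +
  \sum_j vcomp (flow q) j z * Dx j (vcomp (flow q) i) z = vcomp (euler_force q) i z.
Proof.
rewrite [RHS]/vcomp [RHS]mxE.
case: i => -[|[|[|//]]] h /=.
- rewrite big1 ?addr0// => -[[|[|[|//]]] hj] _ /=.
  + rewrite [X in _ * X](_ : _ = 0) ?mulr0// !flow0E.
    apply: (@derive_const_line _ _ _ _ _ (pr q (tcoord z) (ycoord z)).1) => k.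
    by rewrite evec0 evecy.
  + rewrite flow1E flow0E; have [p0|r0] := pr_disjoint q (tcoord z); last by rewrite r0 mul0r.
    rewrite [X in _ * X](_ : _ = 0) ?mulr0//.
    by apply: (@derive_const_line _ _ _ _ _ 0) => k; rewrite evec0 p0.
  + rewrite [X in _ * X](_ : _ = 0) ?mulr0// !flow0E.
    apply: (@derive_const_line _ _ _ _ _ (pr q (tcoord z) (ycoord z)).1) => k.
    by rewrite evec0 evecy.
- rewrite big1 ?addr0// => -[[|[|[|//]]] hj] _ /=.
  + rewrite flow1E flow0E; have [p0|r0] := pr_disjoint q (tcoord z); first by rewrite p0 mul0r.
    rewrite [X in _ * X](_ : _ = 0) ?mulr0//.
    by apply: (@derive_const_line _ _ _ _ _ 0) => k; rewrite evec0 r0.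
  + rewrite [X in _ * X](_ : _ = 0) ?mulr0// !flow1E.
    apply: (@derive_const_line _ _ _ _ _ (pr q (tcoord z) (xcoord z)).2) => k.
    by rewrite evec0 evecx.
  + rewrite [X in _ * X](_ : _ = 0) ?mulr0// !flow1E.
    apply: (@derive_const_line _ _ _ _ _ (pr q (tcoord z) (xcoord z)).2) => k.
    by rewrite evec0 evecx.
- rewrite -/(Dm (fun j => vcomp (flow q) j z) z (vcomp (flow q) (Ordinal h))) flow2E.
  rewrite (Dm_comp _ _ (smooth_phase (n 0)) (smooth_back q smooth_xcoord smooth_ycoord)).
  rewrite (back_transport (q := q) smooth_xcoord smooth_ycoord) ?mulr0//.
    by rewrite Dm_xcoord (_ : ord0 = Ordinal (isT : (0 < 3)%N)) ?flow0E//; exact/val_inj.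
  by rewrite Dm_ycoord (_ : inord 1 = Ordinal (isT : (1 < 3)%N)) ?flow1E//; apply/val_inj; rewrite /= inordK.
Qed.

Lemma euler_force_smooth_periodic q i : smooth_periodic (vcomp (euler_force q) i).
Proof.
rewrite (_ : vcomp _ _ = if val i == 2%N then fun=> 0 else Dt (vcomp (flow q) i)).
  by case: ifP => _; [exact: sp_cst|exact/sp_Dt/flow_smooth_periodic].
by apply/funext => z; rewrite /vcomp mxE; case: ifP.
Qed.

(** Chosen as the residual, so that the inviscid flow solves the viscous equation exactly and no
    viscous problem has to be solved. *)
Definition ns_force (nu : R) q : vfield R := fun z =>
  \row_j (euler_force q z 0 j - nu * laplacian (vcomp (flow q) j) z).

Lemma ns_force_smooth_periodic nu q i : smooth_periodic (vcomp (ns_force nu q) i).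
Proof.
rewrite (_ : vcomp _ _ = fun z => vcomp (euler_force q) i z - nu * laplacian (vcomp (flow q) i) z).
  apply: (spB (euler_force_smooth_periodic q i)).
  exact: (spZ nu (sp_laplacian (flow_smooth_periodic q i))).
by apply/funext => z; rewrite /vcomp mxE.
Qed.

Lemma flow_ns nu q z i : Dt (vcomp (flow q) i) z +
  \sum_j vcomp (flow q) j z * Dx j (vcomp (flow q) i) z =
  nu * laplacian (vcomp (flow q) i) z + vcomp (ns_force nu q) i z.
Proof. by rewrite flow_euler [in RHS]/vcomp mxE addrC subrK. Qed.

Lemma flow_suitable nu q :
  suitable_leray_hopf nu (fun x => flow q (0, x)) (ns_force nu q) (flow q).
Proof.
apply: classical_suitable.
- exact: flow_smooth_periodic.
- exact: ns_force_smooth_periodic.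
- exact: flow_divergence_free.
- exact: flow_ns.
Qed.

Lemma flow_momentum q :
  momentum_equation 0 (fun x => flow q (0, x)) (euler_force q) (flow q) (fun=> 0).
Proof.
apply: classical_momentum.
- exact: flow_smooth_periodic.
- exact: flow_divergence_free.
- by move=> z i; rewrite flow_euler mul0r add0r.
Qed.

End Shears.

(** * Mixing of the transported wave *)

Section Equidistribution.
Context {R : realType}.

Lemma lipschitz_continuous {V : normedModType R} (h : V -> R) L :
  (forall x y, `|h x - h y| <= L * `|x - y|) -> continuous h.
Proof.
move=> hL x; apply/cvgrPdist_le => e e0.
have L0 : 0 < `|L| + 1 by rewrite ltr_wpDl.
apply/nbhs_ballP; exists (e / (`|L| + 1)) => /=; first by rewrite divr_gt0.
move=> y; rewrite -ball_normE /= => xy; apply: (le_trans (hL x y)).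
apply: (@le_trans _ _ ((`|L| + 1) * `|x - y|)).
  by rewrite ler_wpM2r// (le_trans (ler_norm _))// lerDl.
by rewrite -ler_pdivlMl// mulrC ltW.
Qed.

(** The symmetry s -> 1/2 - s folds a period onto [-1/4, 1/4], where the profile is within d of the
    affine bijection 2 s + 1/2 onto [0, 1]; substitution along that bijection reproduces the mean of
    h. *)
Lemma profile_equidistributed (d : R) (h : R -> R) L : 0 < d < 2^-1 -> 0 <= L ->
  (forall x y, `|h x - h y| <= L * `|x - y|) ->
  `|ival 0 1 (fun s : R => h (profile d s)) - ival 0 1 h| <= d * L.
Proof.
move=> d01 L0 hL; have ch := lipschitz_continuous hL.
have cp : continuous (profile d) by exact: (lipschitz_continuous (profile_lipschitz d01)).
pose g s := h (profile d s).
have cg : continuous g by move=> x; apply: continuous_comp; [exact: cp|exact: ch].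
have pg x : g (x + 1) = g x by rewrite /g profile_periodic.
have q4 : - 4^-1 <= 4^-1 :> R by rewrite ge0_cp.
have E1 : ival 0 1 g = 2 * ival (- 4^-1) 4^-1 g.
  rewrite -(ival_period (- 4^-1) cg pg).
  rewrite (@ival_split _ g (- 4^-1) 4^-1)//; last by lra.
  rewrite mulr_natl mulr2n; congr (_ + _).
  have := ival_reflect 2^-1 cg q4.
  rewrite (_ : 2^-1 - 4^-1 = 4^-1); last by field.
  rewrite (_ : 2^-1 - - 4^-1 = - 4^-1 + 1); last by field.
  by move=> <-; apply: eq_ival => x _; rewrite /g profile_reflect.
have E2 : ival 0 1 h = 2 * ival (- 4^-1) 4^-1 (fun s : R => h (2 * s + 2^-1)).
  rewrite ival_affine// mulrA mulfV// mul1r.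
  have -> : 2 * - 4^-1 + 2^-1 = 0 :> R by field.
  by have -> : 2 * 4^-1 + 2^-1 = 1 :> R by field.
have ca : continuous (fun s : R => h (2 * s + 2^-1)).
  move=> x; apply: (@continuous_comp _ _ _ (fun s : R => 2 * s + 2^-1) h); last exact: ch.
  by apply: cvgD; [apply: cvgMr; exact: cvg_id|exact: cvg_cst].
rewrite -/g E1 E2 -mulrBr -(ivalB _ _ cg ca) normrM ger0_norm//.
apply: (@le_trans _ _ (2 * (d * L * (4^-1 - - 4^-1)))); last first.
  by rewrite (_ : 2 * _ = d * L)//; field.
rewrite ler_wpM2l//; apply: ival_norm => //.
  by move=> x; apply: cvgB; [exact: cg|exact: ca].
move=> x /andP[x1 x2]; apply: (le_trans (hL _ _)); rewrite mulrC ler_wpM2r//.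
by apply: profile_near => //; rewrite ler_norml x1 ltW.
Qed.

End Equidistribution.

(** * Averages over a sliding window *)

Section SlidingAverage.
Context {R : realType}.
Variables (g : R -> R -> R) (l k : R).
Hypothesis gl : forall a b a' b', `|g a b - g a' b'| <= l * `|a - a'| + l * `|b - b'|.

Definition sliding_average a b : R := ival 0 1 (fun s : R => g (a + k * s) b).

Lemma sliding_continuous a b : continuous (fun s : R => g (a + k * s) b).
Proof.
apply: (@lipschitz_continuous _ _ _ (l * `|k|)) => x y; apply: (le_trans (gl _ _ _ _)).
rewrite subrr normr0 mulr0 addr0 opprD addrACA subrr add0r.
by rewrite -mulrBr normrM mulrA.
Qed.

Lemma sliding_average_lipschitz a b a' b' :
  `|sliding_average a b - sliding_average a' b'| <= l * `|a - a'| + l * `|b - b'|.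
Proof.
rewrite /sliding_average -(ivalB _ _ (@sliding_continuous a b) (@sliding_continuous a' b')).
rewrite -[leRHS]mulr1 -[X in _ * X]subr0; apply: ival_norm => //.
  by move=> x; apply: cvgB; exact: sliding_continuous.
by move=> s _; apply: (le_trans (gl _ _ _ _)); rewrite opprD addrACA subrr addr0.
Qed.

Lemma sliding_average_le1 a b : (forall a b, `|g a b| <= 1) -> `|sliding_average a b| <= 1.
Proof.
move=> g1; apply: (@le_trans _ _ (1 * (1 - 0))); last by rewrite subr0 mulr1.
by apply: ival_norm => //; exact: sliding_continuous.
Qed.

End SlidingAverage.

(** * The effect of one stage on the averages *)

Section Mixing.
Context {R : realType}.
Variables (N : nat -> nat) (d : nat -> R) (sg : nat -> R -> R).
Let n k : R := (N k)%:R.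
Let f k := profile (d k).
Hypothesis N1 : forall k, (0 < N k <= N k.+1)%N.
Hypothesis d01 : forall k, 0 < d k < 2^-1.
Hypothesis sg_end : forall k t, 1 <= t -> sg k t = 1.

Definition mixed q a b : R := tracer N f sg q 1 a b.

Let n_gt0 k : 0 < n k. Proof. by rewrite ltr0n; have /andP[] := N1 k. Qed.

Lemma tracer_mixed q (t a b : R) : 1 <= t -> tracer N f sg q t a b = mixed q a b.
Proof.
move=> t1; rewrite /mixed /tracer; congr (sin (_ * (_ * _.1))).
elim: q (a, b) => //= q IH ab; rewrite /shear (sg_end q t1) (sg_end q (lexx 1)).
exact: IH.
Qed.

Lemma mixedS q a b : mixed q.+1 a b = mixed q (b + (n q)^-1 * f q (n q.+1 * a)) a.
Proof. by rewrite /mixed /tracer /= /shear sg_end// mulr1. Qed.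

Lemma mixed_le1 q a b : `|mixed q a b| <= 1.
Proof. by rewrite ler_norml sin_geN1 sin_le1. Qed.

Lemma mixed_period q a b (m m' : int) : mixed q (a + m%:~R) (b + m'%:~R) = mixed q a b.
Proof. by apply: tracer_period => k x; exact: profile_periodic. Qed.

(** The 8 bounds 2 pi, from the initial sine. Each stage costs a factor 1 + 2 n_(q+1) / n_q <= 3
    n_(q+1) / n_q, where 2 is the Lipschitz constant of the profile. *)
Definition mixed_lip q : R := 8 * 3 ^+ q * n q.

Lemma mixed_lip_ge0 q : 0 <= mixed_lip q.
Proof. by rewrite !mulr_ge0 ?exprn_ge0// ltW. Qed.

Lemma mixed_lipschitz q a b a' b' :
  `|mixed q a b - mixed q a' b'| <= mixed_lip q * `|a - a'| + mixed_lip q * `|b - b'|.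
Proof.
elim: q a b a' b' => [|q IH] a b a' b'.
  rewrite /mixed /tracer /= /mixed_lip expr0 mulr1.
  have D (x : R) : is_derive x 1 (fun x => sin (pi *+ 2 * (n 0 * x)))
      (cos (pi *+ 2 * (n 0 * x)) * (pi *+ 2 * n 0)).
    apply: (is_derive_comp1 (is_derive_sin _)).
    have := is_derive_linear (l := fun x : R => pi *+ 2 * (n 0 * x)) x 1 _.
    rewrite mulr1; apply => h u v; rewrite -[h *: u]/(h * u); ring.
  have B x : `|cos (pi *+ 2 * (n 0 * x)) * (pi *+ 2 * n 0)| <= 8 * n 0.
    rewrite normrM -[leRHS]mul1r ler_pM//.
      by rewrite ler_norml cos_geN1 cos_le1.
    rewrite ger0_norm; last by apply: mulr_ge0; [rewrite mulrn_wge0// pi_ge0|exact: ltW].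
    rewrite ler_wpM2r ?ltW// mulr2n.
    by have := @pihalf_lt2 R; rewrite ltr_pdivrMr//; move: (pi : R) => p; lra.
  apply: (le_trans (is_derive_lipschitz D B _ _)).
  by rewrite lerDl !mulr_ge0// ltW.
rewrite !mixedS; apply: (le_trans (IH _ _ _ _)).
have q1 : 1 <= n q.+1 / n q.
  by rewrite ler_pdivlMr// mul1r ler_nat; have /andP[] := N1 q.
have F : `|b + (n q)^-1 * f q (n q.+1 * a) - (b' + (n q)^-1 * f q (n q.+1 * a'))| <=
    `|b - b'| + 2 * (n q.+1 / n q) * `|a - a'|.
  rewrite opprD addrACA -mulrBr; apply: (le_trans (ler_normD _ _)); apply: lerD => //.
  rewrite normrM gtr0_norm ?invr_gt0//.
  apply: (@le_trans _ _ ((n q)^-1 * (2 * `|n q.+1 * a - n q.+1 * a'|))).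
    by apply: ler_wpM2l; [rewrite invr_ge0 ltW|exact: profile_lipschitz].
  by rewrite -mulrBr normrM gtr0_norm// le_eqVlt; apply/orP; left; apply/eqP; ring.
have L0 := mixed_lip_ge0 q.
have E : mixed_lip q.+1 = 3 * (n q.+1 / n q) * mixed_lip q.
  by rewrite /mixed_lip exprS; field; rewrite gt_eqF//; exact: n_gt0.
apply: (le_trans (lerD (ler_wpM2l L0 F) (lexx _))); rewrite E.
set u := `|a - a'|; set w := `|b - b'|; set r := n q.+1 / n q in q1 *.
have u0 : 0 <= u by exact: normr_ge0.
have w0 : 0 <= w by exact: normr_ge0.
have h1 : mixed_lip q * u <= r * (mixed_lip q * u) by rewrite ler_peMl// mulr_ge0.
have h2 : mixed_lip q * w <= r * (mixed_lip q * w) by rewrite ler_peMl// mulr_ge0.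
have h3 : 0 <= r * (mixed_lip q * w) by rewrite (le_trans _ h2)// mulr_ge0.
lra.
Qed.

Lemma mixed_lipschitz1 q a b a' : `|mixed q a b - mixed q a' b| <= mixed_lip q * `|a - a'|.
Proof. by have := mixed_lipschitz q a b a' b; rewrite subrr normr0 mulr0 addr0. Qed.

Lemma mixed_lipschitz2 q a b b' : `|mixed q a b - mixed q a b'| <= mixed_lip q * `|b - b'|.
Proof. by have := mixed_lipschitz q a b a b'; rewrite subrr normr0 mulr0 add0r. Qed.

(** The window 1 / n_q is the range of the displacement in stage q: averaging over it is, up to an
    exchange of coordinates, what that stage does to the wave. *)
Definition average q : R -> R -> R := sliding_average (mixed q) (n q)^-1.

Let cmixed q a b k : continuous (fun s : R => mixed q (a + k * s) b).
Proof. exact: (@sliding_continuous _ _ _ k (mixed_lipschitz q) a b). Qed.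

Lemma average_lipschitz q a b a' b' :
  `|average q a b - average q a' b'| <= mixed_lip q * `|a - a'| + mixed_lip q * `|b - b'|.
Proof. exact: (@sliding_average_lipschitz _ _ _ _ (mixed_lipschitz q)). Qed.

Lemma average_period q a b (m m' : int) : average q (a + m%:~R) (b + m'%:~R) = average q a b.
Proof. by apply: eq_ival => s _; rewrite addrAC mixed_period. Qed.

(** The window 1 / n_0 is exactly one period of the initial sine. *)
Lemma average0 a b : average 0 a b = 0.
Proof.
pose H (s : R) := - (pi *+ 2)^-1 * cos (pi *+ 2 * (n 0 * a) + pi *+ 2 * s).
have p0 : pi *+ 2 != 0 :> R by rewrite mulrn_eq0/= gt_eqF ?pi_gt0.
have Dl (x : R) : is_derive x 1 (fun s : R => pi *+ 2 * (n 0 * a) + pi *+ 2 * s) (pi *+ 2).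
  have := is_derive_addf (is_derive_cst (pi *+ 2 * (n 0 * a)) x (1 : R))
   (is_derive_mulf (is_derive_cst (pi *+ 2 : R) x (1 : R)) (is_derive_id x (1 : R))).
  by move/is_derive_eq; apply; rewrite /cst mulr0 addr0 add0r mulr1.
have D (s : R) : is_derive s 1 H (sin (pi *+ 2 * (n 0 * a) + pi *+ 2 * s)).
  have := is_derive_mulf (is_derive_cst (- (pi *+ 2)^-1 : R) s (1 : R))
    (is_derive_comp1 (is_derive_cos _) (Dl s)).
  move/is_derive_eq; apply; rewrite /cst mulr0 addr0.
  set S := sin _; by move: (pi *+ 2) p0 @S => p p0 S; field.
have E s : mixed 0 (a + (n 0)^-1 * s) b = sin (pi *+ 2 * (n 0 * a) + pi *+ 2 * s).
  rewrite /mixed /tracer /= -/(n 0) [n 0 * (a + _)]mulrDr [n 0 * (_ * s)]mulrA.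
  by rewrite mulfV ?gt_eqF// mul1r mulrDr.
have cs : continuous (fun s : R => sin (pi *+ 2 * (n 0 * a) + pi *+ 2 * s)).
  move=> x; apply: (@continuous_comp _ _ _ (fun s : R => pi *+ 2 * (n 0 * a) + pi *+ 2 * s) sin).
    exact: (is_derive_continuous Dl).
  exact: continuous_sin.
rewrite /average /sliding_average (@eq_ival _ _ (fun s : R => sin (pi *+ 2 * (n 0 * a) + pi *+ 2 * s))); last by move=> s _; exact: E.
by rewrite (ival_FTC D)// /H mulr1 mulr0 addr0 cosD2pi subrr.
Qed.

(** Across a window 1 / n_(q+1) the displacement runs through a full period, while the other
    argument moves by at most 1 / n_(q+1); freezing the latter produces the first error. The
    displacement is equidistributed on [0, 1 / n_q] up to d_q, so that the previous average remains,
    with the coordinates exchanged. *)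
Lemma average_step q a b :
  `|average q.+1 a b - average q b a| <= 8 * 3 ^+ q * (n q / n q.+1 + d q).
Proof.
have L0 := mixed_lip_ge0 q.
pose h r := mixed q (b + (n q)^-1 * r) a.
have hL x y : `|h x - h y| <= mixed_lip q / n q * `|x - y|.
  apply: (le_trans (mixed_lipschitz1 _ _ _ _)).
  by rewrite opprD addrACA subrr add0r -mulrBr normrM gtr0_norm ?invr_gt0// mulrA.
have ch := lipschitz_continuous hL.
have cf : continuous (f q) by exact: (lipschitz_continuous (profile_lipschitz (d01 q))).
have chf : continuous (fun s : R => h (f q s)).
  by move=> x; apply: (@continuous_comp _ _ _ (f q) h); [exact: cf|exact: ch].
have chfs : continuous (fun s : R => h (f q (s + n q.+1 * a))).
  move=> x; apply: (@continuous_comp _ _ _ (fun s : R => s + n q.+1 * a) (fun s : R => h (f q s))).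
    by apply: cvgD; [exact: cvg_id|exact: cvg_cst].
  exact: chf.
have S : ival 0 1 (fun s : R => h (f q (s + n q.+1 * a))) = ival 0 1 (fun s : R => h (f q s)).
  by apply: (ival_shift _ chf) => x; rewrite /f profile_periodic.
have E1 : `|average q.+1 a b - ival 0 1 (fun s : R => h (f q (s + n q.+1 * a)))| <=
    mixed_lip q / n q.+1.
  rewrite /average /sliding_average -(ivalB _ _ (@cmixed q.+1 a b _) chfs).
  apply: (@le_trans _ _ (mixed_lip q / n q.+1 * (1 - 0))); last by rewrite subr0 mulr1.
  apply: ival_norm => //.
    by move=> x; apply: cvgB; [exact: cmixed|exact: chfs].
  move=> s /andP[s0 s1]; rewrite mixedS.
  have -> : n q.+1 * (a + (n q.+1)^-1 * s) = s + n q.+1 * a.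
    by rewrite mulrDr [n q.+1 * (_ * s)]mulrA mulfV ?gt_eqF// mul1r addrC.
  apply: (le_trans (mixed_lipschitz2 _ _ _ _)).
  rewrite [a + _]addrC addrK ler_wpM2l// normrM gtr0_norm ?invr_gt0//.
  by rewrite ger0_norm// ler_piMr ?invr_ge0// ltW.
have E2 := profile_equidistributed (d01 q) (divr_ge0 L0 (ltW (n_gt0 q))) hL.
have -> : average q.+1 a b - average q b a =
    (average q.+1 a b - ival 0 1 (fun s : R => h (f q (s + n q.+1 * a)))) +
    (ival 0 1 (fun s : R => h (f q s)) - average q b a) by rewrite S; ring.
apply: (le_trans (ler_normD _ _)); apply: (le_trans (lerD E1 E2)).
rewrite /mixed_lip le_eqVlt; apply/orP; left; apply/eqP; field.
by rewrite !gt_eqF//; exact: n_gt0.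
Qed.

End Mixing.

Lemma ival_cst {R : realType} (c a b : R) : a <= b -> ival a b (fun=> c) = c * (b - a).
Proof.
move=> ab; have D (x : R) : is_derive x 1 (fun x : R => c * x) c.
  have := is_derive_mulf (is_derive_cst c x (1 : R)) (is_derive_id x (1 : R)).
  by move/is_derive_eq; apply; rewrite /cst mulr1 mulr0 addr0.
by rewrite (ival_FTC D)// ?mulrBr// => x; exact: cvg_cst.
Qed.

Section PlanarAverage.
Context {R : realType}.
Variables (g : R -> R -> R) (l : R).
Hypothesis gl : forall a b a' b', `|g a b - g a' b'| <= l * `|a - a'| + l * `|b - b'|.
Hypothesis g1 : forall a b, `|g a b| <= 1.

Definition planar (z : spacetime R) : R := g (xcoord z) (ycoord z).

Let l0 : 0 <= l.
Proof.
have := gl 1 0 0 0; rewrite !subr0 normr1 mulr1 normr0 mulr0 addr0.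
exact: le_trans.
Qed.

Lemma xcoord_lipschitz (z w : spacetime R) : `|xcoord z - xcoord w| <= `|z - w|.
Proof.
apply: (@le_trans _ _ `|(z - w).2|); last exact: ler_norm_pair2.
apply: (@le_trans _ _ `|(z - w).2.1|); last exact: (ler_norm_pair1 (z - w).2).
exact: (ler_norm_pair1 (z - w).2.1).
Qed.

Lemma ycoord_lipschitz (z w : spacetime R) : `|ycoord z - ycoord w| <= `|z - w|.
Proof.
apply: (@le_trans _ _ `|(z - w).2|); last exact: ler_norm_pair2.
apply: (@le_trans _ _ `|(z - w).2.1|); last exact: (ler_norm_pair1 (z - w).2).
exact: (ler_norm_pair2 (z - w).2.1).
Qed.

Lemma planar_continuous : continuous planar.
Proof.
apply: (@lipschitz_continuous _ _ _ (l + l)) => z w; apply: (le_trans (gl _ _ _ _)).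
by rewrite mulrDl lerD// ler_wpM2l//; [exact: xcoord_lipschitz|exact: ycoord_lipschitz].
Qed.

Lemma planar_measurable : measurable_fun (setT : set (mspacetime R)) planar.
Proof. exact: continuous_measurable4 planar_continuous. Qed.

Lemma planar_bdd J : bdd (box J) planar.
Proof. by exists 1 => z _; exact: g1. Qed.

End PlanarAverage.

(** * Weak distance of a function to its averages *)

Section WeakAverage.
Context {R : realType}.
Variables (g : R -> R -> R) (l k : R).
Hypothesis gl : forall a b a' b', `|g a b - g a' b'| <= l * `|a - a'| + l * `|b - b'|.
Hypothesis g1 : forall a b, `|g a b| <= 1.
Hypothesis gp : forall a b, g (a + 1) b = g a b.
Hypothesis k0 : 0 <= k.
Variables (J : set (measurableTypeR R)) (hJ : slice_interval J) (chi : spacetime R -> R).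
Hypothesis schi : smooth_periodic chi.
Variable L : R.
Hypothesis chiL : forall z, 0 <= z.1 <= 2 -> `|Dx ord0 chi z| <= L.

Let mu := fine (leb4 R (box J)).
Let mJ := hJ.1.
Let Joo := slice_interval_lty hJ.
Let mbox := measurable_box mJ.
Let boxoo := leb4_box_lty mJ Joo.

Let JE t : J t -> 0 <= t <= 2.
Proof. by move=> /(hJ.2 t); rewrite /= in_itv. Qed.

Let gs s : forall a b a' b', `|g (a + s) b - g (a' + s) b'| <= l * `|a - a'| + l * `|b - b'|.
Proof.
by move=> a b a' b'; apply: (le_trans (gl _ _ _ _)); rewrite opprD addrACA subrr addr0.
Qed.

Let chi_s (s : R) z := chi (z + (0, (- s) *: evec R ord0)).

Let chi_sE s t r x : chi_s s (t, set_coord ord0 r x) = chi (t, set_coord ord0 (- s + r) x).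
Proof. by rewrite set_coordE /chi_s addrC -[(0, _) + _]/(0 + t, _ + _) add0r. Qed.

Let cchi_s s : continuous (chi_s s).
Proof.
move=> z; apply: (@continuous_comp _ _ _ (fun z : spacetime R => z + (0, (- s) *: evec R ord0)) chi).
  by apply: cvgD; [exact: cvg_id|exact: cvg_cst].
exact: (smooth_continuous schi.1).
Qed.

Let chi_s_near s z : 0 <= s -> 0 <= z.1 <= 2 -> `|chi_s s z - chi z| <= L * s.
Proof.
case: z => t [[a b] c] s0 tJ; pose x := (a, b, c).
rewrite -[(a, b, c)]/(set_coord ord0 a x) chi_sE.
have := @is_derive_lipschitz _ _ _ L (fun r => is_derive_coord ord0 t x r schi.1).
move=> /(_ (fun r => chiL (z := (t, set_coord ord0 r x)) tJ) (- s + a) a).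
by move=> h; apply: (le_trans h); rewrite addrK normrN ger0_norm.
Qed.

Let bchi_s s : bdd (box J) (chi_s s).
Proof.
have [C _ hC] := smooth_bounded schi.1 schi.2.
by exists C => -[t x] [/= tJ _]; apply: hC => /=; rewrite addr0; exact: JE.
Qed.

Let bchi : bdd (box J) chi. Proof. exact: smooth_bdd schi.1 schi.2. Qed.
Let mchi : measurable_fun (setT : set (mspacetime R)) chi.
Proof. exact: smooth_measurable schi.1. Qed.

Let A s := \int[leb4 R]_(z in box J) (planar (fun a b => g (a + k * s) b) z * chi z).

Let mA s : measurable_fun (setT : set (mspacetime R))
  (fun z => planar (fun a b => g (a + k * s) b) z * chi z).
Proof. exact: measurable_funM (planar_measurable (gs _)) mchi. Qed.

Let bA s : bdd (box J) (fun z => planar (fun a b => g (a + k * s) b) z * chi z).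
Proof. by apply: bddM => //; exists 1 => z _; exact: g1. Qed.

Let translate_A s : A s = \int[leb4 R]_(z in box J) (planar g z * chi_s (k * s) z).
Proof.
have bs := bchi_s (k * s).
apply: (eq_box_integral mJ Joo (i := ord0)) => //.
- apply: measurable_funM; first exact: planar_measurable gl.
  exact: continuous_measurable4 (@cchi_s _).
- by apply: bddM => //; exact: planar_bdd.
move=> t x tJ.
have ch : continuous (fun r : R => g r x.1.2 * chi (t, set_coord ord0 (- (k * s) + r) x)).
  move=> r; apply: cvgM.
    apply: (@lipschitz_continuous _ _ _ l) => u v; apply: (le_trans (gl _ _ _ _)).
    by rewrite subrr normr0 mulr0 addr0.
  apply: (@continuous_comp _ _ _ (fun r : R => - (k * s) + r) (fun r => chi (t, set_coord ord0 r x))).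
    by apply: cvgD; [exact: cvg_cst|exact: cvg_id].
  exact: (is_derive_continuous (fun r => is_derive_coord ord0 t x r schi.1)).
have ph r : g (r + 1) x.1.2 * chi (t, set_coord ord0 (- (k * s) + (r + 1)) x) =
    g r x.1.2 * chi (t, set_coord ord0 (- (k * s) + r) x).
  by rewrite gp addrA (xperiodic_set_coord _ _ _ _ schi.2).
under [RHS]eq_ival do rewrite chi_sE.
rewrite -[RHS](ival_shift (k * s) ch ph); apply: eq_ival => r _.
by rewrite [- _ + _]addrC addrK.
Qed.

Let A_near s : 0 <= s < 1 -> `|A s - A 0| <= L * k * mu.
Proof.
move=> /andP[s0 s1]; rewrite translate_A /A -RintegralB//; first last.
- by apply: box_integrable.
- apply: box_integrable => //.
    apply: measurable_funM; first exact: planar_measurable gl.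
    exact: continuous_measurable4 (@cchi_s _).
  apply: bddM; first exact: planar_bdd.
  exact: bchi_s.
apply: le_Rintegral_bdd => //.
  apply/measurable_funTS/measurable_funB => //.
  apply: measurable_funM; first exact: planar_measurable gl.
  exact: continuous_measurable4 (@cchi_s _).
move=> z [zJ _]; rewrite mulr0; have -> : planar (fun a b => g (a + 0) b) z = planar g z.
  by rewrite /planar addr0.
rewrite -mulrBr normrM; apply: (@le_trans _ _ (1 * (L * (k * s)))).
  apply: ler_pM => //; first exact: g1.
  by apply: chi_s_near; [rewrite mulr_ge0|exact: JE].
rewrite mul1r mulrA ler_piMr//; last exact: ltW.
rewrite mulr_ge0// (le_trans _ (chiL (z := z) _))//; exact: JE.
Qed.

Let cA : continuous A.
Proof.
have [C C0 hC] : exists2 C, 0 <= C & forall z, box J z -> `|chi z| <= C.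
  have [C C0 hC] := smooth_bounded schi.1 schi.2; exists C => // z [zJ _]; apply: hC; exact: JE.
have l0 : 0 <= l.
  have := gl 1 0 0 0; rewrite !subr0 normr1 mulr1 normr0 mulr0 addr0; exact: le_trans.
apply: (@lipschitz_continuous _ _ _ (l * k * C * mu)) => s r.
rewrite /A -RintegralB//; try exact: box_integrable.
rewrite mulrAC; apply: le_Rintegral_bdd => //; first exact/measurable_funTS/measurable_funB.
move=> z zJ; rewrite -mulrBl normrM [leRHS]mulrAC; apply: ler_pM => //; last exact: hC.
apply: (le_trans (gl _ _ _ _)); rewrite subrr normr0 mulr0 addr0 opprD addrACA subrr add0r.
by rewrite -mulrBr normrM ger0_norm// mulrA.
Qed.

(** By periodicity a translation of g in x can be moved onto the smooth function [chi], which
    changes by at most L k under shifts of length at most k. Integration over the shift and Fubini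
    turn the translates of g into its average. *)
Lemma planar_average_weak :
  `|\int[leb4 R]_(z in box J)
     ((planar g z - planar (sliding_average g k) z) * chi z)|
  <= L * k * mu.
Proof.
pose F (u : measurableTypeR R * mspacetime R) : R :=
  planar (fun a b => g (a + k * u.1) b) u.2 * chi u.2.
have mF : measurable_fun (setT : set (measurableTypeR R * mspacetime R)) F.
  apply: (@measurable_caratheodory_fun R _ (mspacetime R) F).
    by move=> s; exact: mA.
  move=> z; apply: (@lipschitz_continuous _ _ _ (l * k * `|chi z|)) => s r.
  rewrite -mulrBl normrM [leRHS]mulrAC ler_wpM2r//.
  apply: (le_trans (gl _ _ _ _)); rewrite subrr normr0 mulr0 addr0 opprD addrACA subrr add0r.
  by rewrite -mulrBr normrM ger0_norm// mulrA.
pose Q : set (measurableTypeR R) := `[0%R, 1%R[%classic.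
have mQ : measurable Q by exact: measurable_itv.
have Qoo : (leb1 R Q < +oo)%E by rewrite /Q leb1_itv// ltry.
have bF : bdd (Q `*` box J) F.
  have [C hC] := bchi; exists (1 * C) => -[s z] [_ zJ]; rewrite normrM.
  by apply: ler_pM => //; [exact: g1|exact: hC].
have E1 : ival 0 1 A = \int[leb4 R]_(z in box J)
    (planar (sliding_average g k) z * chi z).
  rewrite -[LHS](Rintegral_prod1 mQ mbox Qoo boxoo mF bF) (Rintegral_prod2 mQ mbox Qoo boxoo mF bF).
  apply: eq_Rintegral => z _; rewrite /planar [RHS]mulrC -[RHS]ivalZ.
    by apply: eq_ival => s _; rewrite mulrC.
  exact: sliding_continuous gl _ _.
have cg s : continuous (fun a => A a - A s) by move=> a; apply: cvgB; [exact: cA|exact: cvg_cst].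
have -> : \int[leb4 R]_(z in box J)
     ((planar g z - planar (sliding_average g k) z) * chi z) =
    - ival 0 1 (fun s => A s - A 0).
  rewrite (ivalB _ _ cA) ?E1; last by move=> a; exact: cvg_cst.
  rewrite ival_cst// subr0 mulr1 opprB.
  under eq_Rintegral do rewrite mulrBl.
  rewrite RintegralB//; last first.
  - apply: box_integrable => //.
      exact: measurable_funM (planar_measurable (sliding_average_lipschitz k gl)) mchi.
    by apply: bddM => //; exists 1 => z _; exact: sliding_average_le1 gl _ _ g1.
  - apply: box_integrable => //; first exact: measurable_funM (planar_measurable gl) mchi.
    by apply: bddM => //; exact: planar_bdd.
  by congr (_ - _); apply: eq_Rintegral => z _; rewrite /planar mulr0 addr0.
rewrite normrN; apply: (@le_trans _ _ (L * k * mu * (1 - 0))); last by rewrite subr0 mulr1.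
apply: ival_norm => //; exact: A_near.
Qed.

End WeakAverage.

(** [u + e] is nonincreasing and [u - e] nondecreasing, so every [u m - e m] lies below every
    [u k + e k]; this gives both the convergence and the distance [e m]. *)
Lemma telescoping_limit {R : realType} (u e : nat -> R) :
  (forall m, `|u m.+1 - u m| <= e m - e m.+1) -> (forall m, 0 <= e m) ->
  cvgn (fun m => u m + e m) /\
  forall m, `|limn (fun m => u m + e m) - u m| <= e m.
Proof.
move=> ue e0.
have dec : nonincreasing_seq (fun m => u m + e m).
  apply/nonincreasing_seqP => m; have := ue m; rewrite ler_norml => /andP[_]; lra.
have inc : nondecreasing_seq (fun m => u m - e m).
  apply/nondecreasing_seqP => m; have := ue m; rewrite ler_norml => /andP[h _]; lra.
have lb m k : u m - e m <= u k + e k.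
  apply: (@le_trans _ _ (u (maxn m k) - e (maxn m k))); first exact/inc/leq_maxl.
  apply: (@le_trans _ _ (u (maxn m k) + e (maxn m k))); last exact/dec/leq_maxr.
  by rewrite lerD2l; have := e0 (maxn m k); lra.
have c : cvgn (fun m => u m + e m).
  by apply: nonincreasing_is_cvgn => //; exists (u 0 - e 0) => _ [k _ <-]; exact: lb.
split=> // m; rewrite distrC ler_distlC; apply/andP; split.
  by apply: limr_ge => //; apply: nearW => k; exact: lb.
exact: (nonincreasing_cvgn_ge dec c m).
Qed.

Section PlanarIntegral.
Context {R : realType}.
Variables (J : set (measurableTypeR R)) (hJ : slice_interval J) (G H : R -> R -> R).
Hypotheses (mG : measurable_fun (setT : set (mspacetime R)) (planar G)) (bG : bdd (box J) (planar G)).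
Hypotheses (mH : measurable_fun (setT : set (mspacetime R)) (planar H)) (bH : bdd (box J) (planar H)).

Lemma eq_planar_integral1 : (forall b, ival 0 1 (G^~ b) = ival 0 1 (H^~ b)) ->
  \int[leb4 R]_(z in box J) planar G z = \int[leb4 R]_(z in box J) planar H z.
Proof.
move=> GH; apply: (eq_box_integral hJ.1 (slice_interval_lty hJ) (i := ord0)) => // t x _.
exact: GH.
Qed.

Lemma eq_planar_integral2 : (forall a, ival 0 1 (G a) = ival 0 1 (H a)) ->
  \int[leb4 R]_(z in box J) planar G z = \int[leb4 R]_(z in box J) planar H z.
Proof.
move=> GH; apply: (eq_box_integral hJ.1 (slice_interval_lty hJ) (i := Ordinal (isT : (1 < 3)%N))) => // t x _.
exact: GH.
Qed.

End PlanarIntegral.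

(** A shift by a quarter period exchanges the squares of sine and cosine, whose sum is 1. *)
Lemma ival_sin_sqr {R : realType} (N : nat) : (0 < N)%N ->
  ival 0 1 (fun s : R => sin (pi *+ 2 * (N%:R * s)) ^+ 2) = 2^-1.
Proof.
move=> N0; have n0 : 0 < N%:R :> R by rewrite ltr0n.
pose u (s : R) := pi *+ 2 * (N%:R * s).
have cu : continuous u.
  move=> x; apply: cvgM; first exact: cvg_cst.
  by apply: cvgM; [exact: cvg_cst|exact: cvg_id].
have cs : continuous (fun s => sin (u s) ^+ 2).
  move=> x; apply: cvgM.
    by apply: (@continuous_comp _ _ _ u sin); [exact: cu|exact: continuous_sin].
  by apply: (@continuous_comp _ _ _ u sin); [exact: cu|exact: continuous_sin].
have cc : continuous (fun s => cos (u s) ^+ 2).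
  move=> x; apply: cvgM.
    by apply: (@continuous_comp _ _ _ u cos); [exact: cu|exact: continuous_cos].
  by apply: (@continuous_comp _ _ _ u cos); [exact: cu|exact: continuous_cos].
have ps s : sin (u (s + 1)) ^+ 2 = sin (u s) ^+ 2.
  have psin x : sin (pi *+ 2 * (x + 1)) = sin (pi *+ 2 * x) :> R.
    by rewrite mulrDr mulr1 sinD2pi.
  by congr (_ ^+ 2); rewrite /u mulrDr mulr1; exact: (periodic_int psin _ N).
have E : ival 0 1 (fun s => sin (u s) ^+ 2) = ival 0 1 (fun s => cos (u s) ^+ 2).
  rewrite -(ival_shift (4 * N%:R)^-1 cs ps); apply: eq_ival => s _; congr (_ ^+ 2).
  have -> : u (s + (4 * N%:R)^-1) = u s + pi / 2.
    by rewrite /u mulr2n; move: (pi : R) => p; field; rewrite gt_eqF.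
  by rewrite sinDpihalf.
have : ival 0 1 (fun s => sin (u s) ^+ 2 + cos (u s) ^+ 2) = 1.
  rewrite (@eq_ival _ _ (fun=> 1)) ?ival_cst//; first by rewrite subr0 mulr1.
  by move=> s _; rewrite addrC cos2Dsin2.
rewrite ivalD// -E -[ival 0 1 _]/(ival 0 1 (fun s => sin (u s) ^+ 2)); lra.
Qed.

(** * The homogenized profile and its distance from the waves *)

Section MixingLimit.
Context {R : realType}.
Variables (N : nat -> nat) (d : nat -> R) (sg : nat -> R -> R).
Let n k : R := (N k)%:R.
Let f k := profile (d k).
Hypothesis N1 : forall k, (0 < N k <= N k.+1)%N.
Hypothesis d01 : forall k, 0 < d k < 2^-1.
Hypothesis sg_end : forall k t, 1 <= t -> sg k t = 1.
Hypothesis err : forall q, 8 * 3 ^+ q * (n q / n q.+1 + d q) <= 2^-1 ^+ q.+3.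

Local Notation mixed := (mixed N d sg).
Local Notation average := (average N d sg).
Local Notation lip := (mixed_lipschitz N1 d01 sg_end).

Let swap_lip q a b a' b' : `|mixed q b a - mixed q b' a'| <=
  mixed_lip N q * `|a - a'| + mixed_lip N q * `|b - b'|.
Proof. by rewrite [leRHS]addrC; exact: lip. Qed.

Let m1 J q : measurable_fun (setT : set (mspacetime R)) (planar (fun a b => mixed q a b ^+ 2)) /\
  bdd (box J) (planar (fun a b => mixed q a b ^+ 2)).
Proof.
split; first exact: measurable_funX (planar_measurable (lip q)).
by apply: (@bddX _ _ _ (planar (mixed q))); apply: planar_bdd; exact: mixed_le1.
Qed.

Let m2 J q : measurable_fun (setT : set (mspacetime R)) (planar (fun a b => mixed q b a ^+ 2)) /\
  bdd (box J) (planar (fun a b => mixed q b a ^+ 2)).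
Proof.
split; first exact: measurable_funX (planar_measurable (swap_lip q)).
apply: (@bddX _ _ _ (planar (fun a b => mixed q b a))); apply: planar_bdd => a b; exact: mixed_le1.
Qed.

Let cmix q a : continuous (fun s : R => mixed q s a ^+ 2).
Proof.
have c : continuous (fun s : R => mixed q s a).
  apply: (@lipschitz_continuous _ _ _ (mixed_lip N q)) => u v.
  by apply: (le_trans (lip q _ _ _ _)); rewrite subrr normr0 mulr0 addr0.
by move=> s; apply: cvgM; exact: c.
Qed.

Let pmix q (a b : R) : mixed q (a + 1) b = mixed q a b.
Proof. by have := mixed_period N d sg q a b 1 0; rewrite addr0. Qed.

(* The stages are shears of the torus, hence preserve the measure. *)
Lemma mixed_sqr_integral J q : slice_interval J ->
  \int[leb4 R]_(z in box J) planar (fun a b => mixed q a b ^+ 2) z = 2^-1 * fine (leb4 R (box J)) /\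
  \int[leb4 R]_(z in box J) planar (fun a b => mixed q b a ^+ 2) z = 2^-1 * fine (leb4 R (box J)).
Proof.
move=> hJ; have mJ := measurable_box hJ.1; elim: q => [|q [IH1 IH2]].
  have mc : measurable_fun (setT : set (mspacetime R)) (planar (fun a b => 2^-1 : R)).
    exact: measurable_cst.
  have bc : bdd (box J) (planar (fun a b => 2^-1 : R)) by exact: bdd_cst.
  have E b : ival 0 1 (fun s => mixed 0 s b ^+ 2) = ival 0 1 (fun=> 2^-1).
    rewrite ival_cst// subr0 mulr1; apply: ival_sin_sqr.
    by have /andP[] := N1 0.
  have [m1J b1J] := m1 J 0; have [m2J b2J] := m2 J 0.
  rewrite (eq_planar_integral1 hJ m1J b1J mc bc)// (eq_planar_integral2 hJ m2J b2J mc bc)//.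
  by rewrite /planar Rintegral_cst.
have [m1J b1J] := m1 J q; have [m2J b2J] := m2 J q.
have [m1S b1S] := m1 J q.+1; have [m2S b2S] := m2 J q.+1.
have E a : ival 0 1 (fun s => mixed q.+1 a s ^+ 2) = ival 0 1 (fun s => mixed q s a ^+ 2).
  under eq_ival do rewrite mixedS//.
  by rewrite (ival_shift _ (@cmix q a))// => s; rewrite pmix.
rewrite (eq_planar_integral2 hJ m1S b1S m2J b2J)//.
by rewrite (eq_planar_integral1 hJ m2S b2S m1J b1J).
Qed.

(** Only even stages are compared, since each stage exchanges the coordinates. The added power tends
    to 0 and makes the sequence monotone. *)
Definition mixing_limit a b : R := limn (fun m => average m.*2 a b + 4^-1 ^+ m.+1).

(** Stages 2 m and 2 m + 1 err by at most 4^-m / 8 and 4^-m / 16; the sum, 3/16 of 4^-m, is exactly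
    the difference of powers on the right. *)
Let average_step2 m a b :
  `|average m.+1.*2 a b - average m.*2 a b| <= 4^-1 ^+ m.+1 - 4^-1 ^+ m.+2.
Proof.
have s1 := average_step N1 d01 sg_end m.*2.+1 a b.
have s2 := average_step N1 d01 sg_end m.*2 b a.
have E : 2^-1 ^+ m.*2 = 4^-1 ^+ m :> R.
  by rewrite -mul2n exprM; congr (_ ^+ m); field.
have e1 := err m.*2.+1; have e2 := err m.*2.
rewrite doubleS -[X in `|X|](subrKA (average m.*2.+1 b a)).
apply: (le_trans (ler_normD _ _)).
apply: (le_trans (lerD (le_trans s1 e1) (le_trans s2 e2))).
by rewrite !exprS E; lra.
Qed.

Lemma mixing_limit_cvg a b : (fun m => average m.*2 a b + 4^-1 ^+ m.+1) @ \oo --> mixing_limit a b.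
Proof.
have [] := @telescoping_limit R (fun m => average m.*2 a b) (fun m => 4^-1 ^+ m.+1).
- by move=> m; exact: average_step2.
- by move=> m; rewrite exprn_ge0.
by [].
Qed.

Lemma mixing_limit_near m a b : `|mixing_limit a b - average m.*2 a b| <= 4^-1 ^+ m.+1.
Proof.
have [] := @telescoping_limit R (fun m => average m.*2 a b) (fun m => 4^-1 ^+ m.+1).
- by move=> k; exact: average_step2.
- by move=> k; rewrite exprn_ge0.
by move=> _; apply.
Qed.

(** The initial average is 0, and all later steps together change it by at most 1/4. *)
Lemma mixing_limit_le a b : `|mixing_limit a b| <= 4^-1.
Proof. by have := mixing_limit_near 0 a b; rewrite average0// subr0 expr1. Qed.

Lemma mixing_limit_measurable : measurable_fun (setT : set (mspacetime R)) (planar mixing_limit).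
Proof.
apply: (@measurable_fun_cvg _ _ _ _ (fun m z => average m.*2 (xcoord z) (ycoord z) + 4^-1 ^+ m.+1)).
  move=> m; apply: measurable_funD; last exact: measurable_cst.
  exact: (planar_measurable (average_lipschitz N1 d01 sg_end m.*2)).
by move=> z _; exact: mixing_limit_cvg.
Qed.

Lemma mixing_limit_period a b (m m' : int) :
  mixing_limit (a + m%:~R) (b + m'%:~R) = mixing_limit a b.
Proof.
rewrite /mixing_limit; congr (limn _); apply/funext => k.
by rewrite average_period.
Qed.

(** If |u| <= 1 and |w| <= 1/4, then u^2 <= |u| <= |u - w| + 1/4. The mean of u^2 is 1/2, because
    the stages preserve the measure, and 1/4 is left. *)
Lemma mixed_far J q : slice_interval J ->
  4^-1 * fine (leb4 R (box J)) <=
  \int[leb4 R]_(z in box J) `|planar (mixed q) z - planar mixing_limit z|.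
Proof.
move=> hJ; have mJ := measurable_box hJ.1.
have [m1J b1J] := m1 J q.
have -> : 4^-1 * fine (leb4 R (box J)) =
    \int[leb4 R]_(z in box J) (planar (fun a b => mixed q a b ^+ 2) z - 4^-1).
  rewrite RintegralB//; last 2 first.
  - exact: box_integrable hJ.1 (slice_interval_lty hJ) _ m1J b1J.
  - exact: box_integrable hJ.1 (slice_interval_lty hJ) _ (measurable_cst _) (bdd_cst _ _).
  by rewrite (mixed_sqr_integral q hJ).1 Rintegral_cst//; lra.
have mD : measurable_fun (setT : set (mspacetime R)) (fun z => planar (mixed q) z - planar mixing_limit z).
  exact: measurable_funB (planar_measurable (lip q)) mixing_limit_measurable.
apply: le_Rintegral => //.
- apply: box_integrable hJ.1 (slice_interval_lty hJ) _ _ _.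
    exact: measurable_funB m1J (measurable_cst _).
  exact: bddB b1J (bdd_cst _ _).
- apply: box_integrable hJ.1 (slice_interval_lty hJ) _ _ _.
    exact: measurableT_comp.
  exists (1 + 4^-1) => z _; rewrite normr_id; apply: (le_trans (ler_normB _ _)).
  by rewrite lerD//; [exact: mixed_le1|exact: mixing_limit_le].
move=> z _; rewrite /planar.
have := mixed_le1 N d sg q (xcoord z) (ycoord z).
have := mixing_limit_le (xcoord z) (ycoord z).
move: (mixed _ _ _) (mixing_limit _ _) => u w w4 u1.
have h : `|u| ^+ 2 <= `|u| by rewrite expr2 ler_piMr.
rewrite real_normK ?num_real// in h.
have := ler_normD (u - w) w; rewrite subrK; lra.
Qed.

(** The difference is below 1/8 off A and at most 5/4 everywhere, hence at most 1/8 plus twice the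
    indicator of A; integration gives 1/4 <= 1/8 + 2 |A|. *)
Lemma mixed_far_set J q : slice_interval J -> leb1 R J = 1%E ->
  let A := box J `&` [set z | 8^-1 <= `|planar (mixed q) z - planar mixing_limit z|] in
  measurable A /\ (16^-1%:E <= leb4 R A)%E.
Proof.
have key (r : R) : 4^-1 <= 8^-1 + 2 * r -> 16^-1 <= r by lra.
move=> hJ J1 A; have mJ := measurable_box hJ.1.
pose g z := `|planar (mixed q) z - planar mixing_limit z|.
have mg : measurable_fun (setT : set (mspacetime R)) g.
  apply: measurableT_comp => //.
  exact: measurable_funB (planar_measurable (lip q)) mixing_limit_measurable.
have mA : measurable A.
  have := mg measurableT `[8^-1, +oo[%classic (measurable_itv _).
  rewrite setTI => mgA; rewrite /A [X in _ `&` X](_ : _ = g @^-1` `[8^-1, +oo[%classic).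
    exact: measurableI.
  by apply/seteqP; split => z /=; rewrite in_itv/= andbT.
split=> //.
have b1 : leb4 R (box J) = 1%E by rewrite leb4_box//; exact: hJ.1.
have Aoo : leb4 R A \is a fin_num.
  rewrite ge0_fin_numE//; apply: (@le_lt_trans _ _ (leb4 R (box J))).
    by apply: le_measure; rewrite ?inE//; exact: subIsetl.
  by rewrite b1 ltry.
have := mixed_far q hJ; rewrite b1 /= mulr1 => far.
rewrite -(fineK Aoo) lee_fin.
pose iA : mspacetime R -> R := indic A.
have mi : measurable_fun (setT : set (mspacetime R)) iA by exact: measurable_indic.
have hb := box_integrable hJ.1 (slice_interval_lty hJ).
have bi c : bdd (box J) (fun z => c * iA z).
  apply: bddM; first exact: bdd_cst.
  by exists 1 => z _; rewrite /iA indicE; case: (_ \in _); rewrite ?normr0 ?normr1.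
have mi2 c : measurable_fun (setT : set (mspacetime R)) (fun z => c * iA z).
  by apply: measurable_funM mi; exact: measurable_cst.
have I : \int[leb4 R]_(z in box J) (8^-1 + 2 * iA z) = 8^-1 + 2 * fine (leb4 R A).
  rewrite RintegralD//; last 2 first.
  - exact: hb (measurable_cst _) (bdd_cst _ _).
  - exact: hb (mi2 _) (bi _).
  rewrite Rintegral_cst// RintegralZl//; last first.
    by have := hb _ (mi2 1) (bi 1); under [X in _ \o X]eq_fun do rewrite mul1r.
  congr (_ + _ * fine _).
    by rewrite -[RHS]mulr1; congr (_ * _); exact: (congr1 fine b1).
  rewrite (integral_indic (leb4 R) mJ mA); congr (leb4 R _).
  by rewrite /A setIAC setIid.
have : \int[leb4 R]_(z in box J) g z <= \int[leb4 R]_(z in box J) (8^-1 + 2 * iA z).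
  have g2 z : g z <= 1 + 4^-1.
    by apply: (le_trans (ler_normB _ _)); rewrite lerD//; [exact: mixed_le1|exact: mixing_limit_le].
  apply: le_Rintegral => //.
  - by apply: hb mg _; exists (1 + 4^-1) => z _; rewrite normr_id; exact: g2.
  - apply: hb; first by apply: measurable_funD; [exact: measurable_cst|exact: mi2].
    by apply: bddD (bi _); exact: bdd_cst.
  move=> z zJ; rewrite /iA indicE; case: (boolP (z \in A)) => zA.
    by have := g2 z; rewrite /= mulr1; lra.
  rewrite /= mulr0 addr0 leNgt; apply/negP => zg; move/negP: zA; apply.
  by rewrite inE; split => //; exact: ltW.
by rewrite I => h; exact: key (le_trans far h).
Qed.

End MixingLimit.

(** * Time schedule and frequencies *)

Section Clock.
Context {R : realType}.

(** The end points of the interval are included: a nonzero derivative there would persist nearby by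
    continuity, against the mean value theorem on a short interval inside [a, b]. *)
Lemma is_derive_constant (g dg : R -> R) (a b x c : R) :
  (forall s : R, is_derive s 1 g (dg s)) -> continuous dg -> a < b -> a <= x <= b ->
  (forall y, a <= y <= b -> g y = c) -> dg x = 0.
Proof.
move=> D cd ab /andP[ax xb] gc; apply: contrapT => /eqP; rewrite -normr_gt0 => e0.
have /cvgrPdist_lt/(_ _ e0) := cd x; rewrite nearE => /nbhs_ballP[/= r r0 hr].
(* The part of [a, b] within r / 2 of x, which is nondegenerate even when x is an end point. *)
pose y := Num.max a (x - r / 2); pose y' := Num.min b (x + r / 2).
have r2 : 0 < r / 2 by rewrite divr_gt0.
have yy' : y < y'.
  have h1 : a < x + r / 2 by lra.
  have h2 : x - r / 2 < b by lra.
  have h3 : x - r / 2 < x + r / 2 by lra.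
  by rewrite /y /y' gt_max !lt_min ab h1 h2.
have [s /andP[ys sy'] E] := is_derive_mvt D (ltW yy').
have dg0 : dg s = 0.
  apply/eqP; have : dg s * (y' - y) == 0.
    rewrite -E !gc ?subrr//.
      by rewrite /y le_max lexx /=; apply: (le_trans (ltW yy')); rewrite /y' ge_min lexx.
    by rewrite [y' <= b]ge_min lexx andbT; apply: (le_trans _ (ltW yy')); rewrite /y le_max lexx.
  by rewrite mulf_eq0 subr_eq0 (gt_eqF yy') orbF.
have := hr s; rewrite dg0 subr0 ltxx => h; apply: notF; apply: h; rewrite -ball_normE /=.
have h1 : x - r / 2 <= s by apply: le_trans ys; rewrite /y le_max lexx orbT.
have h2 : s <= x + r / 2 by apply: (le_trans sy'); rewrite /y' ge_min lexx orbT.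
rewrite ltr_norml; apply/andP; split; lra.
Qed.

Definition idle (g : R -> R) := forall x, x <= 0 \/ 1 <= x -> g x = 0.

Lemma idle_derive (s : R -> R) : smooth_on setT s ->
  (forall x, x <= 0 -> s x = 0) -> (forall x, 1 <= x -> s x = 1) -> idle ('D_(1 : R) s).
Proof.
move=> ss s0 s1 x xx.
have D (y : R) := smooth_is_derive (1 : R) y ss.
have cd := smooth_continuous (smooth_derive (1 : R) ss).
case: xx => hx.
  by apply: (is_derive_constant D cd (a := x - 1) (b := x) (c := 0)); rewrite ?lexx ?andbT; [lra|lra|move=> y /andP[_ yx]; apply: s0; lra].
by apply: (is_derive_constant D cd (a := x) (b := x + 1) (c := 1)); rewrite ?lexx; [lra|lra|move=> y /andP[yx _]; apply: s1; lra].
Qed.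

Lemma idle_derive2 (s : R -> R) : smooth_on setT s -> idle s -> idle ('D_(1 : R) s).
Proof.
move=> ss s0 x xx.
have D (y : R) := smooth_is_derive (1 : R) y ss.
have cd := smooth_continuous (smooth_derive (1 : R) ss).
case: xx => hx.
  by apply: (is_derive_constant D cd (a := x - 1) (b := x) (c := 0)); rewrite ?lexx ?andbT; [lra|lra|move=> y /andP[_ yx]; apply: s0; left; lra].
by apply: (is_derive_constant D cd (a := x) (b := x + 1) (c := 0)); rewrite ?lexx; [lra|lra|move=> y /andP[yx _]; apply: s0; right; lra].
Qed.

Lemma idle_bounded (g : R -> R) : continuous g -> idle g -> exists2 C, 0 <= C & forall x, `|g x| <= C.
Proof.
move=> cg g0; have [||c _ hc] := @EVT_max R (fun x => `|g x|) 0 1; first exact: ler01.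
  by apply: continuous_subspaceT => x; apply: (@continuous_comp _ _ _ g (fun y : R => `|y|)); [exact: cg|exact: norm_continuous].
exists `|g c| => // x; have [x0|x0] := leP x 0; first by rewrite g0 ?normr0//; left.
have [x1|x1] := leP 1 x; first by rewrite g0 ?normr0//; right.
by apply: hc; rewrite in_itv /= !ltW.
Qed.

(** The affine map, of slope (k + 1)(k + 2), that carries the time interval of stage k onto
    [0, 1]. *)
Definition phase (k : nat) (t : R) : R := k.+2%:R * (k.+1%:R * t - k%:R).

Lemma phase_order j k t : (j < k)%N -> phase k t <= 0 \/ 1 <= phase j t.
Proof.
rewrite /phase -(ler_nat R) -!natr1; move: (j%:R) (k%:R) (ler0n R j) (ler0n R k) => u w u0 w0 uw.
have [h|h] := leP ((w + 1) * t - w) 0; [left|right].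
  by rewrite mulr_ge0_le0// !addr_ge0.
have [t1|t1] := leP 1 t; first by nra.
have h2 : (u + 1 + 1) * (1 - t) <= (w + 1) * (1 - t) by rewrite ler_wpM2r//; lra.
nra.
Qed.

Lemma phase_late k t : 1 <= t -> 1 <= phase k t.
Proof.
rewrite /phase -!natr1; move: (k%:R) (ler0n R k) => u u0 t1; nra.
Qed.

Lemma phase_early t : t < 1 -> exists k, forall j, (k <= j)%N -> phase j t <= 0.
Proof.
move=> t1; have [k hk] : exists k : nat, (1 - t)^-1 <= k%:R.
  by exists (Num.truncn (1 - t)^-1).+1; apply: ltW; apply: truncnS_gt.
exists k => j kj; rewrite /phase mulr_ge0_le0// -natr1.
have h : (1 - t)^-1 <= j%:R + 1 by rewrite (le_trans hk)// natr1 ler_nat ltnW.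
have : 1 <= (j%:R + 1) * (1 - t) by rewrite -ler_pdivrMr ?subr_gt0// mul1r.
move: (j%:R) => u; lra.
Qed.

Lemma phase_idle t : exists k, forall j, (k <= j)%N -> phase j t <= 0 \/ 1 <= phase j t.
Proof.
have [t1|t1] := ltP t 1.
  by have [k hk] := phase_early t1; exists k => j /hk; left.
by exists 0%N => j _; right; exact: phase_late.
Qed.

Lemma phase0 k : phase k 0 <= 0.
Proof. by rewrite /phase mulr0 sub0r mulr_ge0_le0// oppr_le0. Qed.

Lemma is_derive_phase k (t : R) : is_derive t 1 (phase k) (k.+2%:R * k.+1%:R).
Proof.
have := is_derive_mulf (is_derive_cst (k.+2%:R : R) t (1 : R)) (is_derive_addf
  (is_derive_mulf (is_derive_cst (k.+1%:R : R) t (1 : R)) (is_derive_id t (1 : R)))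
  (is_derive_cst (- k%:R : R) t (1 : R))).
by move/is_derive_eq; apply; rewrite /cst !mulr0 !addr0 mulr1.
Qed.

Lemma smooth_phase k : smooth_on setT (phase k).
Proof.
apply: smoothM; first exact: smooth_cst.
by apply: smoothB; [apply: smoothM; [exact: smooth_cst|exact: smooth_id]|exact: smooth_cst].
Qed.

End Clock.

Section HolderSeries.
Context {R : realType} {V : normedModType R}.
Variables (D : set V) (a C : R) (u : nat -> V -> R).
Hypothesis C0 : 0 <= C.
Hypothesis step : forall m, holder_le D a (fun z => u m.+1 z - u m z) (C * 4^-1 ^+ m).

(** The subtracted power closes the induction: a step of size C 4^-j is below 2 C (4^-j - 4^-(j+1)),
    which is 3/2 C 4^-j. *)
Lemma holder_le_series m i :
  holder_le D a (fun z => u (m + i)%N z - u m z) (2 * C * (4^-1 ^+ m - 4^-1 ^+ (m + i))).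
Proof.
elim: i => [|i IH].
  by rewrite addn0 subrr mulr0; split=> [z _|z w _ _]; rewrite !subrr normr0 ?mul0r.
have := holder_leD IH (step (m + i)); rewrite -addnS.
set c := (X in holder_le _ _ _ X -> _); set c' := (X in _ -> holder_le _ _ _ X).
move=> h; have {}h : holder_le D a (fun z => u (m + i.+1)%N z - u m z) c.
  by move: h; congr holder_le; apply/funext => z; rewrite addnS; ring.
apply: holder_leW h; rewrite /c /c' addnS [4^-1 ^+ (m + i).+1]exprS.
have q4 : 0 <= 4^-1 :> R by lra.
have := mulr_ge0 C0 (exprn_ge0 (m + i) q4).
move: (4^-1 ^+ m) (4^-1 ^+ (m + i)) => x y; nra.
Qed.

Lemma holder_le_limit m g : (forall z, D z -> u^~ z @ \oo --> g z) ->
  holder_le D a (fun z => g z - u m z) (2 * C * 4^-1 ^+ m).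
Proof.
move=> ug; apply: (@holder_le_cvg _ _ _ _ (fun i z => u (m + i)%N z - u m z)).
  move=> i; apply: holder_leW (holder_le_series m i).
  rewrite ler_wpM2l ?mulr_ge0// lerBlDr lerDl exprn_ge0//.
move=> z Dz; apply: cvgB; last exact: cvg_cst.
have -> : (fun i => u (m + i)%N z) = (fun i => u (i + m)%N z).
  by apply/funext => i; rewrite addnC.
by have := ug z Dz; rewrite -(cvg_shiftn m).
Qed.

End HolderSeries.

Section AlternateBounds.
Context {R : realType}.
Variables (w : nat -> R -> R -> R).

Lemma alternate_double m t a : alternate w m.+1.*2 t a =
  ((alternate w m.*2 t a).1 - w m.*2 t a, (alternate w m.*2 t a).2 - w m.*2.+1 t a).
Proof. by []. Qed.

Lemma alternate_le q t a C : 0 <= C -> (forall k, `|w k t a| <= C * 2^-1 ^+ k) ->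
  `|(alternate w q t a).1| <= 2 * C /\ `|(alternate w q t a).2| <= 2 * C.
Proof.
move=> C0 hw.
(* The slack 2^-q absorbs exactly the term C 2^-q that stage q adds. *)
suff [h1 h2] : `|(alternate w q t a).1| <= 2 * C * (1 - 2^-1 ^+ q) /\
    `|(alternate w q t a).2| <= 2 * C * (1 - 2^-1 ^+ q).
  have h : 2 * C * (1 - 2^-1 ^+ q) <= 2 * C.
    by rewrite ler_piMr ?mulr_ge0// lerBlDr lerDl exprn_ge0.
  by split; [exact: le_trans h1 h|exact: le_trans h2 h].
elim: q => [|q [IH1 IH2]] /=; first by rewrite normr0 expr0 subrr mulr0.
have h2 : 0 <= 2^-1 :> R by lra.
have C2 := mulr_ge0 C0 (exprn_ge0 q h2).
rewrite exprS; split; first by apply: (le_trans IH2); nra.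
apply: (le_trans (ler_normB _ _)); apply: (le_trans (lerD IH1 (hw q))); lra.
Qed.

End AlternateBounds.

(** * Choice of the frequencies *)

Section Frequencies.
Context {R : realType}.

(** Consecutive ratios are 2^(4 (k + K) + 2). The offset K starts the sequence where the quadratic
    exponent dominates all losses that are exponential in k. *)
Definition frequency (K k : nat) : nat := (2 ^ (2 * (k + K) ^ 2))%N.

(** Equal to the bound used for n_k / n_(k+1): rounding the corners of the triangular wave is
    allowed as large an error as the finite separation of scales. *)
Definition defect (k : nat) : R := 2^-1 ^+ (3 * k + 7).

Definition clock (s : R -> R) (k : nat) (t : R) : R := s (phase k t).

Definition clock_rate (k : nat) : R := k.+2%:R * k.+1%:R.

Lemma frequencyS K k : frequency K k.+1 = (frequency K k * 2 ^ (4 * (k + K) + 2))%N.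
Proof.
rewrite /frequency -expnD; congr (2 ^ _)%N; rewrite addSn.
by move: (k + K)%N => j; rewrite -!mulnn; nia.
Qed.

Lemma frequency_ndecr K k : (0 < frequency K k <= frequency K k.+1)%N.
Proof. by rewrite expn_gt0 /= frequencyS leq_pmulr// expn_gt0. Qed.

Lemma defect01 k : 0 < defect k < 2^-1.
Proof.
rewrite /defect exprn_gt0 ?invr_gt0//= (_ : 3 * k + 7 = (3 * k + 6).+1)%N; last by lia.
rewrite exprS -[ltRHS]mulr1 ltr_pM2l ?invr_gt0// exprn_ilt1 ?invr_ge0// ?addnS//.
by rewrite invf_lt1// ltr1n.
Qed.

Lemma frequency_ratio K k : (2 <= K)%N ->
  (frequency K k)%:R / (frequency K k.+1)%:R <= 2^-1 ^+ (3 * k + 7) :> R.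
Proof.
move=> K2; rewrite frequencyS natrM invfM mulrA mulfV ?mul1r; last first.
  by rewrite pnatr_eq0 -lt0n; have /andP[] := frequency_ndecr K k.
rewrite natrX exprVn lef_pV2 ?posrE ?exprn_gt0//; apply: ler_weXn2l; first by rewrite ler1n.
lia.
Qed.

(** After raising 3^q to 4^q the powers of 2 match exactly: 3 + 2 q + 1 - (3 q + 7) = - (q + 3). *)
Lemma mixing_error K q : (2 <= K)%N ->
  8 * 3 ^+ q * ((frequency K q)%:R / (frequency K q.+1)%:R + defect q) <= 2^-1 ^+ q.+3 :> R.
Proof.
move=> K2; apply: (@le_trans _ _ (8 * 4 ^+ q * (2^-1 ^+ (3 * q + 7) + 2^-1 ^+ (3 * q + 7)))).
  apply: ler_pM => //.
  - by rewrite addr_ge0// ?divr_ge0// ltW//; have /andP[] := defect01 q.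
  - by rewrite ler_wpM2l// lerXn2r ?nnegrE// ler_nat.
  - by rewrite lerD2r frequency_ratio.
rewrite le_eqVlt; apply/orP; left; apply/eqP.
have -> : 4 ^+ q = 2 ^+ q * 2 ^+ q :> R by rewrite -exprMn; congr (_ ^+ q); ring.
have -> : (3 * q + 7 = q + (q + (q + 7)))%N by lia.
have e : 2 ^+ q != 0 :> R by rewrite expf_neq0.
by rewrite !exprS !exprD !exprVn; move: (2 ^+ q) e => x e; field.
Qed.

Lemma smooth_clock s k : smooth_on setT s -> smooth_on setT (clock s k).
Proof. by move=> ss; apply: smooth_comp => //; exact: smooth_phase. Qed.

Lemma derive_clock s k c t : smooth_on setT s ->
  'D_(1 : R) (fun t => c * clock s k t) t = c * clock_rate k * clock ('D_(1 : R) s) k t.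
Proof.
move=> ss; rewrite (smooth_deriveZ _ _ _ (smooth_clock k ss)).
rewrite (derive_comp1 _ _ ss (smooth_phase k)) -mulrA; congr (_ * _).
by have [_ ->] := is_derive_phase k t; rewrite mulrC.
Qed.

Lemma derive_clock1 s k t : smooth_on setT s ->
  'D_(1 : R) (clock s k) t = clock_rate k * clock ('D_(1 : R) s) k t.
Proof.
move=> ss; have e : (fun t => 1 * clock s k t) = clock s k by apply/funext => r; rewrite mul1r.
by have := derive_clock k 1 t ss; rewrite e mul1r.
Qed.

Lemma clock_rate_le k : 1 <= clock_rate k <= 2 ^+ (2 * k + 1).
Proof.
rewrite /clock_rate -natrM -natrX ler1n muln_gt0/= ler_nat addn1 expnS.
have h : (k.+1 <= 2 ^ k)%N by exact: ltn_expl.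
have h2 : (2 ^ (2 * k) = 2 ^ k * 2 ^ k)%N by rewrite -expnD; congr (2 ^ _)%N; lia.
rewrite h2 mulnA leq_mul//; apply: (@leq_trans (2 * k.+1)); first by lia.
by rewrite leq_mul2l.
Qed.

Lemma frequency_large K k : (2 <= K)%N -> 2 ^+ (3 * k + 1) <= (frequency K k)%:R :> R.
Proof.
move=> K2; rewrite natrX; apply: ler_weXn2l; first by rewrite ler1n.
have : (k + 2 <= k + K)%N by rewrite leq_add2l.
move: (k + K)%N => j; rewrite -mulnn; nia.
Qed.

(** In logarithms to base 2, with j = k + K, the claim reads 2 (1 - alpha) j^2 >= 4 alpha (j + 1) +
    7 k - 4. The hypothesis on K makes the left side at least 11 j, of which 4 j pays for the
    passage from n_k to n_(k+1) and 7 j for the factor 2^(7 k). *)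
Lemma frequency_holder (alpha : R) K k : 0 < alpha < 1 -> (2 <= K)%N ->
  11 <= 2 * (1 - alpha) * K%:R ->
  (4 * (frequency K k.+1)%:R) `^ alpha * 2 ^+ (7 * k + 4) <= 2 ^+ 8 * (frequency K k)%:R.
Proof.
move=> /andP[a0 a1] K2 hK.
have -> : 4 * (frequency K k.+1)%:R = 2 `^ (2 * (k.+1 + K) ^ 2 + 2)%:R :> R.
  by rewrite powR_mulrn// exprD natrX mulrC; congr (_ * _); ring.
rewrite -powRrM -[2 ^+ (7 * k + 4)]powR_mulrn// -powRD; last by rewrite pnatr_eq0 implybT.
have -> : 2 ^+ 8 * (frequency K k)%:R = 2 `^ (8 + 2 * (k + K) ^ 2)%:R :> R.
  by rewrite powR_mulrn// exprD natrX.
rewrite ler_powR ?ler1n// -!mulnn addSn !natrD !natrM -!natr1 !natrD.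
have := ler0n R k; have : 2 <= K%:R :> R by rewrite ler_nat.
move: (k%:R) (K%:R) hK => u w hw w2 u0.
have h : 11 * (u + w) <= 2 * (1 - alpha) * (u + w) * (u + w) by nra.
nra.
Qed.

Lemma clock_rate_cube k : clock_rate k ^+ 3 <= 2 ^+ (6 * k + 3).
Proof.
have /andP[c1 c2] := clock_rate_le k.
have -> : (6 * k + 3 = (2 * k + 1) * 3)%N by lia.
by rewrite exprM lerXn2r ?nnegrE ?exprn_ge0// (le_trans _ c1).
Qed.

(** The exponent splits as 7 k + 4 = 1 + (6 k + 3) + k: the factor 2, the cube of the clock rate,
    and the decay 2^-k to be gained. *)
Lemma stage_amplitude (alpha : R) K k : 0 < alpha < 1 -> (2 <= K)%N ->
  11 <= 2 * (1 - alpha) * K%:R ->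
  2 * clock_rate k ^+ 3 * (4 * (frequency K k.+1)%:R) `^ alpha / (frequency K k)%:R
  <= 2 ^+ 8 * 2^-1 ^+ k.
Proof.
move=> ha K2 hK; have hP := frequency_holder k ha K2 hK.
have n0 : 0 < (frequency K k)%:R :> R by rewrite ltr0n; have /andP[] := frequency_ndecr K k.
rewrite ler_pdivrMr// -[leRHS]mulrA [_ * (frequency K k)%:R]mulrC [leRHS]mulrA.
rewrite exprVn ler_pdivlMr ?exprn_gt0//; apply: le_trans hP.
have -> : (7 * k + 4 = 1 + (6 * k + 3) + k)%N by lia.
rewrite [2 ^+ (_ + k)]exprD mulrA ler_wpM2r ?exprn_ge0// [leRHS]mulrC ler_wpM2r ?powR_ge0//.
by rewrite exprD expr1 ler_wpM2l// clock_rate_cube.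
Qed.

End Frequencies.

Lemma amplitude_le {R : realType} (a x y C : R) : 0 <= a -> `|x| <= C -> `|y| <= 1 ->
  `|a * x * y| <= a * C.
Proof.
move=> a0 xC y1; rewrite !normrM (ger0_norm a0) -mulrA ler_wpM2l//.
by rewrite -[C]mulr1 ler_pM.
Qed.

(** * Size and regularity of the stages *)

Section Stages.
Context {R : realType}.
Variables (K : nat) (s : R -> R).
Hypothesis K2 : (2 <= K)%N.
Hypothesis ss : smooth_on setT s.
Hypothesis s0 : forall x, x <= 0 -> s x = 0.
Hypothesis s1 : forall x, 1 <= x -> s x = 1.

Definition waves k : R -> R := profile (defect k).
Local Notation N := (frequency K).
Local Notation sg := (clock s).
Let n k : R := (N k)%:R.
Let ds : R -> R := 'D_(1 : R) s.
Let dds : R -> R := 'D_(1 : R) ds.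
Let sds : smooth_on setT ds. Proof. exact: smooth_derive. Qed.
Let sdds : smooth_on setT dds. Proof. exact: smooth_derive. Qed.
Let ids : idle ds. Proof. exact: idle_derive. Qed.
Let idds : idle dds. Proof. exact: idle_derive2. Qed.

Let n_gt0 k : 0 < n k. Proof. by rewrite ltr0n; have /andP[] := frequency_ndecr K k. Qed.

Lemma smooth_waves k : smooth_on setT (waves k).
Proof. exact: smooth_profile (defect01 k). Qed.

Lemma waves_periodic k (x : R) : waves k (x + 1) = waves k x.
Proof. exact: profile_periodic. Qed.

Lemma waves_le1 k (x : R) : `|waves k x| <= 1.
Proof. by have /andP[h0 h1] := profile_range (defect01 k) x; rewrite ger0_norm. Qed.

Lemma clock_end k (t : R) : 1 <= t -> sg k t = 1.
Proof. by move=> t1; apply: s1; exact: phase_late. Qed.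

Lemma derive_clock_idle k (t : R) : phase k t <= 0 \/ 1 <= phase k t -> 'D_(1 : R) (sg k) t = 0.
Proof. by move=> h; rewrite derive_clock1// [X in _ * X](ids h) mulr0. Qed.

Lemma clock_start k (t : R) : sg k t = 0 \/ forall j, (j < k)%N -> 'D_(1 : R) (sg j) t = 0.
Proof.
have [h|h] := leP (phase k t) 0; first by left; exact: s0.
right=> j jk; apply: derive_clock_idle; right.
by have [h'|//] := phase_order t jk; move: (lt_le_trans h h'); rewrite ltxx.
Qed.

Lemma clock_disjoint j k (t : R) : j <> k ->
  'D_(1 : R) (sg j) t = 0 \/ 'D_(1 : R) (sg k) t = 0.
Proof.
move=> /eqP; rewrite neq_ltn => /orP[] /(phase_order t)[h|h].
- by right; apply: derive_clock_idle; left.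
- by left; apply: derive_clock_idle; right.
- by left; apply: derive_clock_idle; left.
- by right; apply: derive_clock_idle; right.
Qed.

Local Notation velocity := (stage_velocity N waves sg).

Definition stage_acceleration k (t a : R) : R :=
  (n k)^-1 * (clock_rate k * clock_rate k) * clock dds k t * waves k (n k.+1 * a).

Lemma velocityE k t a : velocity k t a =
  (n k)^-1 * (clock_rate k * clock ds k t) * waves k (n k.+1 * a).
Proof. by rewrite /stage_velocity derive_clock1. Qed.

Lemma velocity_idle k t a : phase k t <= 0 \/ 1 <= phase k t -> velocity k t a = 0.
Proof. by move=> h; rewrite velocityE [clock ds k t](ids h) !mulr0 mul0r. Qed.

Lemma acceleration_idle k t a : phase k t <= 0 \/ 1 <= phase k t -> stage_acceleration k t a = 0.
Proof. by move=> h; rewrite /stage_acceleration [clock dds k t](idds h) mulr0 mul0r. Qed.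

Lemma Dt_velocity k (b : spacetime R -> R) z : smooth_on setT b -> Dt b z = 0 ->
  Dt (fun z => velocity k (tcoord z) (b z)) z = stage_acceleration k (tcoord z) (b z).
Proof.
move=> sb Db.
have sC : smooth_on setT (fun t => (n k)^-1 * (clock_rate k * clock ds k t)).
  by apply: smooth_scale; apply: smooth_scale; exact: smooth_clock.
have sW : smooth_on setT (fun a => waves k (n k.+1 * a)).
  by apply: smooth_comp (smooth_waves k) _; apply: smooth_scale; exact: smooth_id.
have -> : (fun z => velocity k (tcoord z) (b z)) =
    fun z => (n k)^-1 * (clock_rate k * clock ds k (tcoord z)) * waves k (n k.+1 * b z).
  by apply/funext => w; rewrite velocityE.
rewrite /Dt (smooth_deriveM _ _ (smooth_comp sC smooth_tcoord) (smooth_comp sW sb)).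
rewrite (derive_comp1 _ _ sC smooth_tcoord) (derive_comp1 _ _ sW sb).
rewrite -/(Dt b z) Db !mulr0 add0r -/(Dt tcoord z) [Dt tcoord z]derive_linear// mulr1.
rewrite (smooth_deriveZ _ _ _ (smooth_scale _ (smooth_clock k sds))) (derive_clock k _ _ sds).
rewrite mulrC /stage_acceleration -/dds; congr (_ * _).
by move: (clock_rate k) (clock _ _ _) (n k)^-1 => *; ring.
Qed.

Lemma Dt_alternate q (b : spacetime R -> R) z : smooth_on setT b -> Dt b z = 0 ->
  Dt (fun z => (alternate velocity q (tcoord z) (b z)).1) z =
    (alternate stage_acceleration q (tcoord z) (b z)).1 /\
  Dt (fun z => (alternate velocity q (tcoord z) (b z)).2) z =
    (alternate stage_acceleration q (tcoord z) (b z)).2.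
Proof.
move=> sb Db; elim: q => [|q [IH1 IH2]] /=.
  by rewrite /Dt; split; apply: derive_const_line.
split=> //.
have [h1 h2] := smooth_pr N smooth_waves (fun k => smooth_clock k ss) q smooth_tcoord sb.
rewrite -IH1 -(Dt_velocity q sb Db) /Dt smooth_deriveB//.
by apply: (smooth_velocity N smooth_waves (fun k => smooth_clock k ss) q smooth_tcoord sb).
Qed.

Lemma xcoord_Dt (z : spacetime R) : Dt xcoord z = 0.
Proof. by rewrite /Dt derive_linear. Qed.

Lemma ycoord_Dt (z : spacetime R) : Dt ycoord z = 0.
Proof. by rewrite /Dt derive_linear. Qed.

Lemma euler_forceE q z : euler_force N waves sg q z = \row_j
  match val j with
  | 0%N => (alternate stage_acceleration q (tcoord z) (ycoord z)).1
  | 1%N => (alternate stage_acceleration q (tcoord z) (xcoord z)).2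
  | _ => 0
  end.
Proof.
apply/rowP => -[[|[|[|//]]] h]; rewrite !mxE//=.
  by rewrite flow0E; have [-> _] := Dt_alternate q smooth_ycoord (ycoord_Dt z).
by rewrite flow1E; have [_ ->] := Dt_alternate q smooth_xcoord (xcoord_Dt z).
Qed.

(** The derivatives of s are continuous and vanish outside ]0, 1[. Three of them occur: in the
    velocity, in the force, and in the Lipschitz constant of the force in time. *)
Lemma stage_bounds : exists2 C, 1 <= C & forall x,
  [/\ `|ds x| <= C, `|dds x| <= C & `|'D_(1 : R) dds x| <= C].
Proof.
have [C1 C10 h1] := idle_bounded (smooth_continuous sds) ids.
have [C2 C20 h2] := idle_bounded (smooth_continuous sdds) idds.
have [C3 C30 h3] := idle_bounded (smooth_continuous (smooth_derive (1 : R) sdds)) (idle_derive2 sdds idds).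
exists (C1 + C2 + C3 + 1); first by lra.
by move=> x; split; [apply: (le_trans (h1 x))|apply: (le_trans (h2 x))|apply: (le_trans (h3 x))]; lra.
Qed.

Variables (C : R) (C1 : 1 <= C).
Hypothesis hC : forall x, [/\ `|ds x| <= C, `|dds x| <= C & `|'D_(1 : R) dds x| <= C].

Let c0 k : 0 <= clock_rate k :> R. Proof. by rewrite mulr_ge0. Qed.

Lemma velocity_le k t a : `|velocity k t a| <= C * 2^-1 ^+ k.
Proof.
have C0 : 0 <= C by exact: le_trans C1.
have [h _ _] := hC (phase k t); rewrite velocityE mulrA.
have a0 : 0 <= (n k)^-1 * clock_rate k by rewrite mulr_ge0// invr_ge0 ltW.
apply: (le_trans (amplitude_le a0 h (waves_le1 _ _))); rewrite mulrC ler_wpM2l//.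
rewrite mulrC ler_pdivrMr//.
have /andP[_ hr] := @clock_rate_le R k; have hl := @frequency_large R _ k K2.
apply: (le_trans hr); apply: le_trans (ler_wpM2l _ hl); last first.
  by rewrite exprn_ge0// invr_ge0.
have -> : (3 * k + 1 = k + (2 * k + 1))%N by lia.
by rewrite exprVn [2 ^+ (k + _)]exprD mulKf// expf_neq0.
Qed.

(** Interpolation between the amplitude S and the Lipschitz constant 4 n_(k+1) S. Two clock rates in
    S come from the acceleration itself; the third pays for its Lipschitz constant in time. *)
Lemma acceleration_holder alpha k (b : spacetime R -> R) :
  0 < alpha < 1 -> 11 <= 2 * (1 - alpha) * K%:R ->
  (forall z w, `|b z - b w| <= `|z - w|) ->
  holder_le (@strip R) alpha (fun z => stage_acceleration k (tcoord z) (b z))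
    (2 ^+ 8 * C * 2^-1 ^+ k).
Proof.
move=> ha hK bL; have C0 : 0 <= C by exact: le_trans C1.
have /andP[c1 c2] := @clock_rate_le R k.
pose S := C * clock_rate k ^+ 3 / n k.
have S0 : 0 <= S by rewrite mulr_ge0 ?invr_ge0 ?(ltW (n_gt0 k))// mulr_ge0// exprn_ge0.
have nn : 1 <= n k.+1 by rewrite ler1n; have /andP[] := frequency_ndecr K k.+1.
have i0 : 0 <= (n k)^-1 by rewrite invr_ge0 ltW.
pose A := (n k)^-1 * (clock_rate k * clock_rate k).
have A0 : 0 <= A by rewrite mulr_ge0// mulr_ge0.
have AS : A * C <= S.
  have -> : S = A * C * clock_rate k by rewrite /A /S; move: (clock_rate k) (n k)^-1 => *; ring.
  by rewrite ler_peMr// mulr_ge0.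
have H : holder_le (@strip R) alpha (fun z => stage_acceleration k (tcoord z) (b z))
    (2 * S * (4 * n k.+1) `^ alpha).
  apply: holder_le_lipschitz => //; first by lra.
    move=> z _; have [_ h _] := hC (phase k (tcoord z)).
    apply: (le_trans (amplitude_le A0 h (waves_le1 _ _))); exact: AS.
  move=> z w _ _; set X := clock dds k; set Y := waves k.
  have -> : stage_acceleration k (tcoord z) (b z) - stage_acceleration k (tcoord w) (b w) =
      A * (X (tcoord z) - X (tcoord w)) * Y (n k.+1 * b z) +
      A * X (tcoord w) * (Y (n k.+1 * b z) - Y (n k.+1 * b w)).
    by rewrite /stage_acceleration -/X -/Y -/A; move: (X _) (X _) (Y _) (Y _) => *; ring.
  have hX : `|X (tcoord z) - X (tcoord w)| <= C * clock_rate k * `|z - w|.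
    have D (t : R) : is_derive t 1 X (clock_rate k * clock ('D_(1 : R) dds) k t).
      have := smooth_is_derive (1 : R) t (smooth_clock k sdds).
      by move/is_derive_eq; apply; exact: derive_clock1.
    apply: le_trans (is_derive_lipschitz (L := C * clock_rate k) D _ _ _) _.
      move=> t; have [_ _ h] := hC (phase k t).
      by rewrite normrM (ger0_norm (c0 k)) mulrC ler_wpM2r.
    by rewrite ler_wpM2l ?mulr_ge0//; exact: ler_norm_pair1 (z - w).
  have hY : `|Y (n k.+1 * b z) - Y (n k.+1 * b w)| <= 2 * n k.+1 * `|z - w|.
    apply: (le_trans (profile_lipschitz (defect01 k) _ _)).
    rewrite -mulrBr normrM ger0_norm// mulrA ler_wpM2l ?mulr_ge0//; exact: bL.
  apply: (le_trans (ler_normD _ _)).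
  have h1 := amplitude_le A0 hX (waves_le1 k (n k.+1 * b z)).
  have [_ h _] := hC (phase k (tcoord w)).
  have h2 : `|A * X (tcoord w) * (Y (n k.+1 * b z) - Y (n k.+1 * b w))| <=
      A * C * (2 * n k.+1 * `|z - w|).
    rewrite normrM ler_pM// normrM (ger0_norm A0) ler_wpM2l//.
  apply: (le_trans (lerD h1 h2)).
  have -> : A * (C * clock_rate k * `|z - w|) = S * `|z - w|.
    by rewrite /A /S; move: (clock_rate k) (n k)^-1 => *; ring.
  move: AS S0 nn (normr_ge0 (z - w)) => + + + {}; move: (A * C) S (n k.+1) `|z - w|.
  move=> u v m e uv v0 m1 e0; have := ler_wpM2r e0 uv => h3.
  have h4 : 2 * m * (u * e) <= 2 * m * (v * e) by rewrite ler_wpM2l//; lra.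
  have h6 : 0 <= v * e by exact: mulr_ge0.
  have h5 : v * e <= m * (v * e) by rewrite ler_peMl.
  lra.
apply: holder_leW H.
have -> : 2 * S * (4 * n k.+1) `^ alpha =
   C * (2 * clock_rate k ^+ 3 * (4 * n k.+1) `^ alpha / n k).
  by rewrite /S; move: (clock_rate k) (n k)^-1 (_ `^ _) => *; ring.
rewrite [2 ^+ 8 * C]mulrC -[C * _ * _]mulrA ler_wpM2l//; exact: stage_amplitude.
Qed.

End Stages.

(** * Passage to the limit *)

Lemma bdd_cvg_Rintegral {R : realType} {d : measure_display} {T : measurableType d}
    (mu : {measure set T -> \bar R}) (D : set T) (h : nat -> T -> R) (g : T -> R) C :
  measurable D -> (mu D < +oo)%E -> (forall m, measurable_fun D (h m)) ->
  (forall m x, D x -> `|h m x| <= C) -> (forall x, D x -> h ^~ x @ \oo --> g x) ->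
  (fun m => \int[mu]_(x in D) h m x) @ \oo --> \int[mu]_(x in D) g x.
Proof.
move=> mD Doo mh hC hg.
have mg : measurable_fun D g by exact: measurable_fun_cvg mh hg.
have ic : mu.-integrable D (EFin \o (fun=> C)).
  by apply: bdd_integrable => //; exact: bdd_cst.
have [] := @dominated_convergence _ _ _ mu D mD (fun m => EFin \o h m) (EFin \o g) (EFin \o (fun=> C)).
- by move=> m; exact/measurable_EFinP.
- exact/measurable_EFinP.
- by apply: aeW => x Dx; apply: cvg_EFin; [exact: nearW|exact: hg].
- exact: ic.
- by apply: aeW => x m Dx; rewrite lee_fin; exact: hC.
move=> ig _ H; apply: fine_cvg; rewrite fineK//.
by apply: integrable_fin_num ig.
Qed.

Lemma stable_cvg {R : realType} (u : nat -> R) k : (forall m, (k <= m)%N -> u m.+1 = u m) ->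
  u @ \oo --> limn u.
Proof.
move=> h; have c : u @ \oo --> u k.
  apply: cvg_near_cst; exists k => // m /= km.
  by rewrite -(subnKC km); elim: (m - k)%N => [|i IH]; rewrite ?addn0// addnS h ?leq_addr.
by rewrite (cvg_lim _ c).
Qed.

(** Two stages at rest exchange the coordinates twice and so have no effect. *)
Lemma alternate_stable {R : realType} (w : nat -> R -> R -> R) k m t a :
  (forall j, (k <= j)%N -> w j t a = 0) -> (k <= m.*2)%N ->
  alternate w m.+1.*2 t a = alternate w m.*2 t a.
Proof.
move=> h km; rewrite alternate_double !h ?subr0//; last exact: leqW.
by case: (alternate _ _ _ _).
Qed.

Lemma back_stable {R : realType} (N : nat -> nat) (f sg : nat -> R -> R) k m t ab :
  (forall j, (k <= j)%N -> sg j t = 0) -> (k <= m.*2)%N ->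
  back N f sg m.+1.*2 t ab = back N f sg m.*2 t ab.
Proof.
move=> h km; rewrite doubleS /= /shear /= (h _ km) (h _ (leqW km)).
by rewrite !mulr0 !mul0r !addr0; case: ab.
Qed.

Section SlabSplit.
Context {R : realType}.

Definition early : set (measurableTypeR R) := `]0%R, 1%R[%classic.
Definition late : set (measurableTypeR R) := `[1%R, 2%R[%classic.

Lemma early_interval : slice_interval early.
Proof.
split; first exact: measurable_itv.
by move=> t; rewrite /early /= !in_itv /= => /andP[t0 t1]; apply/andP; split; lra.
Qed.

Lemma late_interval : slice_interval late.
Proof.
split; first exact: measurable_itv.
by move=> t; rewrite /late /= !in_itv /= => /andP[t0 t1]; apply/andP; split; lra.
Qed.

Lemma leb1_late : leb1 R late = 1%E.
Proof. rewrite /late leb1_itv ?ler1n// (_ : 2 - 1 = 1)//; ring. Qed.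

Lemma slab_split : @slab R 2 = box early `|` box late.
Proof.
apply/seteqP; split => -[t x]; rewrite /slab /box /early /late /= !in_itv /=.
  move=> [/andP[t0 t2] xc]; have [t1|t1] := ltP t 1; [left|right]; split=> //.
    by rewrite t0.
by move=> [[/andP[t0 t1] xc]|[/andP[t0 t1] xc]]; split=> //; apply/andP; split; lra.
Qed.

Lemma slab_integral_split (g : spacetime R -> R) :
  measurable_fun (setT : set (mspacetime R)) g -> bdd (@slab R 2) g ->
  \int[leb4 R]_(z in @slab R 2) g z =
  \int[leb4 R]_(z in box early) g z + \int[leb4 R]_(z in box late) g z.
Proof.
move=> mg bg; rewrite slab_split; apply: Rintegral_setU.
- exact: measurable_box early_interval.1.
- exact: measurable_box late_interval.1.
- rewrite -slab_split; apply: bdd_integrable bg.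
  + exact: measurable_slab.
  + by rewrite (le_lt_trans leb4_slab2_le)// ltry.
  + exact: measurable_funTS.
apply/disj_setPS => -[t x]; rewrite /early /late /box /= !in_itv /=.
by move=> [[/andP[_ t1] _] [/andP[t1' _] _]]; move: (lt_le_trans t1 t1'); rewrite ltxx.
Qed.

(** Integration along z first. This removes the square of the third component, the one quadratic
    term for which weak convergence would not suffice. *)
Lemma vertical_integral (h phi : spacetime R -> R) :
  measurable_fun (setT : set (mspacetime R)) h -> bdd (@slab R 2) h ->
  (forall t x s, h (t, set_coord (inord 2) s x) = h (t, x)) -> smooth_periodic phi ->
  \int[leb4 R]_(z in @slab R 2) (h z * Dx (inord 2) phi z) = 0.
Proof.
move=> mh bh hz hphi; have hJ := @time_slab R 2 _.
rewrite slab_box; have {}hJ : slice_interval (`]0%R, 2%R[%classic : set (measurableTypeR R)).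
  by apply: hJ; rewrite ler0n lexx.
have [sD pD] := sp_Dx (inord 2) hphi.
rewrite (@eq_box_integral _ _ hJ.1 (slice_interval_lty hJ) (inord 2) _ (fun=> 0)).
- by rewrite /Rintegral integral0.
- by apply: measurable_funM => //; exact: smooth_measurable.
- exact: measurable_cst.
- by apply: bddM; [exact: bh|exact: smooth_bdd].
- exact: bdd_cst.
move=> t x _; under [LHS]eq_ival do rewrite hz.
have D s := is_derive_coord (inord 2) t x s hphi.1.
have cD : continuous (fun s => Dx (inord 2) phi (t, set_coord (inord 2) s x)).
  by apply: is_derive_continuous => s; exact: is_derive_coord.
rewrite ivalZ// (ival_FTC D)//.
have -> : phi (t, set_coord (inord 2) 1 x) = phi (t, set_coord (inord 2) 0 x).
  by rewrite -(xperiodic_set_coord (inord 2) t 0 x hphi.2) add0r.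
by rewrite subrr mulr0 ival_cst// mul0r.
Qed.

End SlabSplit.

(** * The limit velocity and the limit force *)

Section LimitField.
Context {R : realType}.
Variables (K : nat) (s : R -> R).
Hypothesis K2 : (2 <= K)%N.
Hypothesis ss : smooth_on setT s.
Hypothesis s0 : forall x, x <= 0 -> s x = 0.
Hypothesis s1 : forall x, 1 <= x -> s x = 1.
Variables (C : R) (C1 : 1 <= C).
Hypothesis hC : forall x, [/\ `|'D_(1 : R) s x| <= C, `|'D_(1 : R) ('D_(1 : R) s) x| <= C &
  `|'D_(1 : R) ('D_(1 : R) ('D_(1 : R) s)) x| <= C].

Local Notation N := (frequency K).
Local Notation sg := (clock s).

Definition flows m : vfield R := flow N waves sg m.*2.
Definition forces m : vfield R := euler_force N waves sg m.*2.
Definition homogenized : R -> R -> R := mixing_limit N defect sg.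
(** Outside the exceptional case the sequences are eventually constant. In the third component at
    times t >= 1 the waves keep oscillating, and their weak limit, the homogenized profile, is
    inserted instead. *)
Definition limit_flow : vfield R := fun z => \row_j
  (if (val j == 2%N) && (1 <= z.1) then homogenized (xcoord z) (ycoord z)
   else limn (fun m => flows m z 0 j)).
Definition limit_force : vfield R := fun z => \row_j limn (fun m => forces m z 0 j).

Let C2 : 1 <= 2 * C.
Proof. by apply: (le_trans C1); rewrite ler_peMl ?ler1n// (le_trans _ C1). Qed.

Let N1 := frequency_ndecr K.
Let d01 := @defect01 R.
Let s_end := clock_end s1.
Let err q := @mixing_error R _ q K2.

Lemma flows_smooth m i : smooth_periodic (vcomp (flows m) i).
Proof. exact: flow_smooth_periodic smooth_waves waves_periodic (fun k => smooth_clock k ss) _ _. Qed.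

Lemma forces_smooth m i : smooth_periodic (vcomp (forces m) i).
Proof. exact: euler_force_smooth_periodic smooth_waves waves_periodic (fun k => smooth_clock k ss) _ _. Qed.

Lemma flows0E m z (h : (0 < 3)%N) : flows m z 0 (Ordinal h) =
  (alternate (stage_velocity N waves sg) m.*2 (tcoord z) (ycoord z)).1.
Proof. by rewrite mxE. Qed.

Lemma flows1E m z (h : (1 < 3)%N) : flows m z 0 (Ordinal h) =
  (alternate (stage_velocity N waves sg) m.*2 (tcoord z) (xcoord z)).2.
Proof. by rewrite mxE. Qed.

Lemma flows2E m z (h : (2 < 3)%N) : flows m z 0 (Ordinal h) =
  tracer N waves sg m.*2 (tcoord z) (xcoord z) (ycoord z).
Proof. by rewrite mxE. Qed.

Lemma forces0E m z (h : (0 < 3)%N) : forces m z 0 (Ordinal h) =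
  (alternate (stage_acceleration K s) m.*2 (tcoord z) (ycoord z)).1.
Proof. by rewrite /forces euler_forceE// mxE. Qed.

Lemma forces1E m z (h : (1 < 3)%N) : forces m z 0 (Ordinal h) =
  (alternate (stage_acceleration K s) m.*2 (tcoord z) (xcoord z)).2.
Proof. by rewrite /forces euler_forceE// mxE. Qed.

Lemma forces2E m z (h : (2 < 3)%N) : forces m z 0 (Ordinal h) = 0.
Proof. by rewrite /forces euler_forceE// mxE. Qed.

(** Before time 1 only finitely many stages have begun. From time 1 on all have ended and the planar
    velocities vanish, but every stage has left its trace in the tracer. *)
Lemma flows_stable z : exists k, forall m j, (k <= m)%N ->
  ~~ ((val j == 2%N) && (1 <= z.1)) -> flows m.+1 z 0 j = flows m z 0 j.
Proof.
have [k hk] := phase_idle z.1.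
have dbl k' m : (k' <= m)%N -> (k' <= m.*2)%N by rewrite -addnn; lia.
have [z1|z1] := ltP z.1 1; last first.
  exists k => m [[|[|[|//]]] h] km //= _; rewrite ?flows0E ?flows1E.
  - by rewrite (@alternate_stable _ _ k)// ?dbl// => j kj; exact: velocity_idle (hk j kj).
  - by rewrite (@alternate_stable _ _ k)// ?dbl// => j kj; exact: velocity_idle (hk j kj).
have [k' hk'] := phase_early z1.
exists (maxn k k') => m [[|[|[|//]]] h]; rewrite geq_max => /andP[km km'] _; rewrite ?flows0E ?flows1E ?flows2E.
- by rewrite (@alternate_stable _ _ k)// ?dbl// => j kj; exact: velocity_idle (hk j kj).
- by rewrite (@alternate_stable _ _ k)// ?dbl// => j kj; exact: velocity_idle (hk j kj).
- rewrite /tracer (@back_stable _ _ _ _ k')// ?dbl// => j kj.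
  exact: s0 (hk' j kj).
Qed.

Lemma flows_cvg z j : ~~ ((val j == 2%N) && (1 <= z.1)) ->
  (fun m => flows m z 0 j) @ \oo --> limit_flow z 0 j.
Proof.
move=> h; rewrite mxE (negbTE h); have [k hk] := flows_stable z.
by apply: (@stable_cvg _ _ k) => m km; exact: hk.
Qed.

Lemma forces_cvg z j : (fun m => forces m z 0 j) @ \oo --> limit_force z 0 j.
Proof.
rewrite mxE; have [k hk] := phase_idle z.1.
have dbl m : (k <= m)%N -> (k <= m.*2)%N by rewrite -addnn; lia.
apply: (@stable_cvg _ _ k) => m km.
case: j => -[|[|[|//]]] h; rewrite ?forces0E ?forces1E ?forces2E//.
- by rewrite (@alternate_stable _ _ k)// ?dbl// => j kj; exact: acceleration_idle (hk j kj).
- by rewrite (@alternate_stable _ _ k)// ?dbl// => j kj; exact: acceleration_idle (hk j kj).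
Qed.

Lemma flows_le m z j : `|flows m z 0 j| <= 2 * C.
Proof.
have C0 : 0 <= C by exact: le_trans C1.
have V t a k := velocity_le K2 ss C1 hC k t a.
case: j => -[|[|[|//]]] h.
- by rewrite flows0E; have [] := alternate_le m.*2 C0 (V (tcoord z) (ycoord z)).
- by rewrite flows1E; have [] := alternate_le m.*2 C0 (V (tcoord z) (xcoord z)).
- rewrite flows2E; apply: (@le_trans _ _ 1); first by rewrite ler_norml sin_geN1 sin_le1.
  exact: C2.
Qed.

Lemma limit_flow_le z j : `|limit_flow z 0 j| <= 2 * C.
Proof.
have [h|h] := boolP ((val j == 2%N) && (1 <= z.1)).
  rewrite mxE h; apply: (le_trans (mixing_limit_le N1 d01 s_end err _ _)).
  by apply: le_trans C2; rewrite invf_le1// ler1n.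
have h' : (fun m => `|flows m z 0 j|) @ \oo --> `|limit_flow z 0 j|.
  by apply: cvg_norm; exact: flows_cvg.
rewrite -(cvg_lim _ h')//; apply: limr_le; first by apply/cvg_ex; exists `|limit_flow z 0 j|.
by apply: nearW => m; exact: flows_le.
Qed.

Lemma flows_late m z (h : (2 < 3)%N) : 1 <= z.1 ->
  flows m z 0 (Ordinal h) = planar (mixed N defect sg m.*2) z.
Proof. by move=> z1; rewrite flows2E; exact: tracer_mixed s_end _ _ _ _ z1. Qed.

Lemma flows_late0 m z j : val j != 2%N -> 1 <= z.1 -> flows m z 0 j = 0.
Proof.
move=> + z1; have V a k : stage_velocity N waves sg k (tcoord z) a = 0.
  by apply: velocity_idle => //; right; exact: phase_late.
have A a q : alternate (stage_velocity N waves sg) q (tcoord z) a = (0, 0).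
  by elim: q => //= q ->; rewrite V subrr.
by case: j => -[|[|[|//]]] h //= _; rewrite ?flows0E ?flows1E A.
Qed.

Lemma limit_flow_late z (h : (2 < 3)%N) : 1 <= z.1 ->
  limit_flow z 0 (Ordinal h) = planar homogenized z.
Proof. by move=> z1; rewrite mxE /= z1. Qed.

Lemma limit_flow_late0 z j : val j != 2%N -> 1 <= z.1 -> limit_flow z 0 j = 0.
Proof.
move=> h z1; rewrite mxE (negbTE h) /= (_ : (fun m => flows m z 0 j) = fun=> 0) ?lim_cst//.
by apply/funext => m; exact: flows_late0.
Qed.

(** No stage has begun at time 0; hence one initial datum serves all viscosities. *)
Lemma flows_initial m x : flows m (0, x) = flows 0 (0, x).
Proof.
have h k : phase k 0 <= 0 :> R by exact: phase0.
elim: m => // m <-; apply/rowP => -[[|[|[|//]]] h3]; rewrite ?flows0E ?flows1E ?flows2E.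
- by rewrite (@alternate_stable _ _ 0)// => j _; apply: velocity_idle => //; left; exact: h.
- by rewrite (@alternate_stable _ _ 0)// => j _; apply: velocity_idle => //; left; exact: h.
- by rewrite /tracer (@back_stable _ _ _ _ 0)// => j _; exact: s0 (h j).
Qed.

Let mflows m j : measurable_fun (setT : set (mspacetime R)) (fun z => flows m z 0 j).
Proof. exact: smooth_measurable (flows_smooth m j).1. Qed.

Let mhom : measurable_fun (setT : set (mspacetime R)) (planar homogenized).
Proof. exact: mixing_limit_measurable N1 d01 s_end err. Qed.

Lemma limit_flow_measurable j :
  measurable_fun (setT : set (mspacetime R)) (fun z => limit_flow z 0 j).
Proof.
(* The approximations are replaced by the limit itself where pointwise convergence may fail. *)
apply: (@measurable_fun_cvg _ _ _ _ (fun m z =>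
    if (val j == 2%N) && (1 <= tcoord z) then planar homogenized z else flows m z 0 j)).
  move=> m; apply: measurable_fun_ifT; [|exact: mhom|exact: mflows].
  apply: measurable_and; first exact: measurable_cst.
  by apply: measurable_fun_ler; [exact: measurable_cst|exact: measurable_fst].
move=> z _; case: (boolP ((val j == 2%N) && (1 <= tcoord z))) => h; last first.
  exact: flows_cvg.
by rewrite mxE -/(tcoord z) h; exact: cvg_cst.
Qed.

Lemma limit_flow_xperiodic : xperiodic limit_flow.
Proof.
move=> t x i; apply/rowP => j; rewrite !mxE /=.
case: ifP => _.
  by rewrite -[RHS](mixing_limit_period N defect sg _ _ (val i == 0%N : nat) (val i == 1%N : nat)).
by congr (limn _); apply/funext => m; exact: (flows_smooth m j).2.
Qed.

Lemma limit_force_xperiodic : xperiodic limit_force.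
Proof.
move=> t x i; apply/rowP => j; rewrite [LHS]mxE [RHS]mxE.
by congr (limn _); apply/funext => m; exact: (forces_smooth m j).2.
Qed.

End LimitField.

(** * Weak convergence of the approximations *)

Section WeakLimit.
Context {R : realType}.
Variables (K : nat) (s : R -> R).
Hypothesis K2 : (2 <= K)%N.
Hypothesis ss : smooth_on setT s.
Hypothesis s0 : forall x, x <= 0 -> s x = 0.
Hypothesis s1 : forall x, 1 <= x -> s x = 1.
Variables (C : R) (C1 : 1 <= C).
Hypothesis hC : forall x, [/\ `|'D_(1 : R) s x| <= C, `|'D_(1 : R) ('D_(1 : R) s) x| <= C &
  `|'D_(1 : R) ('D_(1 : R) ('D_(1 : R) s)) x| <= C].

Local Notation N := (frequency K).
Local Notation sg := (clock s).
Local Notation flows := (flows K s).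
Local Notation forces := (forces K s).
Local Notation limit_flow := (limit_flow K s).
Local Notation limit_force := (limit_force K s).
Local Notation homogenized := (homogenized K s).

Let N1 := frequency_ndecr K.
Let d01 := @defect01 R.
Let s_end := clock_end s1.
Let err q := @mixing_error R _ q K2.
Let C2 : 1 <= 2 * C.
Proof. by apply: (le_trans C1); rewrite ler_peMl ?ler1n// (le_trans _ C1). Qed.

Let n_le m : (N m.*2)%:R^-1 <= 4^-1 ^+ m :> R.
Proof.
have h := @frequency_large R _ m.*2 K2.
rewrite exprVn lef_pV2 ?posrE ?exprn_gt0 ?ltr0n//; last by have /andP[] := N1 m.*2.
apply: le_trans h; have -> : 4 ^+ m = 2 ^+ m.*2 :> R.
  by rewrite -mul2n exprM; congr (_ ^+ m); ring.
by apply: ler_weXn2l; [rewrite ler1n|lia].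
Qed.

Let mhom : measurable_fun (setT : set (mspacetime R)) (planar homogenized).
Proof. exact: mixing_limit_measurable N1 d01 s_end err. Qed.

Let hom_le a b : `|homogenized a b| <= 4^-1.
Proof. exact: mixing_limit_le N1 d01 s_end err _ _. Qed.

Let lateoo := leb4_box_lty late_interval.1 (slice_interval_lty (@late_interval R)).
Let mlate := measurable_box (@late_interval R).1.

(** The window average is inserted between the two: the wave is close to it weakly, by the window
    length 1 / n_(2m), and it is uniformly within 4^-(m+1) of the limit. Both errors are bounded by
    multiples of 4^-m. *)
Lemma tracer_weak chi : smooth_periodic chi ->
  (fun m => \int[leb4 R]_(z in box late)
     ((planar (mixed N defect sg m.*2) z - planar homogenized z) * chi z)) @ \oo --> (0 : R).
Proof.
move=> hchi; have [Cx Cx0 hCx] := smooth_bounded hchi.1 hchi.2.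
have [L L0 hL] := smooth_bounded (sp_Dx ord0 hchi).1 (sp_Dx ord0 hchi).2.
have mu1 : fine (leb4 R (box late)) = 1.
  by rewrite leb4_box ?leb1_late//; exact: late_interval.1.
have bchi : bdd (box late) chi by exact: smooth_bdd late_interval hchi.1 hchi.2.
have mchi := smooth_measurable hchi.1.
have bI (u : spacetime R -> R) : measurable_fun (setT : set (mspacetime R)) u -> bdd (box late) u ->
    (leb4 R).-integrable (box late) (EFin \o u).
  exact: box_integrable late_interval.1 (slice_interval_lty late_interval) _.
suff H m : `|\int[leb4 R]_(z in box late)
     ((planar (mixed N defect sg m.*2) z - planar homogenized z) * chi z)| <= (L + Cx) * 4^-1 ^+ m.
  have g0 : (fun m => (L + Cx) * 4^-1 ^+ m) @ \oo --> 0.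
    by apply: cvg_geometric; rewrite ger0_norm ?invf_lt1// ltr1n.
  apply/norm_cvg0P; apply: (squeeze_cvgr _ (cvg_cst 0) g0).
  by apply: nearW => m; rewrite normr_ge0 H.
have lipm := mixed_lipschitz N1 d01 s_end m.*2.
have mm := planar_measurable lipm.
have lipa := average_lipschitz N1 d01 s_end m.*2.
have ma := planar_measurable lipa.
have a1 a b : `|average N defect sg m.*2 a b| <= 1.
  by apply: (@sliding_average_le1 _ _ _ _ lipm) => u v; exact: mixed_le1.
set avg := planar (average N defect sg m.*2) in ma.
set mix := planar (mixed N defect sg m.*2) in mm *.
have bmix : bdd (box late) mix by apply: planar_bdd => a b; exact: mixed_le1.
have bavg : bdd (box late) avg by apply: planar_bdd => a b; exact: a1.
have bhom : bdd (box late) (planar homogenized) by exists 4^-1 => z _; exact: hom_le.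
have -> : \int[leb4 R]_(z in box late) ((mix z - planar homogenized z) * chi z) =
    \int[leb4 R]_(z in box late) ((mix z - avg z) * chi z) +
    \int[leb4 R]_(z in box late) ((avg z - planar homogenized z) * chi z).
  rewrite -RintegralD//; last 2 first.
  - by apply: bI; [apply: measurable_funM mchi; exact: measurable_funB|apply: bddM => //; exact: bddB].
  - by apply: bI; [apply: measurable_funM mchi; exact: measurable_funB|apply: bddM => //; exact: bddB].
  by apply: eq_Rintegral => z _; rewrite -mulrDl subrKA.
apply: (le_trans (ler_normD _ _)); rewrite mulrDl; apply: lerD.
  have := planar_average_weak lipm (fun a b => mixed_le1 _ _ _ _ a b) _ _ late_interval hchi hL.
  move=> /(_ ((N m.*2)%:R)^-1 _ _) h; apply: (le_trans (h _ _)).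
  - by move=> a b; have := mixed_period N defect sg m.*2 a b 1 0; rewrite addr0.
  - by rewrite invr_ge0.
  by rewrite mu1 mulr1 ler_wpM2l.
apply: (@le_trans _ _ (Cx * 4^-1 ^+ m * fine (leb4 R (box late)))); last by rewrite mu1 mulr1.
apply: le_Rintegral_bdd => //.
  by apply/measurable_funTS/measurable_funM => //; exact: measurable_funB.
move=> z [zJ _]; rewrite mulrC normrM ler_pM//.
  apply: hCx; move: zJ; rewrite /late /= in_itv /= => /andP[t1 t2]; apply/andP; split; lra.
rewrite distrC; apply: (le_trans (mixing_limit_near N1 d01 s_end err m _ _)).
by apply: ler_wiXn2l => //; rewrite invf_le1// ler1n.
Qed.

Let mlimit j := limit_flow_measurable K2 ss s0 s1 C1 j.

Let mflows m j : measurable_fun (setT : set (mspacetime R)) (fun z => flows m z 0 j).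
Proof. exact: smooth_measurable (flows_smooth K ss m j).1. Qed.

Let fle m z j : `|flows m z 0 j| <= 2 * C := flows_le K2 ss C1 hC m z j.
Let lle z j : `|limit_flow z 0 j| <= 2 * C := limit_flow_le K2 ss s0 s1 C1 hC z j.

Let slaboo : (leb4 R (@slab R 2) < +oo)%E.
Proof. by rewrite (le_lt_trans leb4_slab2_le)// ltry. Qed.

Let chi_slab chi : smooth_periodic chi ->
  exists2 B, 0 <= B & forall z, @slab R 2 z -> `|chi z| <= B.
Proof.
move=> h; have [B B0 hB] := smooth_bounded h.1 h.2; exists B => // z /slab_itv zJ.
by apply: hB; exact: zJ.
Qed.

Let cvg_component D chi j : measurable D -> D `<=` @slab R 2 -> (leb4 R D < +oo)%E ->
  smooth_periodic chi -> (forall z, D z -> ~~ ((val j == 2%N) && (1 <= z.1))) ->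
  (fun m => \int[leb4 R]_(z in D) (flows m z 0 j * chi z)) @ \oo -->
  \int[leb4 R]_(z in D) (limit_flow z 0 j * chi z).
Proof.
move=> mD Ds Doo hchi hj; have [B B0 hB] := chi_slab hchi.
apply: (@bdd_cvg_Rintegral _ _ _ _ _ _ _ (2 * C * B)) => //.
- move=> m; apply/measurable_funTS/measurable_funM; first exact: mflows.
  exact: smooth_measurable hchi.1.
- by move=> m z Dz; rewrite normrM ler_pM//; exact/hB/Ds.
- move=> z Dz; apply: cvgM; last exact: cvg_cst.
  by apply: flows_cvg => //; exact: hj.
Qed.

(** Dominated convergence wherever the values converge pointwise; weak mixing enters only for the
    third component after time 1. *)
Lemma limit_linear chi j : smooth_periodic chi ->
  (fun m => \int[leb4 R]_(z in @slab R 2) (flows m z 0 j * chi z)) @ \oo -->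
  \int[leb4 R]_(z in @slab R 2) (limit_flow z 0 j * chi z).
Proof.
move=> hchi; have [j2|j2] := eqVneq (val j) 2%N; last first.
  apply: (cvg_component (@measurable_slab R 2) _ slaboo hchi) => //.
  by move=> z _; rewrite (negbTE j2).
have mchi := smooth_measurable hchi.1; have [B B0 hB] := chi_slab hchi.
have split_int (u : spacetime R -> R) : measurable_fun (setT : set (mspacetime R)) u ->
    (forall z, `|u z| <= 2 * C) ->
    \int[leb4 R]_(z in @slab R 2) (u z * chi z) =
    \int[leb4 R]_(z in box early) (u z * chi z) + \int[leb4 R]_(z in box late) (u z * chi z).
  move=> mu uC; apply: slab_integral_split; first exact: measurable_funM.
  by exists (2 * C * B) => z zs; rewrite normrM ler_pM//; exact: hB.
rewrite (split_int (fun z => limit_flow z 0 j) (mlimit j))//.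
rewrite (_ : (fun m => _) = fun m => \int[leb4 R]_(z in box early) (flows m z 0 j * chi z) +
    \int[leb4 R]_(z in box late) (flows m z 0 j * chi z)); last first.
  by apply/funext => m; exact: (split_int (fun z => flows m z 0 j)).
apply: cvgD.
  have earlyoo := leb4_box_lty early_interval.1 (slice_interval_lty (@early_interval R)).
  have es : box early `<=` @slab R 2 by rewrite slab_split; exact: subsetUl.
  apply: (cvg_component (measurable_box early_interval.1) es earlyoo hchi).
  move=> z [ze _]; rewrite negb_and -ltNge; apply/orP; right.
  by move: ze; rewrite /early /= in_itv /= => /andP[].
have jE : j = Ordinal (isT : (2 < 3)%N) by apply/val_inj; rewrite /= j2.
have late1 (z : mspacetime R) : z \in box late -> 1 <= z.1.
  by rewrite inE => -[zl _]; move: zl; rewrite /late /= in_itv /= => /andP[].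
have -> : \int[leb4 R]_(z in box late) (limit_flow z 0 j * chi z) =
    \int[leb4 R]_(z in box late) (planar homogenized z * chi z).
  by apply: eq_Rintegral => z /late1 z1; rewrite jE limit_flow_late.
have T := cvgD (tracer_weak hchi)
  (cvg_cst (\int[leb4 R]_(z in box late) (planar homogenized z * chi z))).
rewrite add0r in T.
rewrite (_ : (fun m => _) = (fun m => \int[leb4 R]_(z in box late)
     ((planar (mixed N defect sg m.*2) z - planar homogenized z) * chi z) +
     \int[leb4 R]_(z in box late) (planar homogenized z * chi z))); first exact: T.
apply/funext => m.
have bchi : bdd (box late) chi by exact: smooth_bdd late_interval hchi.1 hchi.2.
have hb := box_integrable late_interval.1 (slice_interval_lty (@late_interval R)).
rewrite -[RHS]RintegralD//.
- apply: eq_Rintegral => z /late1 z1; rewrite jE (@flows_late _ _ _ s1)//.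
  by rewrite -mulrDl subrK.
- apply: hb; first apply: measurable_funM => //.
    apply: measurable_funB => //.
    exact: planar_measurable (mixed_lipschitz N1 d01 s_end m.*2).
  apply: bddM => //; apply: bddB; last by exists 4^-1 => z _; exact: hom_le.
  by exists 1 => z _; exact: mixed_le1.
- apply: hb; first exact: measurable_funM.
  by apply: bddM => //; exists 4^-1 => z _; exact: hom_le.
Qed.

(** Before time 1 both factors converge pointwise. Afterwards every product except the square of the
    third component contains a planar velocity, which is 0; that square is paired with d_z phi and
    contributes 0 for every m and in the limit. *)
Lemma limit_quadratic phi i j : smooth_periodic phi ->
  (fun m => \int[leb4 R]_(z in @slab R 2) (flows m z 0 i * flows m z 0 j * Dx j phi z)) @ \oo -->
  \int[leb4 R]_(z in @slab R 2) (limit_flow z 0 i * limit_flow z 0 j * Dx j phi z).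
Proof.
move=> hphi; have hchi := sp_Dx j hphi; have mchi := smooth_measurable hchi.1.
have [B B0 hB] := chi_slab hchi.
have [/andP[/eqP i2 /eqP j2]|ij] := boolP ((val i == 2%N) && (val j == 2%N)).
  have iE : i = Ordinal (isT : (2 < 3)%N) by apply/val_inj.
  have jE : j = inord 2 by apply/val_inj; rewrite /= j2 inordK.
  have jO : j = Ordinal (isT : (2 < 3)%N) by apply/val_inj.
  have -> : i = j by rewrite iE jO.
  have sc r x : set_coord (inord 2) r x = (x.1.1, x.1.2, r) :> R * R * R.
    by rewrite /set_coord /= inordK.
  have fz m t x r : flows m (t, set_coord (inord 2) r x) 0 j = flows m (t, x) 0 j.
    by rewrite jO !flows2E sc.
  have lz t x r : limit_flow (t, set_coord (inord 2) r x) 0 j = limit_flow (t, x) 0 j.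
    rewrite [LHS]mxE [RHS]mxE.
    have -> : (fun m => flows m (t, set_coord (inord 2) r x) 0 j) = fun m => flows m (t, x) 0 j.
      by apply/funext => m; exact: fz.
    by rewrite sc.
  rewrite (_ : \int[leb4 R]_(z in _) (limit_flow z 0 j * _ * _) = 0).
    rewrite (_ : (fun m => _) = fun=> 0); first exact: cvg_cst.
    apply/funext => m; rewrite {3}jE; apply: vertical_integral => //.
    - by apply: measurable_funM; exact: mflows.
    - by exists (2 * C * (2 * C)) => z _; rewrite normrM ler_pM.
    - by move=> t x r; rewrite fz.
  rewrite {3}jE; apply: vertical_integral => //.
  - by apply: measurable_funM; exact: mlimit.
  - by exists (2 * C * (2 * C)) => z _; rewrite normrM ler_pM.
  - by move=> t x r; rewrite lz.
apply: (@bdd_cvg_Rintegral _ _ _ _ _ _ _ (2 * C * (2 * C) * B)) => //.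
- exact: measurable_slab.
- move=> m; apply/measurable_funTS/measurable_funM => //.
  by apply: measurable_funM; exact: mflows.
- by move=> m z zs; rewrite !normrM ler_pM ?mulr_ge0// ?ler_pM//; exact: hB.
move=> z _; apply: cvgM; last exact: cvg_cst.
have [z1|z1] := ltP z.1 1.
  by apply: cvgM; apply: flows_cvg => //; rewrite negb_and -ltNge z1 orbT.
move: ij; rewrite negb_and => /orP[i2|j2].
  rewrite limit_flow_late0// mul0r; under eq_fun do rewrite flows_late0// mul0r.
  exact: cvg_cst.
rewrite [X in _ * X]limit_flow_late0// mulr0; under eq_fun do rewrite [X in _ * X]flows_late0// mulr0.
exact: cvg_cst.
Qed.

End WeakLimit.

(** * The limit solves the Euler equations *)

Section EulerLimit.
Context {R : realType}.
Variables (K : nat) (s : R -> R).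
Hypothesis K2 : (2 <= K)%N.
Hypothesis ss : smooth_on setT s.
Hypothesis s0 : forall x, x <= 0 -> s x = 0.
Hypothesis s1 : forall x, 1 <= x -> s x = 1.
Variables (C : R) (C1 : 1 <= C).
Hypothesis hC : forall x, [/\ `|'D_(1 : R) s x| <= C, `|'D_(1 : R) ('D_(1 : R) s) x| <= C &
  `|'D_(1 : R) ('D_(1 : R) ('D_(1 : R) s)) x| <= C].

Local Notation N := (frequency K).
Local Notation sg := (clock s).
Local Notation flows := (flows K s).
Local Notation forces := (forces K s).
Local Notation limit_flow := (limit_flow K s).
Local Notation limit_force := (limit_force K s).
Local Notation homogenized := (homogenized K s).

Let N1 := frequency_ndecr K.
Let d01 := @defect01 R.
Let s_end := clock_end s1.
Let err q := @mixing_error R _ q K2.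
Let C2 : 1 <= 2 * C.
Proof. by apply: (le_trans C1); rewrite ler_peMl ?ler1n// (le_trans _ C1). Qed.

Variables (alpha : R) (ha : 0 < alpha < 1).
Hypothesis hK : 11 <= 2 * (1 - alpha) * K%:R.

Let C0 : 0 <= C. Proof. exact: le_trans C1. Qed.

(** The step from m to m + 1 adds stages 2 m and 2 m + 1, and each planar component of the force
    receives minus the acceleration of one of them. *)
Lemma forces_step m j : holder_le (@strip R) alpha
  (fun z => forces m.+1 z 0 j - forces m z 0 j) (2 ^+ 8 * C * 4^-1 ^+ m).
Proof.
have A k b := @acceleration_holder R K s K2 ss C C1 hC alpha k b ha hK.
have E4 : 2^-1 ^+ m.*2 = 4^-1 ^+ m :> R.
  by rewrite -mul2n exprM; congr (_ ^+ m); field.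
have neg (u w : spacetime R -> R) B B' : B <= B' -> holder_le (@strip R) alpha u B ->
    (forall z, w z = - u z) -> holder_le (@strip R) alpha w B'.
  move=> BB hu wu; have -> : w = fun z => (-1) * u z by apply/funext => z; rewrite wu mulN1r.
  by apply: holder_leW BB _; have := holder_leZ (-1) hu; rewrite normrN1 mul1r.
case: j => -[|[|[|//]]] h.
- apply: (neg _ _ _ _ _ (A m.*2 _ ycoord_lipschitz)) => [|z]; first by rewrite E4.
  by rewrite !forces0E// alternate_double /= addrAC subrr sub0r.
- apply: (neg _ _ _ _ _ (A m.*2.+1 _ xcoord_lipschitz)) => [|z].
    rewrite [2^-1 ^+ m.*2.+1]exprS E4 ler_wpM2l ?mulr_ge0 ?exprn_ge0// ler_piMl ?exprn_ge0//.
    by rewrite invf_le1 ?ler1n.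
  by rewrite !forces1E// alternate_double /= addrAC subrr sub0r.
- have B0 : 0 <= 2 ^+ 8 * C * 4^-1 ^+ m by rewrite !mulr_ge0 ?exprn_ge0 ?invr_ge0.
  split=> [z _|z w _ _]; rewrite !forces2E// subrr ?subr0 normr0//.
  by rewrite mulr_ge0// powR_ge0.
Qed.

Lemma limit_force_near m j : holder_le (@strip R) alpha
  (fun z => limit_force z 0 j - forces m z 0 j) (2 * (2 ^+ 8 * C) * 4^-1 ^+ m).
Proof.
apply: (@holder_le_limit _ _ _ _ _ (fun m z => forces m z 0 j)).
- by rewrite mulr_ge0// exprn_ge0.
- by move=> k; exact: forces_step.
- by move=> z _; exact: forces_cvg.
Qed.

Lemma forces0 z j : forces 0 z 0 j = 0.
Proof. by case: j => -[|[|[|//]]] h; rewrite ?forces0E ?forces1E ?forces2E. Qed.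

Lemma limit_force_holder j : holder_le (@strip R) alpha (fun z => limit_force z 0 j)
  (2 * (2 ^+ 8 * C)).
Proof.
have := limit_force_near 0 j; rewrite expr0 mulr1; congr holder_le.
by apply/funext => z; rewrite forces0 subr0.
Qed.

Lemma forces_le m z j : @strip R z -> `|forces m z 0 j| <= 2 * (2 * (2 ^+ 8 * C)).
Proof.
move=> zs; have h1 := (limit_force_holder j).1 z zs.
have h2 := (limit_force_near m j).1 z zs.
have -> : forces m z 0 j = limit_force z 0 j - (limit_force z 0 j - forces m z 0 j).
  by rewrite subKr.
apply: (le_trans (ler_normB _ _)); rewrite [leRHS]mulr_natl mulr2n; apply: lerD => //.
apply: (le_trans h2); rewrite ler_piMr ?mulr_ge0 ?exprn_ge0//.
by rewrite exprn_ile1// ?invf_le1// ler1n.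
Qed.

Lemma slab_strip z : @slab R 2 z -> @strip R z.
Proof. by move=> []. Qed.

Let mlimit j := limit_flow_measurable K2 ss s0 s1 C1 j.
Let mflows m j : measurable_fun (setT : set (mspacetime R)) (fun z => flows m z 0 j).
Proof. exact: smooth_measurable (flows_smooth K ss m j).1. Qed.
Let mforces m j : measurable_fun (setT : set (mspacetime R)) (fun z => forces m z 0 j).
Proof. exact: smooth_measurable (forces_smooth K ss m j).1. Qed.
Let fle m z j : `|flows m z 0 j| <= 2 * C := flows_le K2 ss C1 hC m z j.
Let lle z j : `|limit_flow z 0 j| <= 2 * C := limit_flow_le K2 ss s0 s1 C1 hC z j.

Lemma limit_force_measurable j :
  measurable_fun (setT : set (mspacetime R)) (fun z => limit_force z 0 j).
Proof.
apply: (@measurable_fun_cvg _ _ _ _ (fun m z => forces m z 0 j)).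
  by move=> m; exact: mforces.
by move=> z _; exact: forces_cvg.
Qed.

Let slaboo : (leb4 R (@slab R 2) < +oo)%E.
Proof. by rewrite (le_lt_trans leb4_slab2_le)// ltry. Qed.

Let bI (u : spacetime R -> R) : measurable_fun (setT : set (mspacetime R)) u ->
  bdd (@slab R 2) u -> (leb4 R).-integrable (@slab R 2) (EFin \o u).
Proof.
move=> mu bu; apply: (bdd_integrable (@measurable_slab R 2) slaboo _ bu).
exact: measurable_funTS.
Qed.

Let bsp chi : smooth_periodic chi -> bdd (@slab R 2) chi.
Proof.
move=> h; have [B B0 hB] := smooth_bounded h.1 h.2; exists B => z /slab_itv zJ.
by apply: hB; exact: zJ.
Qed.

Let vcond (v : vfield R) := (forall j, measurable_fun (setT : set (mspacetime R)) (fun z => v z 0 j)) /\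
  (forall j, bdd (@slab R 2) (fun z => v z 0 j)).

Let flows_cond m : vcond (flows m).
Proof. by split=> j; [exact: mflows|exists (2 * C) => z _; exact: fle]. Qed.
Let limit_cond : vcond limit_flow.
Proof. by split=> j; [exact: mlimit|exists (2 * C) => z _; exact: lle]. Qed.
Let forces_cond m : vcond (forces m).
Proof.
split=> j; first exact: mforces.
by exists (2 * (2 * (2 ^+ 8 * C))) => z /slab_strip; exact: forces_le.
Qed.
Let limit_force_cond : vcond limit_force.
Proof.
split=> j; first exact: limit_force_measurable.
by exists (2 * (2 ^+ 8 * C)) => z /slab_strip; exact: (limit_force_holder j).1.
Qed.

Let I1 (v : vfield R) chi j : vcond v -> smooth_periodic chi ->
  (leb4 R).-integrable (@slab R 2) (EFin \o (fun z => v z 0 j * chi z)).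
Proof.
move=> [mv bv] hc; apply: bI; first exact: measurable_funM (mv j) (smooth_measurable hc.1).
by apply: bddM => //; exact: bsp.
Qed.

Let I2 (v : vfield R) chi i j : vcond v -> smooth_periodic chi ->
  (leb4 R).-integrable (@slab R 2) (EFin \o (fun z => v z 0 i * v z 0 j * chi z)).
Proof.
move=> [mv bv] hc; apply: bI.
  apply: measurable_funM (smooth_measurable hc.1); exact: measurable_funM.
by apply: bddM; [apply: bddM|exact: bsp].
Qed.

Let sum3 (f : 'I_3 -> spacetime R -> R) :
  (forall j, (leb4 R).-integrable (@slab R 2) (EFin \o f j)) ->
  \int[leb4 R]_(z in @slab R 2) (\sum_j f j z) =
    \sum_j \int[leb4 R]_(z in @slab R 2) f j z /\
  (leb4 R).-integrable (@slab R 2) (EFin \o (fun z => \sum_j f j z)).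
Proof.
move=> hf; have mS := @measurable_slab R 2.
have i01 : (leb4 R).-integrable (@slab R 2) (EFin \o (fun z => f ord0 z + f (inord 1) z)).
  exact: (integrableD mS (hf ord0) (hf (inord 1))).
have -> : (fun z => \sum_j f j z) = fun z => f ord0 z + f (inord 1) z + f (inord 2) z.
  by apply/funext => z; rewrite big_ord3.
split; last exact: (integrableD mS i01 (hf (inord 2))).
rewrite (RintegralD mS i01 (hf (inord 2))) (RintegralD mS (hf ord0) (hf (inord 1))).
by rewrite [RHS]big_ord3.
Qed.

(** Separate integrals allow the linear, the quadratic and the force terms to converge for different
    reasons. *)
Lemma momentum_split (v F : vfield R) phi i : vcond v -> vcond F -> smooth_periodic phi ->
  \int[leb4 R]_(z in @slab R 2)
     (v z 0 i * Dt phi z + \sum_j v z 0 i * v z 0 j * Dx j phi z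
      + 0 * Dx i phi z + 0 * v z 0 i * laplacian phi z + F z 0 i * phi z) =
  \int[leb4 R]_(z in @slab R 2) (v z 0 i * Dt phi z) +
  \sum_j \int[leb4 R]_(z in @slab R 2) (v z 0 i * v z 0 j * Dx j phi z) +
  \int[leb4 R]_(z in @slab R 2) (F z 0 i * phi z).
Proof.
move=> hv hF hphi; have mS := @measurable_slab R 2.
have [E S] := sum3 (fun j => I2 i j hv (sp_Dx j hphi)).
have iA := I1 i hv (sp_Dt hphi); have iF := I1 i hF hphi.
rewrite -E -(RintegralD mS iA S) -RintegralD//; last exact: (integrableD mS iA S).
by apply: eq_Rintegral => z _; rewrite !mul0r !addr0.
Qed.

Definition vin : sfield R := fun x => flows 0 (0, x).

Lemma flows_vin m : (fun x => flows m (0, x)) = vin.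
Proof. by apply/funext => x; exact: flows_initial. Qed.

Lemma limit_momentum : momentum_equation 0 vin limit_force limit_flow (fun=> 0).
Proof.
move=> phi i hphi; have sphi := test0_sp hphi.
pose c := \int[leb3 R]_(x in @cube R) (vin x 0 i * phi (0, x)).
pose T (v F : vfield R) : R := \int[leb4 R]_(z in @slab R 2) (v z 0 i * Dt phi z) +
  \sum_j \int[leb4 R]_(z in @slab R 2) (v z 0 i * v z 0 j * Dx j phi z) +
  \int[leb4 R]_(z in @slab R 2) (F z 0 i * phi z).
(* The equation of the m-th flow; the right side is the same for all m because the initial datum is,
   so it survives in the limit. *)
have E m : T (flows m) (forces m) = - c.
  apply/eqP; rewrite -addr_eq0 /T -momentum_split//; apply/eqP.
  have := @flow_momentum R N waves sg smooth_waves waves_periodic (fun k => smooth_clock k ss)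
    (clock_start ss s0 s1) (clock_disjoint ss s0 s1) m.*2 phi i hphi.
  apply: etrans; congr (_ + _); apply: eq_Rintegral => x _; congr (_ * _).
  by rewrite -(flows_vin m).
have cv : (fun m => T (flows m) (forces m)) @ \oo --> T limit_flow limit_force.
  apply: cvgD; [apply: cvgD|].
  - by have h := limit_linear K2 ss s0 s1 C1 hC (sp_Dt sphi); exact: h.
  - rewrite big_ord3; under eq_fun do rewrite big_ord3.
    by apply: cvgD; [apply: cvgD|]; have h j := limit_quadratic K2 ss s0 s1 C1 hC (i := i) (j := j) sphi; exact: h.
  - have [B hB] := bsp sphi.
    apply: (@bdd_cvg_Rintegral _ _ _ _ _ _ _ (2 * (2 * (2 ^+ 8 * C)) * B)).
    + exact: measurable_slab.
    + exact: slaboo.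
    + by move=> m; apply/measurable_funTS/measurable_funM; [exact: mforces|exact: smooth_measurable sphi.1].
    + move=> m z zs; rewrite normrM ler_pM//; last exact: hB.
      exact: forces_le (slab_strip zs).
    + by move=> z _; apply: cvgM; [exact: forces_cvg|exact: cvg_cst].
rewrite momentum_split// -/(T limit_flow limit_force) -/c.
have cE : (fun m => T (flows m) (forces m)) = fun=> - c by apply/funext => m; exact: E.
rewrite cE in cv.
by rewrite (cvg_unique _ cv (cvg_cst (- c))) ?addNr.
Qed.

Lemma limit_divergence_free : divergence_free limit_flow.
Proof.
move=> phi ht; have [hphi _] := ht; have sphi := test0_sp hphi.
have E (v : vfield R) : vcond v ->
    \int[leb4 R]_(z in @slab R 2) (\sum_i v z 0 i * Dx i phi z) =
    \sum_i \int[leb4 R]_(z in @slab R 2) (v z 0 i * Dx i phi z).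
  by move=> hv; have [] := sum3 (fun j => I1 j hv (sp_Dx j sphi)).
have Z m : \sum_i \int[leb4 R]_(z in @slab R 2) (flows m z 0 i * Dx i phi z) = 0.
  rewrite -E//; apply: classical_divergence_free; last exact: ht.
  - by move=> i; exact: flows_smooth.
  - by move=> z; exact: flow_divergence_free.
have cv : (fun m => \sum_i \int[leb4 R]_(z in @slab R 2) (flows m z 0 i * Dx i phi z)) @ \oo -->
    \sum_i \int[leb4 R]_(z in @slab R 2) (limit_flow z 0 i * Dx i phi z).
  rewrite big_ord3; under eq_fun do rewrite big_ord3.
  by apply: cvgD; [apply: cvgD|]; have h j := limit_linear K2 ss s0 s1 C1 hC (sp_Dx j sphi); exact: h.
rewrite E// ; have ZE : (fun m => \sum_i \int[leb4 R]_(z in @slab R 2) (flows m z 0 i * Dx i phi z)) = fun=> 0.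
  by apply/funext.
rewrite ZE in cv.
exact: (cvg_unique _ cv (cvg_cst 0)).
Qed.

Lemma vector_in_Lp (v : vfield R) B p : (1 <= p)%E ->
  (forall j, measurable_fun (setT : set (mspacetime R)) (fun z => v z 0 j)) ->
  (forall z j, @slab R 2 z -> `|v z 0 j| <= B) -> 0 <= B ->
  in_Lp (leb4 R) (@slab R 2) p v.
Proof.
move=> p1 mv vB B0; split.
  by move=> i j; rewrite (ord1 i); exact: measurable_funTS.
apply: (@le_lt_trans _ _ ((2 * B) * 2)%:E); last exact: ltry.
apply: Lp_norm_le => //.
- exact: measurable_slab.
- exact: leb4_slab2_le.
- by rewrite ler1n.
- by rewrite mulr_ge0.
- by move=> z zs; apply: enorm_le => j; exact: vB.
Qed.

Lemma limit_flow_in_Lp p : (1 <= p)%E -> in_Lp (leb4 R) (@slab R 2) p limit_flow.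
Proof.
move=> p1; by apply: (@vector_in_Lp _ (2 * C)) => //; rewrite mulr_ge0.
Qed.

Lemma limit_euler_solution : euler_solution vin limit_force limit_flow.
Proof.
split.
- apply: classical_initial_datum; first by move=> i; exact: flows_smooth.
  by move=> z; exact: flow_divergence_free.
- split; first exact: limit_force_xperiodic.
  apply: (@vector_in_Lp _ (2 * (2 ^+ 8 * C))).
  + by rewrite lee_fin ler_pdivlMr// mul1r ler_nat.
  + exact: limit_force_measurable.
  + by move=> z j /slab_strip; exact: (limit_force_holder j).1.
  + by rewrite !mulr_ge0 ?exprn_ge0.
- split; first exact: limit_flow_xperiodic.
  by apply: limit_flow_in_Lp; rewrite lee_fin ler1n.
- exact: limit_divergence_free.
- by exists (fun=> 0); [exact: zero_pressure|exact: limit_momentum].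
Qed.

End EulerLimit.

(** * Vanishing viscosity *)

(** The largest admissible m is taken among those up to 1 / nu, which keeps the maximum finite. For
    fixed m the condition holds as soon as nu is small, however fast A grows, so the maximum tends
    to infinity. *)
Lemma slow_index {R : realType} (A : nat -> R) : exists Q : R -> nat,
  (forall nu, 0 < nu -> (0 < Q nu)%N -> nu * A (Q nu) <= 4^-1 ^+ Q nu) /\
  forall m, exists2 d : R, 0 < d & forall nu, 0 < nu < d -> (m <= Q nu)%N.
Proof.
pose B (nu : R) := (Num.truncn nu^-1).+1.
pose Q (nu : R) := \max_(m < B nu | nu * A m <= 4^-1 ^+ m) (m : nat).
(* A maximum over the empty set is 0, so the inequality is asserted only where [Q nu] is
   positive. *)
exists Q; split=> [nu nu0|m].
  apply: (big_ind (fun m => (0 < m)%N -> nu * A m <= 4^-1 ^+ m)) => [//|x y hx hy|i hi _ //].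
  by rewrite /maxn; case: ifP => _; [exact: hy|exact: hx].
exists (Num.min (4^-1 ^+ m / (`|A m| + 1)) m.+1%:R^-1).
  by rewrite lt_min divr_gt0 ?exprn_gt0 ?invr_gt0 ?ltr0n// ltr_wpDl.
move=> nu /andP[nu0]; rewrite lt_min => /andP[nu1 nu2].
have mB : (m < B nu)%N.
  rewrite /B ltnS; apply: (@leq_trans m.+1) => //.
  by rewrite truncn_ge_nat ?invr_ge0 ?(ltW nu0)// ltW// -[ltLHS]invrK ltf_pV2 ?posrE ?invr_gt0 ?ltr0n.
apply: (@leq_bigmax_cond _ (fun m : 'I_(B nu) => nu * A m <= 4^-1 ^+ m) (fun m => m : nat) (Ordinal mB)).
move: nu1; rewrite ltr_pdivlMr ?ltr_wpDl// => /ltW; apply: le_trans.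
by rewrite ler_wpM2l ?(ltW nu0)// (le_trans (ler_norm _))// lerDl.
Qed.

Lemma at_right0_near {R : realType} (P : R -> Prop) (d : R) : 0 < d ->
  (forall nu, 0 < nu < d -> P nu) -> \forall nu \near 0^'+, P nu.
Proof.
move=> d0 hP; near=> nu; apply: hP; apply/andP; split; near: nu.
  exact: nbhs_right_gt.
exact: nbhs_right_lt.
Unshelve. all: by end_near. Qed.

(** A supremum over the empty set would be -oo; two distinct points of the strip exclude this for
    both suprema. *)
Lemma holder_norm_strip_ge0 {R : realType} (a : R) (f : vfield R) :
  (0 <= holder_norm (@strip R) a f)%E.
Proof.
pose z : spacetime R := (1, 0); pose w : spacetime R := (2^-1, 0).
have zs : strip z by split; rewrite //= in_itv /= ltr01 ltr1n.
have ws : strip w by split; rewrite //= in_itv /=; apply/andP; split; lra.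
rewrite /holder_norm; apply: adde_ge0.
  apply: (@le_trans _ _ (enorm (f z))%:E); first by rewrite lee_fin enorm_ge0.
  by apply: ereal_sup_ubound; exists z.
apply: (@le_trans _ _ (enorm (f z - f w) / `|z - w| `^ a)%:E).
  by rewrite lee_fin divr_ge0 ?enorm_ge0 ?powR_ge0.
apply: ereal_sup_ubound; exists (z, w) => //=; split=> //=.
by apply/eqP => -[] /eqP; rewrite eq_sym invr_eq1 => /eqP h; have := @ltr1n R 2; rewrite h ltxx.
Qed.

(** * The family of viscous solutions *)

Section ViscousFamily.
Context {R : realType}.
Variables (K : nat) (s : R -> R).
Hypothesis K2 : (2 <= K)%N.
Hypothesis ss : smooth_on setT s.
Hypothesis s0 : forall x, x <= 0 -> s x = 0.
Hypothesis s1 : forall x, 1 <= x -> s x = 1.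
Variables (C : R) (C1 : 1 <= C).
Hypothesis hC : forall x, [/\ `|'D_(1 : R) s x| <= C, `|'D_(1 : R) ('D_(1 : R) s) x| <= C &
  `|'D_(1 : R) ('D_(1 : R) ('D_(1 : R) s)) x| <= C].

Local Notation N := (frequency K).
Local Notation sg := (clock s).
Local Notation flows := (flows K s).
Local Notation forces := (forces K s).
Local Notation limit_flow := (limit_flow K s).
Local Notation limit_force := (limit_force K s).
Local Notation homogenized := (homogenized K s).

Let N1 := frequency_ndecr K.
Let d01 := @defect01 R.
Let s_end := clock_end s1.
Let err q := @mixing_error R _ q K2.
Let C2 : 1 <= 2 * C.
Proof. by apply: (le_trans C1); rewrite ler_peMl ?ler1n// (le_trans _ C1). Qed.

Variables (alpha : R) (ha : 0 < alpha < 1).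
Hypothesis hK : 11 <= 2 * (1 - alpha) * K%:R.

Local Notation v0 := limit_flow.
Local Notation F0 := limit_force.
Local Notation v_in := (vin K s).

Let hfl m i := flows_smooth K ss m i.

Lemma smooth_vector_holder (F : vfield R) : (forall i, smooth_periodic (vcomp F i)) ->
  exists2 A, 0 <= A & forall i, holder_le (@strip R) alpha (fun z => F z 0 i) A.
Proof.
move=> hF; have /choice[c hc] : forall i, exists c, holder_le (@strip R) alpha (fun z => F z 0 i) c.
  by move=> i; exact: smooth_holder ha (hF i).1 (hF i).2.
exists (\sum_i `|c i|); first by apply: sumr_ge0.
move=> i; apply: holder_leW (hc i); rewrite (le_trans (ler_norm _))//.
by rewrite (bigD1 i)//= lerDl sumr_ge0.
Qed.

(** These bounds come without control in m; they determine how slowly the number of stages may grow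
    as nu tends to 0. *)
Lemma laplacian_bounds : exists A : nat -> R, forall m, 0 <= A m /\
  forall i, holder_le (@strip R) alpha (laplacian (vcomp (flows m) i)) (A m).
Proof.
suff /choice[A hA] : forall m, exists a, 0 <= a /\
  forall i, holder_le (@strip R) alpha (laplacian (vcomp (flows m) i)) a by exists A.
move=> m; pose F : vfield R := fun z => \row_i laplacian (vcomp (flows m) i) z.
have FE i : vcomp F i = laplacian (vcomp (flows m) i) by apply/funext => z; rewrite /vcomp mxE.
have [|A A0 hA] := @smooth_vector_holder F.
  by move=> i; rewrite FE; exact: sp_laplacian.
by exists A; split=> // i; have := hA i; rewrite -[X in holder_le _ _ X]/(vcomp F i) FE.
Qed.

Variables (A : nat -> R) (Q : R -> nat).
Hypothesis hA : forall m, 0 <= A m /\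
  forall i, holder_le (@strip R) alpha (laplacian (vcomp (flows m) i)) (A m).
Hypothesis hQ : forall nu, 0 < nu -> (0 < Q nu)%N -> nu * A (Q nu) <= 4^-1 ^+ Q nu.
Hypothesis Qoo : forall m, exists2 d : R, 0 < d & forall nu, 0 < nu < d -> (m <= Q nu)%N.

Definition viscous_flow nu : vfield R := flows (Q nu).
Definition viscous_force nu : vfield R := ns_force N waves sg nu (Q nu).*2.

Lemma viscous_suitable nu : suitable_leray_hopf nu v_in (viscous_force nu) (viscous_flow nu).
Proof.
rewrite -(flows_vin K ss s0 s1 (Q nu)).
exact: (@flow_suitable R N waves sg smooth_waves waves_periodic (fun k => smooth_clock k ss)
  (clock_start ss s0 s1) (clock_disjoint ss s0 s1) nu (Q nu).*2).
Qed.

Let D : R := 2 * (2 ^+ 8 * C) + 1.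
Let D0 : 0 <= D.
Proof. by rewrite addr_ge0// !mulr_ge0 ?exprn_ge0// (le_trans _ C1). Qed.

(** The error consists of the tail of the force series, a multiple of 4^-Q, and of nu times a
    Laplacian, which the choice of Q keeps below 4^-Q; this is the summand 1 in [D]. *)
Lemma viscous_force_near nu j : 0 < nu -> (0 < Q nu)%N -> holder_le (@strip R) alpha
  (fun z => (viscous_force nu z - F0 z) 0 j) (D * 4^-1 ^+ Q nu).
Proof.
move=> nu0 Q0.
have h1 := holder_leZ (-1) (limit_force_near K2 ss s0 s1 C1 hC ha hK (Q nu) j).
have h2 := holder_leZ (- nu) ((hA (Q nu)).2 j).
have := holder_leD h1 h2.
rewrite normrN1 mul1r normrN (gtr0_norm nu0) => h.
have E : (fun z => (viscous_force nu z - F0 z) 0 j) =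
  fun z => -1 * (F0 z 0 j - forces (Q nu) z 0 j) + - nu * laplacian (vcomp (flows (Q nu)) j) z.
  apply/funext => z; rewrite mxE [viscous_force _ _ _ _]mxE [(- F0 z) _ _]mxE.
  rewrite -[euler_force _ _ _ _ _ _ _]/(forces (Q nu) z 0 j).
  rewrite -[vcomp (flow _ _ _ _) j]/(vcomp (flows (Q nu)) j).
  by move: (forces _ _ _ _) (F0 _ _ _) (laplacian _ _) => *; ring.
rewrite E; apply: holder_leW h.
apply: (@le_trans _ _ (2 * (2 ^+ 8 * C) * 4^-1 ^+ Q nu + 4^-1 ^+ Q nu)).
  by rewrite lerD2l; exact: hQ.
by rewrite /D [leRHS]mulrDl mul1r.
Qed.

Let strip0 : @strip R !=set0.
Proof. by exists (1, 0); split; rewrite //= in_itv /= ltr01 ltr1n. Qed.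

Lemma viscous_force_holder_norm nu : 0 < nu -> (0 < Q nu)%N ->
  (holder_norm (@strip R) alpha (fun z => (viscous_force nu z - F0 z)%R) <= (4 * (D * 4^-1 ^+ Q nu))%R%:E)%E.
Proof.
by move=> nu0 Q0; apply: holder_norm_le => // j; exact: viscous_force_near.
Qed.

Lemma Q_cvg : Q @ 0^'+ --> \oo.
Proof.
move=> P [m _ hm]; have [d d0 hd] := Qoo m.
by apply: (at_right0_near d0) => nu /hd; exact: hm.
Qed.

Let e0 (c : R) : (fun nu => (c * 4^-1 ^+ Q nu)%:E) @ 0^'+ --> 0%E.
Proof.
have g0 : (fun m => c * 4^-1 ^+ m) @ \oo --> (0 : R).
  by apply: cvg_geometric; rewrite ger0_norm ?invf_lt1// ltr1n.
by apply: cvg_EFin; [exact: nearW|exact: (@cvg_comp _ _ _ Q (fun m => c * 4^-1 ^+ m) _ _ _ Q_cvg g0)].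
Qed.

Let cvg0E (h : R -> \bar R) c : (forall nu, (0 <= h nu)%E) ->
  (forall nu, 0 < nu -> (0 < Q nu)%N -> (h nu <= (c * 4^-1 ^+ Q nu)%:E)%E) ->
  h @ 0^'+ --> 0%E.
Proof.
move=> h0 hc; apply: (squeeze_cvge _ (cvg_cst 0%E) (e0 c)).
have [d d0 hd] := Qoo 1.
by apply: (at_right0_near d0) => nu nud; rewrite h0 hc ?hd//; case/andP: nud.
Qed.

Lemma viscous_force_cvg :
  (fun nu => holder_norm (@strip R) alpha (fun z => viscous_force nu z - F0 z)) @ 0^'+ --> 0%E.
Proof.
apply: (@cvg0E _ (4 * D)) => nu; first exact: holder_norm_strip_ge0.
by move=> nu0 Q0; rewrite -mulrA; exact: viscous_force_holder_norm.
Qed.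

Lemma viscous_force_cvg12 :
  (fun nu => LpLq_norm 1%:E 2%:E (fun z => viscous_force nu z - F0 z)) @ 0^'+ --> 0%E.
Proof.
apply: (@cvg0E _ (2 * D * 2)) => nu; first exact: Lnorm_ge0.
move=> nu0 Q0; have B0 : 0 <= D * 4^-1 ^+ Q nu by rewrite mulr_ge0 ?exprn_ge0.
have -> : 2 * D * 2 * 4^-1 ^+ Q nu = 2 * (D * 4^-1 ^+ Q nu) * 2.
  by move: (4^-1 ^+ _) => e; ring.
apply: LpLq_norm_le.
- by rewrite mulr_ge0.
- by [].
- by rewrite lee_fin ler1n.
move=> t x t02; apply: enorm_le => j; apply: (viscous_force_near j nu0 Q0).1.
by split; rewrite //= in_itv.
Qed.

Lemma viscous_weak phi i : test phi ->
  (fun q => \int[leb4 R]_(z in @slab R 2) (viscous_flow q.+1%:R^-1 z 0 i * phi z)) @ \oo -->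
  \int[leb4 R]_(z in @slab R 2) (v0 z 0 i * phi z).
Proof.
move=> [/test0_sp hphi _].
have h := limit_linear K2 ss s0 s1 C1 hC hphi (j := i).
have Qq : (fun q : nat => Q q.+1%:R^-1) @ \oo --> \oo.
  move=> P [m _ hm]; have [d d0 hd] := Qoo m.
  have [k hk] : exists k : nat, d^-1 < k%:R by exists (Num.truncn d^-1).+1; exact: truncnS_gt.
  exists k => // q /= kq; apply: hm; apply: hd; rewrite invr_gt0 ltr0n /=.
  rewrite -[ltRHS]invrK ltf_pV2 ?posrE ?invr_gt0 ?ltr0n//; apply: (lt_le_trans hk).
  by rewrite ler_nat ltnW.
exact: (@cvg_comp _ _ _ (fun q : nat => Q q.+1%:R^-1) (fun m => \int[leb4 R]_(z in @slab R 2) (flows m z 0 i * phi z)) _ _ _ Qq h).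
Qed.

Lemma viscous_bounded nu p : (1 <= p)%E ->
  (Lp_norm (leb4 R) (@slab R 2) p (viscous_flow nu) <= (2 * (2 * C) * 2)%:E)%E.
Proof.
move=> p1; apply: Lp_norm_le => //.
- exact: measurable_slab.
- exact: leb4_slab2_le.
- by rewrite ler1n.
- by rewrite !mulr_ge0// (le_trans _ C1).
- by move=> z _; apply: enorm_le => j; exact: (flows_le K2 ss C1 hC).
Qed.

(** The initial datum does not depend on nu, the forces satisfy the second alternative, convergence
    in L^1 L^2, and nu = 1 / (q + 1) is the sequence of viscosities. *)
Lemma viscous_sequence : vanishing_viscosity_sequence v_in F0 v0 (fun=> v_in) viscous_force viscous_flow.
Proof.
split.
- have -> : (fun=> Lp_norm (leb3 R) (@cube R) 2%:E (fun x => v_in x - v_in x)) = fun _ : R => 0%E.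
    apply/funext => nu; apply/eqP; rewrite eq_le Lnorm_ge0 andbT.
    have -> : 0%E = (0 * 1)%:E :> \bar R by rewrite mul0r.
    apply: Lp_norm_le => //.
    + exact: measurable_cube.
    + exact: leb3_cube_le.
    + by move=> x _; rewrite subrr (le_trans (enorm_le (c := 0) _))// ?mulr0// => j; rewrite mxE normr0.
    + by rewrite lee_fin ler1n.
  exact: cvg_cst.
- move=> nu nu0; split; first exact: viscous_suitable.
  by apply: smooth_in_Lp; [rewrite lee_fin ler1n|move=> i; exact: hfl].
- exists (fun q => q.+1%:R^-1); split.
  + by move=> q; rewrite invr_gt0 ltr0n.
  + exact: cvg_harmonic.
  + by move=> phi i; exact: viscous_weak.
- by right; exact: viscous_force_cvg12.
Qed.

(** At times t >= 1 the third components differ by at least 1/8 on a set of measure at least 1/16,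
    which bounds all the norms from below by the same product. *)
Lemma viscous_far nu p : (1 <= p)%E ->
  ((8^-1 * 16^-1)%:E <= Lp_norm (leb4 R) (@slab R 2) p (fun z => (viscous_flow nu z - v0 z)%R))%E.
Proof.
move=> p1.
have [mB Bge] := mixed_far_set (frequency_ndecr K) (@defect01 R) (clock_end s1)
  (fun q => @mixing_error R _ q K2) (Q nu).*2 (@late_interval R) (@leb1_late R).
have sub z : box (@late R) z -> @slab R 2 z by rewrite slab_split; right.
apply: (Lnorm_ge mB _ _ Bge) => //.
- by rewrite invr_gt0 ltr0n invf_le1 ?ler1n ?ltr0n.
- by move=> z; rewrite patchE; case: ifP => _//; rewrite lee_fin enorm_ge0.
- move=> z [zl zB]; rewrite patchE mem_set; last exact: sub.
  rewrite lee_fin; apply: le_trans (coord_le_enorm _ (Ordinal (isT : (2 < 3)%N))).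
  have z1 : 1 <= z.1 by case: zl; rewrite /late /= in_itv /= => /andP[].
  by rewrite mxE [(- v0 z) _ _]mxE flows_late// limit_flow_late.
Qed.

Lemma viscous_force_finite nu : (holder_norm (@strip R) alpha (viscous_force nu) < +oo)%E.
Proof.
have [|B B0 hB] := @smooth_vector_holder (viscous_force nu).
  by move=> i; exact: (@ns_force_smooth_periodic R N waves sg smooth_waves waves_periodic (fun k => smooth_clock k ss) nu (Q nu).*2 i).
apply: (@le_lt_trans _ _ (4 * B)%:E); last exact: ltry.
exact: holder_norm_le.
Qed.

End ViscousFamily.

Theorem corollary7p2 (R : realType) (alpha : R) (halpha : 0 < alpha < 1) :
  exists (v0 : vfield R) (vin : sfield R) (F0 : vfield R),
    [/\ weak_physical_solution vin F0 v0,
        in_Lp (leb4 R) (@slab R 2) +oo%E v0,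
        forall i, smooth_on setT (fun x => vin x 0 i)
      & (holder_norm (@strip R) alpha F0 < +oo)%E] /\
    exists2 eps : R, 0 < eps &
    exists (vinn : R -> sfield R) (Fn vn : R -> vfield R),
      [/\ vanishing_viscosity_sequence vin F0 v0 vinn Fn vn,
          forall nu, 0 < nu ->
            forall i, smooth_on (@strip R) (fun z => vn nu z 0 i),
          (ereal_sup [set Lp_norm (leb4 R) (@slab R 2) +oo%E (vn nu)
                     | nu in [set nu : R | (0 < nu)%R]] < +oo)%E,
          (forall nu, 0 < nu -> (holder_norm (@strip R) alpha (Fn nu) < +oo)%E)
          /\ (fun nu => holder_norm (@strip R) alpha
                          (fun z => Fn nu z - F0 z)) @ 0^'+ --> 0%E
        & forall (nu : R) (p : \bar R), 0 < nu -> (1%:E <= p)%E ->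
            (eps%:E <= Lp_norm (leb4 R) (@slab R 2) p
                         (fun z => (vn nu z - v0 z)%R))%E].
Proof.
have [s [ss s0 s1]] := @smooth_step R.
have [C C1 hC] := stage_bounds ss s0 s1.
have a1 : 0 < 2 * (1 - alpha) by rewrite mulr_gt0// subr_gt0; case/andP: halpha.
(* Adding 2 to the integer part ensures K >= 2 together with K >= 11 / (2 (1 - alpha)). *)
pose K := (Num.truncn (11 / (2 * (1 - alpha)))).+2.
have K2 : (2 <= K)%N by [].
have hK : 11 <= 2 * (1 - alpha) * K%:R.
  rewrite mulrC -ler_pdivrMr// (le_trans (ltW (truncnS_gt _)))// ler_nat.
  exact: leqnSn.
have [A hA] := laplacian_bounds K ss halpha.
have [Q [hQ Qoo]] := slow_index A.
have V := viscous_sequence K2 ss s0 s1 C1 hC halpha hK hA hQ Qoo.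
exists (limit_flow K s), (vin K s), (limit_force K s); split.
  split.
  - split; first by have h := limit_euler_solution K2 ss s0 s1 C1 hC halpha hK; exact: h.
    by exists (fun=> vin K s), (viscous_force K s Q), (viscous_flow K s Q).
  - by apply: (limit_flow_in_Lp K2 ss s0 s1 C1 hC); rewrite leey.
  - by move=> i; exact: smooth_slice (flows_smooth K ss 0 i).1.
  - apply: (@le_lt_trans _ _ (4 * (2 * (2 ^+ 8 * C)))%:E); last exact: ltry.
    apply: holder_norm_le.
      by exists (1, 0); split; rewrite //= in_itv /= ltr01 ltr1n.
    by have h := limit_force_holder K2 ss s0 s1 C1 hC halpha hK; exact: h.
exists (8^-1 * 16^-1); first by rewrite mulr_gt0.
exists (fun=> vin K s), (viscous_force K s Q), (viscous_flow K s Q); split.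
- exact: V.
- by move=> nu _ i k; apply: Ck_setT; exact: (flows_smooth K ss (Q nu) i).1.
- apply: (@le_lt_trans _ _ (2 * (2 * C) * 2)%:E); last exact: ltry.
  by apply: ub_ereal_sup => _ [nu _ <-]; apply: (viscous_bounded K2 ss C1 hC); rewrite leey.
- split; first by move=> nu _; exact: viscous_force_finite.
  by have h := viscous_force_cvg K2 ss s0 s1 C1 hC halpha hK hA hQ Qoo; exact: h.
- by move=> nu p _ p1; exact: viscous_far.
Qed.
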